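(* There are absolute constants $C,C'>0$ such that the following holds. Let $d,k\in\mathbb{N}$, $z\ge1$, let $X=\{x_1,\dots,x_n\}\subset\mathbb{R}^d$ be any set of points, and let $F\subset\mathbb{R}^d$ be an optimal $(k,z)$-flat approximation of $X$, i.e. a $k$-flat in $\mathbb{R}^d$ minimizing $\mathrm{cost}_z(X,\cdot)$ over all $k$-flats in $\mathbb{R}^d$. Let $\varepsilon\in(0,1)$ and $$t\ \ge\ C\cdot\frac{z\,k^2\,(1+\log(k/\varepsilon))^{C'}}{\varepsilon^3}.$$ Then with probability at least $0.9$ over the draw of $\Pi\sim\mathcal{J}_{d,t}$, $$\frac{1}{1+\varepsilon}\,\mathrm{cost}_z(X,F)\ \le\ \min_{F'\ \text{a $k$-flat in }\mathbb{R}^t}\mathrm{cost}_z(\Pi(X),F')\ \le\ (1+\varepsilon)\,\mathrm{cost}_z(X,F).$$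
   Context: $\mathcal{J}_{d,t}$ denotes the distribution of the linear map $\Pi:\mathbb{R}^d\to\mathbb{R}^t$, $x\mapsto Gx$, where $G$ is a $t\times d$ matrix with i.i.d. $\mathcal{N}(0,1/t)$ entries. A $k$-flat in $\mathbb{R}^m$ is an affine subspace $F=\{\tau+y: y\in R\}$ with $R$ a linear subspace of dimension at most $k$ and $\tau\in\mathbb{R}^m$; $\rho_F(x)$ is the closest point of $F$ to $x$, and for finite $Y\subset\mathbb{R}^m$, $\mathrm{cost}_z(Y,F)=\big(\sum_{y\in Y}\|y-\rho_F(y)\|_2^z\big)^{1/z}$. The paper writes the bound on $t$ as $t\gtrsim z k^2\,\mathrm{polylog}(k/\varepsilon)/\varepsilon^3$. *)

(* Defs.v *)
From HB Require Import structures.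
From mathcomp Require Import all_boot all_order all_algebra.
From mathcomp Require Import all_classical all_reals all_analysis.
Set Implicit Arguments.
Unset Strict Implicit.
Unset Printing Implicit Defensive.
Import Order.TTheory GRing.Theory Num.Theory.
Import numFieldNormedType.Exports.
Local Open Scope classical_set_scope.
Local Open Scope ring_scope.

(* The canonical norm `|x| on matrices is the sup norm, hence this one. *)
Definition l2norm (R : realType) (m : nat) (x : 'cV[R]_m) : R :=
  Num.sqrt (\sum_(i < m) x i 0 ^+ 2).

Definition is_flat (R : realType) (m k : nat) (F : set 'cV[R]_m) : Prop :=
  exists (tau : 'cV[R]_m) (V : {vspace 'cV[R]_m}),
    (\dim V <= k)%N /\ F = [set tau + y | y in [set` V]].

Definition is_closest (R : realType) (m : nat) (F : set 'cV[R]_m)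
    (x p : 'cV[R]_m) : Prop :=
  F p /\ forall q, F q -> l2norm (x - p) <= l2norm (x - q).

(* The default value 0 is only returned when F has no point closest to x,
   which never happens for a flat. *)
Definition closest (R : realType) (m : nat) (F : set 'cV[R]_m)
    (x : 'cV[R]_m) : 'cV[R]_m :=
  xget 0 [set p | is_closest F x p].

(* Meant for finite Y: the sum ranges over Y as a set, without multiplicity. *)
Definition cost (R : realType) (m : nat) (z : R) (Y F : set 'cV[R]_m) : R :=
  (\sum_(y \in Y) l2norm (y - closest F y) `^ z) `^ z^-1.

Definition is_optimal_flat (R : realType) (m k : nat) (z : R)
    (Y F : set 'cV[R]_m) : Prop :=
  is_flat k F /\ forall F', is_flat k F' -> cost z Y F <= cost z Y F'.

Definition mutually_independent (R : realType) (disp : measure_display)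
    (T : measurableType disp) (P : probability T R) (I : finType)
    (X : I -> {RV P >-> R}) : Prop :=
  forall (J : {set I}) (A : I -> set R), (forall i, measurable (A i)) ->
    P (\bigcap_(i in [set` J]) (X i @^-1` A i)) =
    (\prod_(i in J) P (X i @^-1` A i))%E.

(* The second parameter of normal_prob is the standard deviation. Laws are
   compared on measurable sets only: normal_prob, being an integral, and P
   carry no meaning elsewhere. *)
Definition iid_gaussian_entries (R : realType) (disp : measure_display)
    (T : measurableType disp) (P : probability T R) (d t : nat)
    (G : 'I_t -> 'I_d -> {RV P >-> R}) : Prop :=
  (forall i j (A : set R), measurable A ->
     distribution P (G i j) A = normal_prob 0 (Num.sqrt t%:R^-1) A) /\
  mutually_independent (fun ij : 'I_t * 'I_d => G ij.1 ij.2).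

(* The sample at w of the random linear map x |-> G x; it has law J_{d,t} when
   iid_gaussian_entries G holds. *)
Definition random_map (R : realType) (disp : measure_display)
    (T : measurableType disp) (P : probability T R) (d t : nat)
    (G : 'I_t -> 'I_d -> {RV P >-> R}) (w : T) (x : 'cV[R]_d) : 'cV[R]_t :=
  (\matrix_(i < t, j < d) G i j w) *m x.

(* Main.v *)
(* The upper bound is Markov's inequality: the image of F is a k-flat, and the
   z-th moments of the norms of Gaussian images exceed their targets with
   exponentially small probability.

   For the lower bound, a union bound over all flats of R^t is replaced by one
   over short sequences of data points. Each point x carries the weight K(x)^z,
   where K(x) bounds the ratio of the distance of x to the cost of X over all
   k-flats; the total weight depends on k and z only. Suppose that a k-flat F'
   of R^t costs less than cost(X, F)/(1 + eps), and let ws be a list of vectors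
   spanning F. Lifting F' through G to the span of ws gives a k-flat of R^d,
   whose cost is at least cost(X, F). As long as G is nearly isometric on the
   span of ws and x for most x, some such x is therefore farther from the lifted
   flat than Gx is from F'; moving x into ws multiplies det(1 + c P Q P) by at
   most 1 - e/2, where Q projects off the span of G ws and P projects onto the
   part of F' off the initial span. This
   determinant is at least 1 and initially at most (1 + c)^(k+1), so after J
   steps, about (k/e) log(1/e), the sequence must have met a set of large weight
   of points x for which G distorts the span of ws and x. By Markov's inequality
   for the weights, applied J times, this has small probability, independently
   of the number of points.

   The cost of the image ignores multiplicities, but G is almost surely
   injective on X. *)
Require Import Defs.
From HB Require Import structures.
From mathcomp Require Import all_boot all_order all_algebra.
From mathcomp Require Import all_classical all_reals all_analysis.
From mathcomp Require Import measurable_realfun.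
From mathcomp Require Import ring lra.
Set Implicit Arguments.
Unset Strict Implicit.
Unset Printing Implicit Defensive.
Import Order.TTheory GRing.Theory Num.Theory.
Import numFieldNormedType.Exports.
Local Open Scope classical_set_scope.
Local Open Scope ring_scope.

(** * Inner products and Gram-Schmidt projections *)

(** A net over the [k]-flats of [R^t] has a size exponential in [k t], more than a tail of order
    [exp(- eps^2 t)] can pay for. The event [bad_iter] mentions no flat at all: an offending flat
    only serves to show that the event occurs, so all flats are treated at once. The price of that
    event is as follows, with [L = 1 + ln (k / eps)]. The grid on the span of at most [k + 1 + J]
    vectors contributes an exponent of order [J L]. The [J] Markov steps contribute [J] times the
    logarithm of the total weight over the accuracy; since the total weight is at most
    [3^((k + 2) z)], this is of order [J (L + k z)]. As [J] is of order [k L / eps], comparison with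
    [eps^2 t] leads to [t] of order [z k^2 L^2 / eps^3]. A determinant serves as potential because
    rank-one updates multiply it and its lower bound 1 does not depend on [t]. The accuracy is
    [e = eps / 8], because the descent loses a factor [1 + 8 e]. *)

Section InnerProduct.
Variables (R : realType) (n : nat).
Implicit Types (x y u v : 'cV[R]_n) (M : 'M[R]_n).

Definition dot x y : R := \sum_(i < n) x i 0 * y i 0.

Lemma dotC x y : dot x y = dot y x.
Proof. by apply: eq_bigr => i _; rewrite mulrC. Qed.

Lemma mx11_dot x y : x^T *m y = (dot x y)%:M.
Proof.
apply/matrixP => i j; rewrite !ord1 !mxE eqxx mulr1n.
by apply: eq_bigr => k _; rewrite !mxE.
Qed.

Lemma dotDl x y v : dot (x + y) v = dot x v + dot y v.
Proof. by rewrite -big_split; apply: eq_bigr => i _; rewrite !mxE mulrDl. Qed.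

Lemma dotDr x y v : dot v (x + y) = dot v x + dot v y.
Proof. by rewrite dotC dotDl !(dotC v). Qed.

Lemma dotZl a x y : dot (a *: x) y = a * dot x y.
Proof. by rewrite mulr_sumr; apply: eq_bigr => i _; rewrite !mxE mulrA. Qed.

Lemma dotZr a x y : dot x (a *: y) = a * dot x y.
Proof. by rewrite dotC dotZl dotC. Qed.

Lemma dotNl x y : dot (- x) y = - dot x y.
Proof. by rewrite -scaleN1r dotZl mulN1r. Qed.

Lemma dotNr x y : dot x (- y) = - dot x y.
Proof. by rewrite dotC dotNl dotC. Qed.

Lemma dotBl x y v : dot (x - y) v = dot x v - dot y v.
Proof. by rewrite dotDl dotNl. Qed.

Lemma dotBr x y v : dot v (x - y) = dot v x - dot v y.
Proof. by rewrite dotDr dotNr. Qed.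

Lemma dot0l x : dot 0 x = 0.
Proof. by rewrite -(scale0r x) dotZl mul0r. Qed.

Lemma dot0r x : dot x 0 = 0.
Proof. by rewrite dotC dot0l. Qed.

Lemma dot_suml (I : Type) (r : seq I) (P : pred I) (f : I -> 'cV[R]_n) y :
  dot (\sum_(i <- r | P i) f i) y = \sum_(i <- r | P i) dot (f i) y.
Proof.
elim: r => [|i r IH]; first by rewrite !big_nil dot0l.
by rewrite !big_cons; case: (P i); rewrite ?dotDl IH.
Qed.

Lemma dot_ge0 x : 0 <= dot x x.
Proof. by apply: sumr_ge0 => i _; rewrite -expr2 sqr_ge0. Qed.

Lemma dot_eq0 x : (dot x x == 0) = (x == 0).
Proof.
apply/eqP/eqP => [h|->]; last exact: dot0l.
apply/matrixP => i j; rewrite ord1 mxE; apply/eqP.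
move/eqP: h; rewrite psumr_eq0 => [/allP/(_ i)|k _]; last by rewrite -expr2 sqr_ge0.
by rewrite mem_index_enum => /(_ isT); rewrite mulf_eq0 orbb.
Qed.

Lemma dot_gt0 x : (0 < dot x x) = (x != 0).
Proof. by rewrite lt_def dot_ge0 andbT dot_eq0. Qed.

Lemma l2normE x : l2norm x = Num.sqrt (dot x x).
Proof. by congr Num.sqrt; apply: eq_bigr => i _; rewrite expr2. Qed.

Lemma l2norm_ge0 x : 0 <= l2norm x.
Proof. exact: sqrtr_ge0. Qed.

Lemma sqr_l2norm x : l2norm x ^+ 2 = dot x x.
Proof. by rewrite l2normE sqr_sqrtr // dot_ge0. Qed.

Lemma l2norm_eq0 x : (l2norm x == 0) = (x == 0).
Proof. by rewrite l2normE sqrtr_eq0 -dot_eq0 eq_le dot_ge0 andbT. Qed.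

Lemma l2norm0 : l2norm (0 : 'cV[R]_n) = 0.
Proof. by apply/eqP; rewrite l2norm_eq0. Qed.

Lemma l2normN x : l2norm (- x) = l2norm x.
Proof. by rewrite !l2normE dotNl dotNr opprK. Qed.

Lemma l2normZ a x : l2norm (a *: x) = `|a| * l2norm x.
Proof.
by rewrite !l2normE dotZl dotZr mulrA -expr2 sqrtrM ?sqr_ge0// sqrtr_sqr.
Qed.

Lemma CauchySchwarz_sqr x y : dot x y ^+ 2 <= dot x x * dot y y.
Proof.
have [->|y0] := eqVneq y 0; first by rewrite !dot0r mulr0 expr0n.
have yy : 0 < dot y y by rewrite dot_gt0.
have := dot_ge0 (dot y y *: x - dot x y *: y).
rewrite !dotBl !dotBr !dotZl !dotZr (dotC y x) => h.
have : 0 <= dot y y * (dot x x * dot y y - dot x y ^+ 2) by move: h; lra.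
by rewrite pmulr_rge0// subr_ge0.
Qed.

Lemma CauchySchwarz x y : `|dot x y| <= l2norm x * l2norm y.
Proof.
rewrite -(@ler_pXn2r _ 2)// ?nnegrE ?mulr_ge0 ?l2norm_ge0//.
by rewrite exprMn !sqr_l2norm real_normK ?num_real// CauchySchwarz_sqr.
Qed.

Lemma l2normD x y : l2norm (x + y) <= l2norm x + l2norm y.
Proof.
rewrite -(@ler_pXn2r _ 2)// ?nnegrE ?addr_ge0 ?l2norm_ge0//.
rewrite sqrrD !sqr_l2norm dotDl !dotDr (dotC y x).
have := le_trans (ler_norm _) (CauchySchwarz x y); lra.
Qed.

Lemma l2normB x y : l2norm (x - y) <= l2norm x + l2norm y.
Proof. by rewrite -(l2normN y) l2normD. Qed.

Lemma l2norm_sum (I : Type) (r : seq I) (f : I -> 'cV[R]_n) :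
  l2norm (\sum_(i <- r) f i) <= \sum_(i <- r) l2norm (f i).
Proof.
elim: r => [|i r IH]; first by rewrite !big_nil l2norm0.
by rewrite !big_cons (le_trans (l2normD _ _))// lerD2l.
Qed.

Lemma dot_mulmx_tr M x y : dot (M *m x) y = dot x (M^T *m y).
Proof.
have : (dot (M *m x) y)%:M = (dot x (M^T *m y))%:M :> 'M[R]_1.
  by rewrite -!mx11_dot trmx_mul mulmxA.
by move/matrixP => /(_ 0 0); rewrite !mxE eqxx !mulr1n.
Qed.

Lemma outer_mul m (x : 'cV[R]_m) y v : (x *m y^T) *m v = dot y v *: x.
Proof. by rewrite -mulmxA mx11_dot mul_mx_scalar. Qed.

End InnerProduct.

(* [gsproj vs] is the orthogonal projection onto the complement of the span of
   [vs]; as [0^-1 = 0], no case distinction is needed when [v] already lies in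
   the span of [vs']. *)
Fixpoint gsproj (R : realType) (n : nat) (vs : seq 'cV[R]_n) : 'M[R]_n :=
  if vs is v :: vs' then
    let Q := gsproj vs' in let u := Q *m v in
    Q - (dot u u)^-1 *: (u *m u^T)
  else 1%:M.

(* The normalised Gram-Schmidt vectors, dependent vectors giving [0]. *)
Fixpoint gsvec (R : realType) (n : nat) (vs : seq 'cV[R]_n) : seq 'cV[R]_n :=
  if vs is v :: vs' then
    let u := gsproj vs' *m v in (l2norm u)^-1 *: u :: gsvec vs'
  else [::].

Section GramSchmidt.
Variables (R : realType) (n : nat).
Implicit Types (x y u v : 'cV[R]_n) (M : 'M[R]_n) (vs : seq 'cV[R]_n).

Lemma gsproj_tr vs : (gsproj vs)^T = gsproj vs.
Proof.
elim: vs => [|v vs IH] /=; first by rewrite trmx1.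
by rewrite linearB /= linearZ /= trmx_mul trmxK IH.
Qed.

Lemma gsproj_idem vs : gsproj vs *m gsproj vs = gsproj vs.
Proof.
elim: vs => [|v vs IH] /=; first by rewrite mulmx1.
set Q := gsproj vs in IH *; set u := Q *m v.
have Qu : Q *m u = u by rewrite mulmxA IH.
have uQ : u^T *m Q = u^T by rewrite -[Q in LHS]gsproj_tr -trmx_mul -/Q Qu.
rewrite mulmxBl !mulmxBr IH -!scalemxAl -!scalemxAr mulmxA Qu -(mulmxA u) uQ.
have -> : u *m u^T *m (u *m u^T) = dot u u *: (u *m u^T).
  by rewrite mulmxA outer_mul scalemxAl.
have [u0|u0] := eqVneq (dot u u) 0; first by rewrite u0 invr0 !scale0r !subr0.
by rewrite [_ *: (dot u u *: _)]scalerA mulVf// scale1r subrr subr0.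
Qed.

Lemma gsprojK vs x : gsproj vs *m (gsproj vs *m x) = gsproj vs *m x.
Proof. by rewrite mulmxA gsproj_idem. Qed.

Lemma dot_gsproj vs x y : dot (gsproj vs *m x) y = dot x (gsproj vs *m y).
Proof. by rewrite dot_mulmx_tr gsproj_tr. Qed.

Lemma gsproj_cons v vs x :
  gsproj (v :: vs) *m x = gsproj vs *m x -
    ((dot (gsproj vs *m v) (gsproj vs *m v))^-1 * dot (gsproj vs *m v) x)
    *: (gsproj vs *m v).
Proof. by rewrite /= mulmxBl -scalemxAl outer_mul scalerA. Qed.

Lemma gsproj_mem vs v : v \in vs -> gsproj vs *m v = 0.
Proof.
elim: vs => [//|a vs IH]; rewrite gsproj_cons in_cons.
set u := gsproj vs *m a => /orP[/eqP ->|vin].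
  have -> : dot u a = dot u u by rewrite {2}/u -dot_gsproj gsprojK.
  have [u0|u0] := eqVneq u 0; first by rewrite -/u u0 scaler0 subrr.
  by rewrite -/u mulVf ?dot_eq0// scale1r subrr.
by rewrite [dot u v]dot_gsproj (IH vin) dot0r mulr0 scale0r subrr.
Qed.

Lemma gsproj_span vs v : v \in <<vs>>%VS -> gsproj vs *m v = 0.
Proof.
move=> vin; have := @coord_span _ _ _ (in_tuple vs) v vin => ->.
rewrite mulmx_sumr big1// => i _.
by rewrite -scalemxAr gsproj_mem ?scaler0// mem_nth.
Qed.

Lemma gsproj_compl vs x : x - gsproj vs *m x \in <<vs>>%VS.
Proof.
elim: vs x => [|v vs IH] x; first by rewrite /= mul1mx subrr mem0v.
rewrite gsproj_cons opprB addrCA span_cons; set u := gsproj vs *m v.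
rewrite memvD ?memvZ//; last by rewrite (subvP (addvSr _ _)) ?IH.
rewrite -[u](subKr v) memvB ?(subvP (addvSl _ _) _ (memv_line v))//.
by rewrite (subvP (addvSr _ _)) ?IH.
Qed.

Lemma gsproj_spanE vs v : (v \in <<vs>>%VS) = (gsproj vs *m v == 0).
Proof.
apply/idP/eqP => [|Qv]; first exact: gsproj_span.
by have := gsproj_compl vs v; rewrite Qv subr0.
Qed.

Lemma dot_gsproj_span vs x v : v \in <<vs>>%VS -> dot (gsproj vs *m x) v = 0.
Proof. by move=> vin; rewrite dot_gsproj gsproj_span// dot0r. Qed.

(** Pythagoras: [x - y] is [gsproj vs *m x] plus a vector of the span, orthogonal to it. *)
Lemma sqr_gsproj_le vs x y : y \in <<vs>>%VS ->
  dot (gsproj vs *m x) (gsproj vs *m x) <= dot (x - y) (x - y).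
Proof.
move=> yin; have -> : x - y = gsproj vs *m x + (x - gsproj vs *m x - y).
  by rewrite addrCA addrA addrNK.
have zin : x - gsproj vs *m x - y \in <<vs>>%VS by rewrite memvB ?gsproj_compl.
move: (x - _ - y) zin => z zin.
have Qz := dot_gsproj_span x zin.
by rewrite [leRHS]dotDl !dotDr [dot z (_ *m _)]dotC Qz addr0 add0r lerDl dot_ge0.
Qed.

Lemma l2norm_gsproj_le vs x y : y \in <<vs>>%VS ->
  l2norm (gsproj vs *m x) <= l2norm (x - y).
Proof. by move=> yin; rewrite !l2normE ler_sqrt ?dot_ge0// sqr_gsproj_le. Qed.

Lemma l2norm_gsproj vs x : l2norm (gsproj vs *m x) <= l2norm x.
Proof. by rewrite -{2}(subr0 x) l2norm_gsproj_le// mem0v. Qed.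

Lemma mulmx_colP m (A B : 'M[R]_(m, n)) : (forall x, A *m x = B *m x) -> A = B.
Proof.
move=> h; apply/matrixP => i j.
have /matrixP/(_ i 0) := h (delta_mx j 0).
by rewrite -!colE !mxE.
Qed.

(** What [gsproj ws] removes lies in the span of [ws], which [gsproj vs] kills. In the descent,
    vectors defined relative to the initial list are thereby measured against every longer list. *)
Lemma gsproj_absorb vs ws : {subset ws <= <<vs>>%VS} ->
  gsproj vs *m gsproj ws = gsproj vs.
Proof.
move=> /span_subvP sub; apply: mulmx_colP => x.
apply/eqP; rewrite -mulmxA eq_sym -subr_eq0 -mulmxBr; apply/eqP.
by apply: gsproj_span; apply: (subvP sub); exact: gsproj_compl.
Qed.

(** The projection onto the span as a sum of rank-one terms. It yields the expansion in Gram-Schmidt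
    vectors and, later, the partial isometry that parametrises a flat. *)
Lemma gsproj_outer vs :
  1%:M - gsproj vs = \sum_(e <- gsvec vs) e *m e^T.
Proof.
elim: vs => [|v vs IH] /=; first by rewrite big_nil subrr.
set u := _ *m v.
rewrite big_cons -IH opprB addrCA; congr (_ + _).
rewrite linearZ /= -scalemxAl -scalemxAr scalerA; congr (_ *: _).
by rewrite -invfM -expr2 sqr_l2norm.
Qed.

Lemma size_gsvec vs : size (gsvec vs) = size vs.
Proof. by elim: vs => [//|v vs IH] /=; rewrite IH. Qed.

Lemma l2norm_gsvec vs e : e \in gsvec vs -> l2norm e <= 1.
Proof.
elim: vs => [//|v vs IH] /=; rewrite in_cons => /orP[/eqP->|]; last exact: IH.
rewrite l2normZ ger0_norm ?invr_ge0 ?l2norm_ge0//.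
by have [->|h] := eqVneq (l2norm (gsproj vs *m v)) 0; rewrite ?mulr0// mulVf.
Qed.

Lemma gsvec_expand vs y : y \in <<vs>>%VS ->
  y = \sum_(e <- gsvec vs) dot e y *: e.
Proof.
move=> /gsproj_span Qy; have := congr1 (mulmx^~ y) (gsproj_outer vs).
rewrite mulmxBl mul1mx Qy subr0 mulmx_suml => {1}->.
by apply: eq_bigr => e _; rewrite outer_mul.
Qed.

End GramSchmidt.

(** * Flats and rank-one determinants *)

Section Section_of_projection.
Variables (R : realType) (d t : nat) (G : 'M[R]_(t, d)).
Implicit Types (ws : seq 'cV[R]_d).

Local Notation proj ws := (gsproj (map (mulmx G) ws)).

(* A right inverse of [G] over the span of [map (mulmx G) ws] with values in
   the span of [ws]. *)
Fixpoint gslift ws : 'M[R]_(d, t) :=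
  if ws is w :: ws' then
    let u := proj ws' *m (G *m w) in
    gslift ws' + (dot u u)^-1 *: ((w - gslift ws' *m (G *m w)) *m u^T)
  else 0.

(** By induction [G] maps [w - gslift ws' *m (G *m w)] to the Gram-Schmidt residual [u], so the
    rank-one term added to the lift becomes the one that [gsproj] subtracts. *)
Lemma gsliftK ws : G *m gslift ws = 1%:M - proj ws.
Proof.
elim: ws => [|w ws IH] /=; first by rewrite mulmx0 subrr.
set u := _ *m (G *m w).
rewrite mulmxDr -scalemxAr [G *m (_ *m u^T)]mulmxA mulmxBr.
rewrite [G *m (gslift _ *m _)]mulmxA IH.
rewrite [(1%:M - _) *m (G *m w)]mulmxBl mul1mx subKr -/u.
by rewrite opprB addrA addrAC.
Qed.

Lemma gslift_span ws y : gslift ws *m y \in <<ws>>%VS.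
Proof.
elim: ws y => [|w ws IH] y /=; first by rewrite mul0mx mem0v.
rewrite mulmxDl -scalemxAl outer_mul span_cons.
have sub := subvP (addvSr <[w]> <<ws>>).
apply: memvD; first exact: sub.
do 2![apply: memvZ]; apply: memvB; last exact: sub.
exact: (subvP (addvSl <[w]> <<ws>>) _ (memv_line w)).
Qed.

End Section_of_projection.

Section Flats.
Variable (R : realType).

Lemma flat_closestP n k (F : set 'cV[R]_n) x : is_flat k F ->
  is_closest F x (closest F x).
Proof.
move=> [tau [V [_ ->]]].
pose Q := gsproj (vbasis V).
pose p := tau + ((x - tau) - Q *m (x - tau)).
have spanV : <<vbasis V>>%VS = V by exact: span_basis (vbasisP V).
apply: (xgetPex 0); exists p; split.
  exists ((x - tau) - Q *m (x - tau)) => //=.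
  by have := gsproj_compl (vbasis V) (x - tau); rewrite spanV.
move=> q [y yV <-]; have -> : x - p = Q *m (x - tau) by rewrite opprD addrA subKr.
rewrite opprD addrA.
by apply: l2norm_gsproj_le; rewrite spanV.
Qed.

Lemma closest_mem n k (F : set 'cV[R]_n) x : is_flat k F -> F (closest F x).
Proof. by move=> /(@flat_closestP _ _ _ x)[]. Qed.

Lemma closest_le n k (F : set 'cV[R]_n) x q : is_flat k F -> F q ->
  l2norm (x - closest F x) <= l2norm (x - q).
Proof. by move=> /(@flat_closestP _ _ _ x)[_]; apply. Qed.

Lemma flat_image m n k (A : 'M[R]_(n, m)) (F : set 'cV[R]_m) :
  is_flat k F -> is_flat k (mulmx A @` F).
Proof.
move=> [tau [V [dV ->]]]; pose f : 'Hom('cV[R]_m, 'cV[R]_n) := linfun (mulmx A).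
exists (A *m tau), (f @: V)%VS; split.
  by rewrite (leq_trans _ dV)// -(limg_ker_dim f V) leq_addl.
apply/seteqP; split=> [_ [_ [y yV <-] <-]|_ [_ /memv_imgP[y yV ->] <-]].
  exists (A *m y); last by rewrite mulmxDr.
  by rewrite /= -(lfunE (mulmx A)) memv_img.
by exists (tau + y); [exists y|rewrite mulmxDr lfunE].
Qed.

(** The extra vector is the translation. From here on an affine flat is treated through a linear
    span, at the price of one dimension. *)
Lemma flat_span n k (F : set 'cV[R]_n) : is_flat k F ->
  exists ws : seq 'cV[R]_n, (size ws <= k.+1)%N /\
    forall p, F p -> p \in <<ws>>%VS.
Proof.
move=> [tau [V [dV ->]]]; exists (tau :: vbasis V); split=> [|_ [y yV <-]].
  by rewrite /= size_tuple ltnS.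
by rewrite span_cons memv_add ?memv_line// (span_basis (vbasisP V)).
Qed.

End Flats.

Section RankOneDeterminants.
Variables (R : realType) (n : nat).
Implicit Types (x y u v b : 'cV[R]_n) (S M : 'M[R]_n).

(** The matrix determinant lemma: the bordered matrix [A] is factored through either of its two
    Schur complements. *)
Lemma det_add1_outer u v : \det (1%:M + u *m v^T) = 1 + dot v u.
Proof.
pose A := block_mx (1%:M : 'M[R]_1) (- v^T) u 1%:M.
have E1 : A = block_mx 1%:M 0 u 1%:M *m block_mx 1%:M (- v^T) 0 (1%:M + u *m v^T).
  rewrite mulmx_block !mul1mx !mulmx0 !mulmx1 mul0mx !addr0 mulmxN.
  by rewrite addrCA addNr addr0.
have E2 : A = block_mx (1%:M + v^T *m u) (- v^T) 0 1%:M *m block_mx 1%:M 0 u 1%:M.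
  rewrite mulmx_block !mulmx1 !mul1mx !mul0mx !mulmx0 !add0r ?addr0 mulNmx.
  by rewrite addrK.
have := congr1 determinant E1; rewrite {1}E2 !det_mulmx !det_ublock !det_lblock.
rewrite !det1 !mulr1 !mul1r => <-.
by rewrite det_mx11 mx11_dot !mxE eqxx !mulr1n.
Qed.

Definition posdef S := S^T = S /\ forall x, x != 0 -> 0 < dot x (S *m x).

Lemma posdef_unit S : posdef S -> S \in unitmx.
Proof.
move=> [_ pS]; rewrite -unitmx_tr -row_free_unit -kermx_eq0.
apply/rowV0P => r /sub_kermxP rS.
apply/eqP; rewrite -trmx_eq0; apply/negP => /negP/pS.
by rewrite -[S]trmxK -trmx_mul rS trmx0 dot0r ltxx.
Qed.

Lemma det_add_outer S c u : posdef S ->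
  \det (S + c *: (u *m u^T)) = \det S * (1 + c * dot u (invmx S *m u)).
Proof.
move=> pS; have uS := posdef_unit pS.
have -> : S + c *: (u *m u^T) = S *m (1%:M + (invmx S *m (c *: u)) *m u^T).
  by rewrite mulmxDr mulmx1 !mulmxA mulmxV// mul1mx -scalemxAl.
by rewrite det_mulmx det_add1_outer -scalemxAr dotZr.
Qed.

(** Cauchy-Schwarz for [S^(1/2) b] and [S^(-1/2) u], without square roots: with [y = S^-1 u], expand
    the nonnegative [S]-norm of [B y - (dot u b) b]. It bounds from below the quadratic form of the
    inverse that [det_add_outer] produces, given one test vector [b]. *)
Lemma posdef_CauchySchwarz S u b : posdef S ->
  dot u b ^+ 2 <= dot b (S *m b) * dot u (invmx S *m u).
Proof.
move=> pS; have uS := posdef_unit pS; have [sS qS] := pS.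
have S_ge0 x : 0 <= dot x (S *m x).
  by have [->|/qS/ltW//] := eqVneq x 0; rewrite dot0l.
set y := invmx S *m u; have Sy : S *m y = u by rewrite mulmxA mulmxV// mul1mx.
have [->|b0] := eqVneq b 0; first by rewrite dot0r dot0l mul0r expr0n.
have bb := qS _ b0; set B := dot b (S *m b) in bb *.
have := S_ge0 (B *: y - dot u b *: b).
rewrite mulmxBr -!scalemxAr Sy !dotBl !dotBr !dotZl !dotZr -/B (dotC y u).
have -> : dot y (S *m b) = dot u b by rewrite dotC dot_mulmx_tr sS Sy dotC.
rewrite (dotC b u) => h.
have : 0 <= B * (B * dot u y - dot u b ^+ 2) by move: h; lra.
by rewrite pmulr_rge0// subr_ge0.
Qed.

End RankOneDeterminants.

(** * The determinant potential and its decrease *)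

Section Potential.
Variables (R : realType) (n : nat) (c : R).
Hypothesis c_gt0 : 0 < c.
Implicit Types (vs ws cs : seq 'cV[R]_n) (x u v b : 'cV[R]_n).

(* Its determinant is the potential of the argument: it never drops below [1],
   and loses a constant factor whenever [ws] gains a vector violating the lower
   bound. *)
Definition potmx cs ws : 'M[R]_n :=
  1%:M + c *: ((1%:M - gsproj cs) *m gsproj ws *m (1%:M - gsproj cs)).

Lemma projC_tr cs : (1%:M - gsproj cs)^T = 1%:M - gsproj cs.
Proof. by rewrite linearB /= trmx1 gsproj_tr. Qed.

Lemma projC_idem cs :
  (1%:M - gsproj cs) *m (1%:M - gsproj cs) = 1%:M - gsproj cs.
Proof. by rewrite mulmxBl mul1mx mulmxBr mulmx1 gsproj_idem subrr subr0. Qed.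

Lemma dot_potmx cs ws x : dot x (potmx cs ws *m x) = dot x x +
  c * dot (gsproj ws *m ((1%:M - gsproj cs) *m x))
          (gsproj ws *m ((1%:M - gsproj cs) *m x)).
Proof.
rewrite /potmx mulmxDl mul1mx -scalemxAl dotDr dotZr -!mulmxA.
by rewrite -[X in dot x (X *m _)]projC_tr -dot_mulmx_tr -[in LHS]gsprojK -dot_gsproj.
Qed.

Lemma posdef_potmx cs ws : posdef (potmx cs ws).
Proof.
split=> [|x x0].
  rewrite linearD /= linearZ /= trmx1 !trmx_mul projC_tr gsproj_tr.
  by rewrite /potmx mulmxA.
by rewrite dot_potmx ltr_wpDr ?dot_gt0// mulr_ge0 ?dot_ge0// ltW.
Qed.

(** With [A = gsproj ws *m (1 - gsproj cs)] the matrix is [1 + c A^T A]. Adding the rows of [A] one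
    at a time, each rank-one update multiplies the determinant by [1 + c u^T S^-1 u], which is at
    least 1. *)
Lemma det_potmx_ge1 cs ws : 1 <= \det (potmx cs ws).
Proof.
pose A := gsproj ws *m (1%:M - gsproj cs).
pose S k : 'M[R]_n := 1%:M + c *: \sum_(i < n | (i < k)%N) ((row i A)^T *m row i A).
have dotS k x : dot x (S k *m x) =
    dot x x + c * \sum_(i < n | (i < k)%N) (dot (row i A)^T x) ^+ 2.
  rewrite mulmxDl mul1mx -scalemxAl dotDr dotZr mulmx_suml.
  congr (_ + _ * _); rewrite dotC dot_suml.
  apply: eq_bigr => i _.
  by rewrite -[X in _ *m X *m _]trmxK outer_mul dotZl -expr2.
have pS k : posdef (S k).
  split=> [|x x0].
    rewrite linearD /= linearZ /= trmx1 linear_sum; congr (_ + _ *: _).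
    by apply: eq_bigr => i _ /=; rewrite trmx_mul trmxK.
  rewrite dotS ltr_wpDr ?dot_gt0// mulr_ge0 ?(ltW c_gt0)//.
  by apply: sumr_ge0 => i _; exact: sqr_ge0.
have -> : potmx cs ws = S n.
  rewrite /potmx /S; congr (_ + _ *: _).
  have -> : (1%:M - gsproj cs) *m gsproj ws *m (1%:M - gsproj cs) = A^T *m A.
    by rewrite trmx_mul projC_tr gsproj_tr /A !mulmxA -[_ *m _ *m gsproj ws]mulmxA
      gsproj_idem.
  apply/matrixP => i j; rewrite !mxE summxE.
  under [RHS]eq_bigl do rewrite ltn_ord.
  apply: eq_bigr => k _; rewrite !mxE big_ord1 !mxE.
  by [].
suff H k : (k <= n)%N -> 1 <= \det (S k) by exact: H.
elim: k => [_|k IH kn].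
  by rewrite /S big_pred0_eq scaler0 addr0 det1.
have -> : S k.+1 = S k + c *: ((row (Ordinal kn) A)^T *m ((row (Ordinal kn) A)^T)^T).
  rewrite /S -addrA -scalerDr; congr (_ + _ *: _).
  rewrite (bigD1 (Ordinal kn))//= trmxK addrC; congr (_ + _).
  by apply: eq_bigl => i; rewrite ltnS -val_eqE /= ltn_neqAle andbC.
rewrite det_add_outer//; set u := (row _ A)^T.
have detS : 1 <= \det (S k) by apply: IH; exact: ltnW.
have Sge0 : 0 <= dot u (invmx (S k) *m u).
  have uS := posdef_unit (pS k).
  have {1}-> : u = S k *m (invmx (S k) *m u) by rewrite mulmxA mulmxV// mul1mx.
  rewrite dotC; have [-> //|/(pS k).2/ltW//] := eqVneq (invmx (S k) *m u) 0.
  by rewrite dot0l.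
by rewrite mulr_ege1// lerDl mulr_ge0// ltW.
Qed.

(** When [gsproj ws] fixes [cs], it drops out and [1 + c P] remains, with [P] the projection onto
    the span of [cs]. Each Gram-Schmidt vector of [cs] contributes a factor [1 + c], a dependent one
    a factor 1. *)
Lemma det_potmx_le cs ws : 
  (forall v, v \in cs -> gsproj ws *m v = v) ->
  \det (potmx cs ws) <= (1 + c) ^+ size cs.
Proof.
move=> sub.
have Qcs x : x \in <<cs>>%VS -> gsproj ws *m x = x.
  move=> xin; have := @coord_span _ _ _ (in_tuple cs) x xin => ->.
  rewrite mulmx_sumr; apply: eq_bigr => i _.
  by rewrite -scalemxAr sub// mem_nth.
have -> : potmx cs ws = 1%:M + c *: (1%:M - gsproj cs).
  congr (_ + _ *: _); apply: mulmx_colP => x.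
  rewrite -!mulmxA (Qcs ((1%:M - gsproj cs) *m x)) ?mulmxA ?projC_idem//.
  by rewrite mulmxBl mul1mx gsproj_compl.
elim: {ws sub Qcs} cs => [|v cs IH] /=; first by rewrite subrr scaler0 addr0 det1.
set u := gsproj cs *m v.
have := posdef_potmx cs [::]; rewrite /potmx /= mulmx1 projC_idem => pS.
rewrite opprB addrCA scalerDr addrA addrAC scalerA det_add_outer//.
have [u0|u0] := eqVneq u 0.
  rewrite u0 !dot0l mulr0 addr0 mulr1 exprS (le_trans IH)//.
  by rewrite ler_peMl ?exprn_ge0 ?addr_ge0 ?(ltW c_gt0)// lerDl ltW.
(* The residual [u] is orthogonal to the span of [cs], hence fixed by the matrix and by its
   inverse. *)
have -> : invmx (1%:M + c *: (1%:M - gsproj cs)) *m u = u.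
  rewrite -{1}[u](_ : (1%:M + c *: (1%:M - gsproj cs)) *m u = u).
    by rewrite mulmxA mulVmx ?posdef_unit// mul1mx.
  by rewrite mulmxDl mul1mx -scalemxAl mulmxBl mul1mx gsprojK subrr scaler0 addr0.
by rewrite -mulrA mulVf ?dot_eq0// mulr1 exprSr ler_pM2r// ltr_wpDl.
Qed.

(** Adding [v] subtracts [c / |u|^2] times the outer square of [P u], so the determinant is
    multiplied by [1 - c X / |u|^2], with [X] the form of the inverse at [P u]. Cauchy-Schwarz with
    test vector [b] gives [(u.q)^2 <= (|b|^2 + c |q|^2) X <= 2 c |q|^2 X]: the bound on [dot b b]
    absorbs the identity part and costs the factor 2. The angle condition then gives
    [c X / |u|^2 >= e / 2]. *)
Lemma det_potmx_step cs ws v b e :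
  b \in <<cs>>%VS -> 0 <= e ->
  let u := gsproj ws *m v in let q := gsproj ws *m b in
  dot b b <= c * dot q q ->
  e * (dot q q * dot u u) <= dot u q ^+ 2 -> 0 < dot u q ->
  \det (potmx cs (v :: ws)) <= (1 - e / 2) * \det (potmx cs ws).
Proof.
move=> bcs e0 u q bq cos uq.
pose P := 1%:M - gsproj cs.
have Pb : P *m b = b by rewrite mulmxBl mul1mx gsproj_span// subr0.
have pT := posdef_potmx cs ws.
have -> : potmx cs (v :: ws) =
    potmx cs ws + (- (c / dot u u)) *: ((P *m u) *m (P *m u)^T).
  have PT : P^T = P by exact: projC_tr.
  rewrite /potmx /= -/u -/P -addrA; clearbody P; congr (_ + _).
  rewrite mulmxBr mulmxBl scalerBr -scalemxAr -scalemxAl scaleNr scalerA.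
  by rewrite (trmx_mul P u) PT !mulmxA.
rewrite det_add_outer// mulrC ler_wpM2r//.
  by apply: le_trans (det_potmx_ge1 cs ws).
have uu : 0 < dot u u.
  by rewrite dot_gt0; apply: contraTneq uq => ->; rewrite dot0l ltxx.
have qq : 0 < dot q q.
  by rewrite dot_gt0; apply: contraTneq uq => ->; rewrite dot0r ltxx.
rewrite mulNr lerD2l lerN2.
have CS := posdef_CauchySchwarz (P *m u) b pT.
move: CS; rewrite dot_potmx -/P Pb -/q.
have -> : dot (P *m u) b = dot u q.
  by rewrite dot_mulmx_tr projC_tr -/P Pb /q -dot_gsproj gsprojK.
set X := dot (P *m u) _ => CS.
have X0 : 0 <= X.
  rewrite leNgt; apply/negP => Xlt.
  have : 0 < dot u q ^+ 2 by rewrite exprn_gt0.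
  apply/negP; rewrite -leNgt (le_trans CS)// mulr_ge0_le0 ?ltW//.
  by rewrite ltr_wpDl ?dot_ge0// mulr_gt0.
have H : e * (dot q q * dot u u) <= 2 * c * dot q q * X.
  apply: (le_trans cos); apply: (le_trans CS).
  by apply: ler_wpM2r => //; move: bq; lra.
have {}H : e * dot u u <= 2 * c * X.
  have : dot q q * (e * dot u u) <= dot q q * (2 * c * X) by move: H; lra.
  by rewrite ler_pM2l.
rewrite [_ / _ * X]mulrAC ler_pdivlMr//.
by move: H; lra.
Qed.

End Potential.

(** * Sensitivity of the points *)

HB.lock Definition lz (R : realType) (I : finType) (z : R) (f : I -> R) : R :=
  (\sum_i `|f i| `^ z) `^ z^-1.

Section FiniteMinkowski.
Variables (R : realType) (I : finType) (z : R).
Hypothesis z_ge1 : 1 <= z.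
Implicit Types f g h K : I -> R.

Let z_gt0 : 0 < z. Proof. exact: lt_le_trans z_ge1. Qed.
Let z_neq0 : z != 0. Proof. by rewrite gt_eqF. Qed.

Local Notation lz := (lz z).

Lemma sum_powR_ge0 (P : pred I) f : 0 <= \sum_(i | P i) `|f i| `^ z.
Proof. by apply: sumr_ge0 => i _; exact: powR_ge0. Qed.

Lemma lz_ge0 f : 0 <= lz f. Proof. by rewrite lz.unlock powR_ge0. Qed.

Lemma lz_powR f : lz f `^ z = \sum_i `|f i| `^ z.
Proof. by rewrite lz.unlock -powRrM mulVf// powRr1// sum_powR_ge0. Qed.

Lemma powR_rootK a : 0 <= a -> (a `^ z) `^ z^-1 = a.
Proof. by move=> a0; rewrite -powRrM mulfV// powRr1. Qed.

Lemma le_root a b : 0 <= a -> 0 <= b -> a `^ z <= b `^ z -> a <= b.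
Proof.
move=> a0 b0 ab; rewrite -(powR_rootK a0) -(powR_rootK b0).
by apply: ge0_ler_powR => //; rewrite ?nnegrE ?powR_ge0// invr_ge0 ltW.
Qed.

Lemma le_powz a b : 0 <= a -> a <= b -> a `^ z <= b `^ z.
Proof.
move=> a0 ab; apply: ge0_ler_powR => //; first exact: ltW.
by rewrite nnegrE (le_trans a0).
Qed.

Lemma lz_le_sum f a : 0 <= a -> \sum_i `|f i| `^ z <= a `^ z -> lz f <= a.
Proof. by move=> a0 h; apply: le_root; rewrite ?lz_ge0// lz_powR. Qed.

Lemma lz_mono f g : (forall i, `|f i| <= `|g i|) -> lz f <= lz g.
Proof.
move=> fg; apply: lz_le_sum; rewrite ?lz_ge0// lz_powR.
by apply: ler_sum => i _; exact: le_powz.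
Qed.

Lemma lz_abs f : lz (fun i => `|f i|) = lz f.
Proof. by rewrite lz.unlock; under eq_bigr do rewrite normr_id. Qed.

Lemma ext_lz f g : f =1 g -> lz f = lz g.
Proof. by move=> fg; rewrite lz.unlock; under eq_bigr do rewrite fg. Qed.

Lemma abs_le_lz f i : `|f i| <= lz f.
Proof.
apply: le_root; rewrite ?lz_ge0// lz_powR (bigD1 i)//= lerDl.
exact: sum_powR_ge0.
Qed.

Lemma lz_eq0 f : lz f = 0 -> forall i, f i = 0.
Proof.
by move=> f0 i; apply/eqP; rewrite -normr_eq0 eq_le normr_ge0 andbT -f0 abs_le_lz.
Qed.

Lemma lzZ a f : lz (fun i => a * f i) = `|a| * lz f.
Proof.
rewrite lz.unlock; under eq_bigr do rewrite normrM powRM//.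
by rewrite -mulr_sumr powRM ?powR_ge0 ?sum_powR_ge0// powR_rootK.
Qed.

Lemma lzZ_ge0 a f : 0 <= a -> lz (fun i => a * f i) = a * lz f.
Proof. by move=> a0; rewrite lzZ ger0_norm. Qed.

Lemma convex_powz (a x y : R) : 0 <= a <= 1 -> 0 <= x -> 0 <= y ->
  (a * x + (1 - a) * y) `^ z <= a * x `^ z + (1 - a) * y `^ z.
Proof.
move=> /andP[a0 a1] x0 y0.
by apply: (convex_powR z_ge1 (Itv01 a0 a1)); rewrite inE/= in_itv/= ?x0 ?y0.
Qed.

Lemma powR_div (a b : R) : 0 <= a -> 0 <= b -> (a / b) `^ z = a `^ z / b `^ z.
Proof.
move=> a0 b0; rewrite powRM ?invr_ge0//; congr (_ * _).
by rewrite -(powR_inv1 b0) powRAC powR_inv1 ?powR_ge0.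
Qed.

(** Minkowski's inequality from convexity of the [z]-th power: [|f| / A] and [|g| / B], both of norm
    1, are averaged pointwise with weights [A / (A + B)] and [B / (A + B)]. *)
Lemma lzD f g : lz (fun i => f i + g i) <= lz f + lz g.
Proof.
have [f0|f0] := eqVneq (lz f) 0.
  by rewrite f0 add0r (@ext_lz _ g)// => i; rewrite (lz_eq0 f0) add0r.
have [g0|g0] := eqVneq (lz g) 0.
  by rewrite g0 addr0 (@ext_lz _ f)// => i; rewrite (lz_eq0 g0) addr0.
have [A EA] : exists A, A = lz f by exists (lz f).
have [B EB] : exists B, B = lz g by exists (lz g).
have {}f0 : 0 < A by rewrite EA lt_def f0 lz_ge0.
have {}g0 : 0 < B by rewrite EB lt_def g0 lz_ge0.
rewrite -EA -EB; have AB : 0 < A + B by rewrite addr_gt0.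
pose a := A / (A + B).
have a01 : 0 <= a <= 1.
  by rewrite divr_ge0 ?(ltW f0) ?(ltW AB)//= ler_pdivrMr// mul1r lerDl ltW.
have a1 : 1 - a = B / (A + B).
  by rewrite /a -{1}(divff (lt0r_neq0 AB)) -mulrBl addrC addKr.
apply: lz_le_sum; first exact: ltW.
have bound i : `|f i + g i| `^ z <= (A + B) `^ z *
    (a * (`|f i| `^ z / A `^ z) + (1 - a) * (`|g i| `^ z / B `^ z)).
  have -> : `|f i| `^ z / A `^ z = (`|f i| / A) `^ z.
    by rewrite powR_div// ltW.
  have -> : `|g i| `^ z / B `^ z = (`|g i| / B) `^ z.
    by rewrite powR_div// ltW.
  apply: (@le_trans _ _ ((A + B) `^ z * (a * (`|f i| / A) + (1 - a) * (`|g i| / B)) `^ z)).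
    rewrite -powRM ?(ltW AB)//; last first.
      by rewrite a1 addr_ge0// mulr_ge0// divr_ge0// ltW.
    apply: le_powz => //; apply: (le_trans (ler_normD _ _)).
    rewrite a1 /a le_eqVlt; apply/orP; left; apply/eqP.
    by field; rewrite !gt_eqF.
  by rewrite ler_wpM2l ?powR_ge0// convex_powz// divr_ge0// ltW.
apply: (le_trans (ler_sum _ (fun i _ => bound i))).
rewrite -mulr_sumr big_split/= -!mulr_sumr -!mulr_suml -!lz_powR -EA -EB.
by rewrite !divff ?gt_eqF ?powR_gt0// !mulr1 subrKC mulr1.
Qed.

Lemma lzD_abs f g h : (forall i, `|f i| <= `|g i| + `|h i|) ->
  lz f <= lz g + lz h.
Proof.
move=> fgh; rewrite -(lz_abs g) -(lz_abs h).
apply: (le_trans _ (lzD _ _)).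
by apply: lz_mono => i; rewrite [leRHS]ger0_norm ?addr_ge0.
Qed.

Fixpoint fspan (gs : seq (I -> R)) f : Prop :=
  if gs is g :: gs' then
    exists a h, fspan gs' h /\ forall i, f i = a * g i + h i
  else forall i, f i = 0.

Lemma fspan_lin gs a f b g : fspan gs f -> fspan gs g ->
  fspan gs (fun i => a * f i + b * g i).
Proof.
elim: gs f g => [|e gs IH] f g /=.
  by move=> f0 g0 i; rewrite f0 g0 !mulr0 addr0.
move=> [a1 [h1 [s1 e1]]] [a2 [h2 [s2 e2]]].
exists (a * a1 + b * a2), (fun i => a * h1 i + b * h2 i).
by split=> [|i]; [exact: IH|rewrite e1 e2; ring].
Qed.

Lemma fspan0 gs : fspan gs (fun=> 0).
Proof.
elim: gs => [//|g gs IH] /=; exists 0, (fun=> 0); split=> // i.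
by rewrite mul0r addr0.
Qed.

Lemma fspan_sum (J : Type) (s : seq J) (c : J -> R) (g : J -> I -> R) :
  fspan (map g s) (fun i => \sum_(j <- s) c j * g j i).
Proof.
elim: s => [|j s IH] /=; first by move=> i; rewrite big_nil.
by exists (c j), (fun i => \sum_(j <- s) c j * g j i); split=> // i; rewrite big_cons.
Qed.

Lemma limit_le (x a b : R) : (forall t, 0 < t -> x <= a + b * t) -> x <= a.
Proof.
move=> h; rewrite leNgt; apply/negP => ax.
have b1 : 0 < `|b| + 1 by rewrite ltr_wpDl.
have t0 : 0 < (x - a) / 2 / (`|b| + 1) by rewrite !divr_gt0 ?subr_gt0.
have := h _ t0; apply/negP; rewrite -ltNge -ltrBrDl.
apply: (@le_lt_trans _ _ ((`|b| + 1) * ((x - a) / 2 / (`|b| + 1)))).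
  by rewrite ler_pM2r// (le_trans (ler_norm _))// lerDl.
by rewrite mulrC mulfVK ?gt_eqF//; move: ax; lra.
Qed.

(* Each new function is replaced by its residual against an almost best
   approximation from the previous ones, which costs a factor [3]. *)
Lemma fspan_sensitivity gs : exists K, [/\ forall i, 0 <= K i,
  lz K <= 3 ^+ size gs - 1 &
  forall f i, fspan gs f -> `|f i| <= K i * lz f].
Proof.
elim: gs => [|g gs [K [K0 Kle Kf]]].
  exists (fun=> 0); split=> // [|f i /= ->]; last by rewrite normr0 mul0r.
  apply: lz_le_sum; rewrite expr0 subrr// big1// => i _.
  by rewrite normr0 powR0.
(* [inf S] is the distance from [g] to the span of [gs]. That it is attained would require
   compactness, so only approximate minimisers are used. *)
pose S := [set r | exists h, fspan gs h /\ r = lz (fun i => g i - h i)].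
have S0 : S !=set0.
  by exists (lz (fun i => g i - 0)); exists (fun=> 0); split=> //; exact: fspan0.
have S_lb : has_lbound S by exists 0 => _ [h [_ ->]]; exact: lz_ge0.
have S_inf : has_inf S by [].
have D0 : 0 <= inf S by apply: lb_le_inf => // _ [h [_ ->]]; exact: lz_ge0.
have decomp f : fspan (g :: gs) f -> exists2 a, True & forall h, fspan gs h ->
    exists f', [/\ fspan gs f', f =1 (fun i => a * (g i - h i) + f' i) &
                  `|a| * inf S <= lz f].
  move=> [a [f1 [sf1 ef]]]; exists a => // h sh.
  exists (fun i => 1 * f1 i + a * h i); split=> [|i|].
  - exact: fspan_lin.
  - by rewrite ef; ring.
  - have [->|a0] := eqVneq a 0; first by rewrite normr0 mul0r lz_ge0.
    have -> : lz f = `|a| * lz (fun i => g i - (- a^-1 * f1 i + 0 * f1 i)).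
      by rewrite -lzZ; apply: ext_lz => i; rewrite ef; field.
    rewrite ler_wpM2l//; apply: ge_inf => //.
    by exists (fun i => - a^-1 * f1 i + 0 * f1 i); split=> //; exact: fspan_lin.
(* At distance 0, [g] is a limit of elements of the span, and the old [K] still works, up to an
   error that vanishes with [t]. *)
have [D_eq0|D_neq0] := eqVneq (inf S) 0.
  exists K; split=> // [|f i sf].
    apply: (le_trans Kle); rewrite lerD2r exprSr ler_peMr ?exprn_ge0//; lra.
  have [a _ dec] := decomp _ sf.
  apply: (@limit_le _ _ ((1 + K i) * `|a|)) => t t0.
  have [_ [h [sh ->]]] := inf_adherent t0 S_inf; rewrite D_eq0 add0r => lt.
  have [f' [sf' ef' _]] := dec h sh.
  have gi : `|g i - h i| <= t by apply: le_trans (ltW lt); exact: (abs_le_lz (fun i => g i - h i)).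
  have lf' : lz f' <= lz f + `|a| * t.
    apply: (@le_trans _ _ (lz f + lz (fun i => - a * (g i - h i)))).
      rewrite (@ext_lz f' (fun i => f i + - a * (g i - h i))) ?lzD// => j.
      by rewrite ef'; ring.
    by rewrite lzZ normrN lerD2l ler_wpM2l// ltW.
  rewrite ef' (le_trans (ler_normD _ _))// normrM.
  have H1 : `|a| * `|g i - h i| <= `|a| * t by rewrite ler_wpM2l.
  have H2 := le_trans (Kf f' i sf') (ler_wpM2l (K0 i) lf').
  by move: H1 H2; lra.
have {D_neq0}D0 : 0 < inf S by rewrite lt_def D_neq0.
(* [g0 = g - h] has at most twice the minimal norm. Hence [|a| lz g0 <= 2 lz f], and the remainder
   [f'] satisfies [lz f' <= 3 lz f]; the new bound on [lz K] is
   [3 (3^n - 1) + 2 = 3^(n + 1) - 1]. *)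
have [_ [h [sh ->]] lt2] := inf_adherent D0 S_inf.
set g0 := (fun i => g i - h i) in lt2.
have g0_ge : inf S <= lz g0 by apply: ge_inf => //; exists h.
have g0_gt0 : 0 < lz g0 by apply: lt_le_trans g0_ge.
exists (fun i => 3 * K i + 2 / lz g0 * `|g0 i|); split=> [i||f i sf].
- by rewrite addr_ge0// mulr_ge0// divr_ge0// ltW.
- apply: (le_trans (lzD _ _)); rewrite !lzZ lz_abs normr_nat.
  rewrite ger0_norm ?divr_ge0 ?(ltW g0_gt0)// divfK ?gt_eqF//.
  by rewrite /= exprS; move: Kle; lra.
- have [a _ dec] := decomp _ sf; have [f' [sf' ef' aD]] := dec h sh.
  have aL : `|a| * lz g0 <= 2 * lz f.
    have : `|a| * lz g0 <= `|a| * (inf S + inf S) by rewrite ler_wpM2l// ltW.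
    by move: aD; lra.
  have lf' : lz f' <= 3 * lz f.
    have : lz f' <= lz f + lz (fun i => - a * g0 i).
      rewrite (@ext_lz f' (fun i => f i + - a * g0 i)) ?lzD// => j.
      by rewrite ef' /g0; ring.
    by rewrite lzZ normrN; move: aL; lra.
  rewrite ef' (le_trans (ler_normD _ _))// normrM -/(g0 i).
  have H1 : `|a| * `|g0 i| <= 2 / lz g0 * `|g0 i| * lz f.
    rewrite mulrAC ler_wpM2r// mulrAC ler_pdivlMr//.
  have H2 := le_trans (Kf f' i sf') (ler_wpM2l (K0 i) lf').
  by move: H1 H2; lra.
Qed.

End FiniteMinkowski.

Section FlatSensitivity.
Variables (R : realType) (I : finType) (z : R) (d k : nat) (p : I -> 'cV[R]_d).
Hypothesis z_ge1 : 1 <= z.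

Definition fdist (n : nat) (F : set 'cV[R]_n) x := l2norm (x - closest F x).

(** The distance of [p i] to [F'] is at most its distance to [F] plus the distance [|v i|] of its
    projection on [F] to [F']. Along a fixed direction [u], the numbers [dot u (v j)] are affine in
    the [k] coordinates of the projections within [F], so as functions of [j] they lie in a space of
    dimension [k + 1] that does not depend on [F'], and [fspan_sensitivity] applies to it. The total
    is [1 + 2 (3^(k + 1) - 1) <= 3^(k + 2)]. *)
Lemma flat_sensitivity (F : set 'cV[R]_d) : is_flat k F ->
  0 < lz z (fun i => fdist F (p i)) ->
  (forall F', is_flat k F' ->
     lz z (fun i => fdist F (p i)) <= lz z (fun i => fdist F' (p i))) ->
  exists K : I -> R, [/\ forall i, 0 <= K i, lz z K <= 3 ^+ k.+2 &
    forall F' i, is_flat k F' ->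
      fdist F' (p i) <= K i * lz z (fun i => fdist F' (p i))].
Proof.
move=> fF; set OPT := lz _ _ => OPT_gt0 Fopt.
have [tau [V [dV FE]]] := fF.
pose y i := closest F (p i) - tau.
have yV i : y i \in V.
  have [v vV Ev] : [set tau + y | y in [set` V]] (closest F (p i)).
    by rewrite -FE; exact: closest_mem fF.
  by rewrite /y -Ev addrC addKr.
pose gs := (fun=> 1) :: map (fun l i => coord (vbasis V) l (y i)) (enum 'I_(\dim V)).
have [K [K0 Kle Kf]] := fspan_sensitivity z_ge1 gs.
have size_gs : (size gs <= k.+1)%N by rewrite /= size_map size_enum_ord ltnS.
exists (fun i => fdist F (p i) / OPT + 2 * K i); split=> [i||F' i fF'].
- by rewrite addr_ge0 ?mulr_ge0 ?invr_ge0 ?l2norm_ge0 ?(ltW OPT_gt0).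
- apply: (le_trans (lzD z_ge1 _ _)).
  rewrite (@ext_lz _ _ _ _ (fun i => OPT^-1 * fdist F (p i))); last by move=> i; rewrite mulrC.
  rewrite !lzZ// normr_nat ger0_norm ?invr_ge0 ?(ltW OPT_gt0)// mulVf ?gt_eqF//.
  have : 3 ^+ size gs <= 3 ^+ k.+1 :> R by rewrite ler_weXn2l// ler1n.
  rewrite [_ ^+ k.+2]exprS; have : 1 <= 3 ^+ k.+1 :> R by rewrite exprn_ege1// ler1n.
  by move: (3 ^+ k.+1) (3 ^+ size gs) Kle => a b; lra.
set C := lz _ _.
have [tau' [V' [_ F'E]]] := fF'.
have spanV' : <<vbasis V'>>%VS = V' by exact: span_basis (vbasisP V').
pose Q := gsproj (vbasis V').
pose v j := Q *m (closest F (p j) - tau').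
have vle j : l2norm (v j) <= fdist F (p j) + fdist F' (p j).
  have [w wV' Ew] : [set tau' + y | y in [set` V']] (closest F' (p j)).
    by rewrite -F'E; exact: closest_mem fF'.
  apply: (@le_trans _ _ (l2norm (closest F (p j) - tau' - w))).
    by apply: l2norm_gsproj_le; rewrite spanV'.
  rewrite -addrA -opprD Ew -[closest F _ - _](subrKA (p j)).
  by rewrite (le_trans (l2normD _ _))// lerD2r -l2normN opprB.
have F'le : fdist F' (p i) <= fdist F (p i) + l2norm (v i).
  pose q := tau' + (closest F (p i) - tau' - v i).
  have F'q : F' q.
    rewrite F'E; exists (closest F (p i) - tau' - v i) => //=.
    by have := gsproj_compl (vbasis V') (closest F (p i) - tau'); rewrite spanV'.
  apply: (le_trans (closest_le _ fF' F'q)); rewrite /q addrA subrKC opprB addrCA addrC.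
  exact: l2normD.
have OC : OPT <= C by exact: Fopt.
have C0 : 0 < C by exact: lt_le_trans OC.
suff vK : l2norm (v i) <= 2 * K i * C.
  apply: (le_trans F'le); rewrite mulrDl lerD// mulrAC ler_pdivlMr//.
  by rewrite ler_wpM2l// l2norm_ge0.
have [v0|v0] := eqVneq (l2norm (v i)) 0.
  by rewrite v0 !mulr_ge0// ltW.
(* The direction is adapted to the point under consideration: [f i] equals [|v i|], while
   [|f j| <= |v j|] for every other [j]. *)
pose u := (l2norm (v i))^-1 *: v i.
have nu : l2norm u = 1.
  by rewrite l2normZ ger0_norm ?invr_ge0 ?l2norm_ge0// mulVf.
pose f j := dot u (v j).
have sf : fspan gs f.
  exists (dot u (Q *m (tau - tau'))).
  exists (fun j => \sum_(l <- enum 'I_(\dim V)) dot u (Q *m (vbasis V)`_l) *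
    coord (vbasis V) l (y j)); split; first exact: fspan_sum.
  move=> j; rewrite mulr1 /f /v big_enum/=.
  have -> : closest F (p j) - tau' = (tau - tau') + y j.
    by rewrite /y [RHS]addrC subrKA.
  rewrite mulmxDr dotDr; congr (_ + _).
  rewrite {1}(coord_vbasis (yV j)) mulmx_sumr dotC dot_suml.
  by apply: eq_bigr => l _; rewrite -scalemxAr dotZl mulrC dotC.
have lf : lz z f <= 2 * C.
  apply: (@le_trans _ _ (OPT + C)); last by rewrite mulr_natl mulr2n lerD2r.
  apply: lzD_abs => // j; rewrite [`|fdist F _|]ger0_norm ?l2norm_ge0//.
  rewrite [`|fdist F' _|]ger0_norm ?l2norm_ge0//.
  by rewrite (le_trans (CauchySchwarz _ _))// nu mul1r.
have := Kf f i sf.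
rewrite {1}/f /u dotZl -sqr_l2norm expr2 mulrA mulVf// mul1r ger0_norm ?l2norm_ge0// => h.
by apply: (le_trans h); rewrite [2 * K i]mulrC -mulrA ler_wpM2l.
Qed.

End FlatSensitivity.

(** * The lower bound for a fixed matrix *)

Section GridEmbedding.
Variables (R : realType) (d t : nat).

(** The indices run over [0 .. 2 M] and are shifted by [M], so the coefficients are the multiples of
    [1 / M] in [[-1, 1]], the range of the coordinates of unit vectors of the span. *)
Definition gridpt (vs : seq 'cV[R]_d) (M : nat)
    (c : {ffun 'I_(size vs) -> 'I_(M + M).+1}) : 'cV[R]_d :=
  \sum_(i < size vs) (((c i)%:R - M%:R) / M%:R) *: (gsvec vs)`_i.

Definition gridok (e : R) (M : nat) (G : 'M[R]_(t, d)) (vs : seq 'cV[R]_d) :=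
  forall c, let g := @gridpt vs M c in
    (1 - e / 2) ^+ 2 * dot g g <= dot (G *m g) (G *m g) <= 2 ^+ 2 * dot g g.

(** A unit vector [y] is rounded coordinatewise to a grid point at distance at most
    [m = size vs / M <= e / 6]. The Gram-Schmidt vectors are themselves grid points, so [G] maps
    each to norm at most 2 and the rounding error to norm at most [2 m]. What remains is
    [(1 - e / 2) (1 - m) - 2 m >= 1 - e]. *)
Lemma grid_embedding e M G vs : 0 < e -> e <= 1 -> (0 < M)%N ->
  6 * (size vs)%:R <= e * M%:R -> gridok e M G vs ->
  forall y, y \in <<vs>>%VS -> (1 - e) * l2norm y <= l2norm (G *m y).
Proof.
move=> e0 e1 M0 fine ok.
have MR : 0 < M%:R :> R by rewrite ltr0n.
have lo c : (1 - e / 2) * l2norm (gridpt c) <= l2norm (G *m @gridpt vs M c).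
  rewrite -(@ler_pXn2r _ 2)// ?nnegrE ?mulr_ge0 ?l2norm_ge0//; last lra.
  by rewrite exprMn !sqr_l2norm; case/andP: (ok c).
have hi c : l2norm (G *m @gridpt vs M c) <= 2 * l2norm (gridpt c).
  rewrite -(@ler_pXn2r _ 2)// ?nnegrE ?mulr_ge0 ?l2norm_ge0//.
  by rewrite exprMn !sqr_l2norm; case/andP: (ok c).
have e_le1 (i : 'I_(size vs)) : l2norm (gsvec vs)`_i <= 1.
  by rewrite (l2norm_gsvec (vs := vs))// mem_nth// size_gsvec.
have Ge_le2 (i : 'I_(size vs)) : l2norm (G *m (gsvec vs)`_i) <= 2.
  (* Index [2 M] stands for the coefficient 1, index [M] for 0. *)
  pose c := [ffun j : 'I_(size vs) => inord (if j == i then M + M else M) : 'I_(M + M).+1].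
  have gE : gridpt c = (gsvec vs)`_i.
    rewrite /gridpt (bigD1 i)//= big1 ?addr0 => [|j ji].
      by rewrite ffunE eqxx inordK// natrD addrK divff ?gt_eqF// scale1r.
    by rewrite ffunE (negbTE ji) inordK ?ltnS ?leq_addr// subrr mul0r scale0r.
  rewrite -gE (le_trans (hi c))// gE -[leRHS]mulr1 ler_wpM2l//.
suff unit_case y : y \in <<vs>>%VS -> l2norm y = 1 -> 1 - e <= l2norm (G *m y).
  move=> y yin; have [->|y0] := eqVneq y 0; first by rewrite mulmx0 !l2norm0 mulr0.
  have ny : 0 < l2norm y by rewrite lt_def l2norm_ge0 l2norm_eq0 y0.
  have := unit_case ((l2norm y)^-1 *: y) (memvZ _ yin).
  rewrite -scalemxAr !l2normZ ger0_norm ?invr_ge0 ?l2norm_ge0// mulVf ?gt_eqF//.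
  by move=> /(_ erefl); rewrite mulrC ler_pdivlMr.
move=> yin ny.
pose a (i : 'I_(size vs)) := dot (gsvec vs)`_i y.
have yE : y = \sum_(i < size vs) a i *: (gsvec vs)`_i.
  rewrite {1}(gsvec_expand yin) (big_nth 0) size_gsvec big_mkord.
  by [].
have a_le1 i : `|a i| <= 1.
  by rewrite (le_trans (CauchySchwarz _ _))// ny mulr1.
pose x i := M%:R * (a i + 1).
have x0 i : 0 <= x i.
  by rewrite mulr_ge0 ?(ltW MR)//; move: (a_le1 i); rewrite ler_norml; lra.
have xM i : x i <= (M + M)%:R.
  have -> : (M + M)%:R = M%:R * 2 :> R by rewrite natrD; ring.
  rewrite /x ler_pM2l//.
  by move: (a_le1 i); rewrite ler_norml; lra.
pose c := [ffun i => inord (Num.truncn (x i)) : 'I_(M + M).+1].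
have cE i : c i = Num.truncn (x i) :> nat.
  rewrite ffunE inordK// ltnS -(@ler_nat R).
  by rewrite (le_trans _ (xM i))//; case/andP: (truncn_itv (x0 i)).
have close i : `|a i - ((c i)%:R - M%:R) / M%:R| <= M%:R^-1.
  have -> : a i - ((c i)%:R - M%:R) / M%:R = (x i - (c i)%:R) / M%:R.
    by rewrite /x; field; rewrite gt_eqF.
  rewrite normrM [`|_^-1|]ger0_norm ?invr_ge0 ?(ltW MR)//.
  rewrite -[leRHS]mul1r ler_wpM2r ?invr_ge0 ?(ltW MR)// cE.
  case/andP: (truncn_itv (x0 i)) => h1 h2.
  by rewrite ger0_norm ?subr_ge0// lerBlDr addrC natr1 ltW.
pose g := gridpt c.
have yg : y - g = \sum_(i < size vs) (a i - ((c i)%:R - M%:R) / M%:R) *: (gsvec vs)`_i.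
  by rewrite {1}yE /g /gridpt -sumrB; apply: eq_bigr => i _; rewrite scalerBl.
set m : R := (size vs)%:R / M%:R.
have m_le : 6 * m <= e by rewrite /m mulrA ler_pdivrMr.
have small (f : 'I_(size vs) -> R) (b : R) : 0 <= b -> (forall i, f i <= b / M%:R) ->
    \sum_(i < size vs) f i <= b * m.
  move=> b0 fb; apply: (le_trans (ler_sum _ (fun i _ => fb i))).
  by rewrite sumr_const card_ord -[_ *+ _]mulr_natr /m [_ / M%:R in leRHS]mulrC mulrA.
have d1 : l2norm (y - g) <= 1 * m.
  rewrite yg (le_trans (l2norm_sum _ _))// small// => i.
  by rewrite l2normZ mul1r -[leRHS]mulr1 ler_pM ?l2norm_ge0.
have d2 : l2norm (G *m (y - g)) <= 2 * m.
  rewrite yg mulmx_sumr (le_trans (l2norm_sum _ _))// small// => i.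
  by rewrite -scalemxAr l2normZ mulrC ler_pM ?l2norm_ge0.
have n1 : 1 <= l2norm g + l2norm (y - g).
  by rewrite -ny -{1}[y](subrKC g) l2normD.
have n2 : l2norm (G *m g) <= l2norm (G *m y) + l2norm (G *m (y - g)).
  by rewrite -[g in leLHS](subKr y) mulmxBr l2normB.
have n3 : (1 - e / 2) * (1 - m) <= l2norm (G *m g).
  apply: le_trans (lo c); rewrite ler_wpM2l//; first lra.
  by move: n1 d1; rewrite -/g; lra.
have m0 : 0 <= m by rewrite divr_ge0 ?ler0n.
have : e / 2 * m >= 0 by rewrite mulr_ge0// divr_ge0// ltW.
by move: n2 n3 d2 m_le; lra.
Qed.

End GridEmbedding.

Lemma span_map (R : realType) (m n : nat) (A : 'M[R]_(n, m))
    (us : seq 'cV[R]_m) x :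
  x \in <<us>>%VS -> A *m x \in <<map (mulmx A) us>>%VS.
Proof.
move=> xin; have := @coord_span _ _ _ (in_tuple us) x xin => ->.
rewrite mulmx_sumr memv_suml// => i _; rewrite -scalemxAr memvZ// memv_span//.
by rewrite map_f// mem_nth.
Qed.

(** * Descent of the potential along sequences of data points *)

Section Descent.
Variables (R : realType) (d t k : nat) (z e : R) (I : finType).
Variables (p : I -> 'cV[R]_d) (K : I -> R) (G : 'M[R]_(t, d)).
Variables (F : set 'cV[R]_d) (F' : set 'cV[R]_t) (ws0 : seq 'cV[R]_d).
Hypothesis z_ge1 : 1 <= z.
Hypothesis e_gt0 : 0 < e.
Hypothesis e_le8 : e <= 8^-1.
Hypothesis F_flat : is_flat k F.
Hypothesis F'_flat : is_flat k F'.
Hypothesis ws0_span : forall q, F q -> q \in <<ws0>>%VS.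
Hypothesis K_ge0 : forall i, 0 <= K i.

Local Notation L ws := (map (mulmx G) ws).
Local Notation OPT := (lz z (fun i => fdist F (p i))).
Let w i := K i `^ z.
Let a i := closest F' (G *m p i).
Let c i := G *m p i - a i.
Let b i := gsproj (L ws0) *m a i.

(** By [K_sens], points of total weight [m] contribute at most [m] times the [z]-th power of the
    cost, for every flat. *)
Definition wmass (P : I -> Prop) : R := \sum_(i | `[< P i >]) K i `^ z.

Hypothesis OPT_gt0 : 0 < OPT.
Hypothesis F_opt : forall F1, is_flat k F1 ->
  OPT <= lz z (fun i => fdist F1 (p i)).
Hypothesis K_sens : forall F1 i, is_flat k F1 ->
  fdist F1 (p i) <= K i * lz z (fun i => fdist F1 (p i)).
Hypothesis upper : lz z (fun i => l2norm (G *m (p i - closest F (p i)))) <= 2 * OPT.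
Hypothesis lower : lz z (fun i => l2norm (c i)) < OPT / (1 + 8 * e).

(** The two clauses supply the hypotheses of [det_potmx_step] with [c = (e / 3) ^- 2]: the first
    yields the angle between the projections of [G p i] and [b i], the second the bound on
    [dot b b]. *)
Definition goodstep ws i :=
  (1 + e) * l2norm (c i) < l2norm (G *m (p i - gslift G ws *m a i)) /\
  (e / 3) ^+ 2 * dot (b i) (b i) <=
    dot (gsproj (L ws) *m b i) (gsproj (L ws) *m b i).

Lemma residualE ws i :
  G *m (p i - gslift G ws *m a i) = c i + gsproj (L ws) *m a i.
Proof. by rewrite mulmxBr mulmxA gsliftK mulmxBl mul1mx opprB addrCA addrC. Qed.

Lemma gsproj_b ws i : {subset ws0 <= ws} ->
  gsproj (L ws) *m b i = gsproj (L ws) *m a i.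
Proof.
move=> sub; rewrite /b mulmxA gsproj_absorb// => _ /mapP[x xin ->].
by rewrite memv_span// map_f// sub.
Qed.

(** Split [c i = s + r] with [r] its projection off the span; then [s] is orthogonal to [u = r + q],
    and the first clause of [goodstep] gives [(1 + e)^2 |r|^2 < |u|^2]. For [e <= 1 / 8] this
    implies [|u - q|^2 <= (1 - e) |u|^2], that is [|q|^2 + e |u|^2 <= 2 u.q], and the inequality of
    arithmetic and geometric means concludes. *)
Lemma goodstep_angle ws i : {subset ws0 <= ws} -> goodstep ws i ->
  let u := gsproj (L ws) *m (G *m p i) in let q := gsproj (L ws) *m b i in
  e * (dot q q * dot u u) <= dot u q ^+ 2 /\ 0 < dot u q.
Proof.
move=> sub [gd _] u q.
have uE : u = gsproj (L ws) *m c i + q.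
  by rewrite /q gsproj_b// -mulmxDr /c subrK.
have qE : q = gsproj (L ws) *m a i by exact: gsproj_b.
pose r := gsproj (L ws) *m c i.
have [s sE] : exists s, s = c i - r by exists (c i - r).
have su : dot s u = 0.
  by rewrite /u -dot_gsproj sE /r mulmxBr gsprojK subrr dot0l.
have sr : dot s r = 0.
  by rewrite /r -dot_gsproj sE /r mulmxBr gsprojK subrr dot0l.
have cE : dot (c i) (c i) = dot s s + dot r r.
  by rewrite -[c i](subrK r) -sE dotDl !dotDr (dotC r s) sr addr0 add0r.
have c1E : dot (c i + q) (c i + q) = dot s s + dot u u.
  have -> : c i + q = s + u by rewrite uE sE addrA subrK.
  by rewrite dotDl !dotDr (dotC u s) su addr0 add0r.
have : ((1 + e) * l2norm (c i)) ^+ 2 < l2norm (c i + q) ^+ 2.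
  rewrite ltr_pXn2r// ?nnegrE ?mulr_ge0 ?l2norm_ge0 ?addr_ge0 ?(ltW e_gt0)//.
  by rewrite qE -residualE.
rewrite exprMn !sqr_l2norm cE c1E => lt.
have ss := dot_ge0 s; have rr := dot_ge0 r; have uu := dot_ge0 u.
have qq := dot_ge0 q.
have rE : dot r r = dot u u - 2 * dot u q + dot q q.
  have -> : r = u - q by rewrite uE addrK.
  by rewrite dotBl !dotBr (dotC q u); ring.
have h1 : (1 + e) ^+ 2 * dot r r < dot u u.
  have : dot s s <= (1 + e) ^+ 2 * dot s s.
    by rewrite ler_peMl// exprn_ege1// lerDl ltW.
  by move: lt; lra.
have h2 : dot r r <= (1 - e) * dot u u.
  have A : 1 <= (1 - e) * (1 + e) ^+ 2 by have := e_gt0; have := e_le8; nra.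
  have B : dot r r <= (1 - e) * ((1 + e) ^+ 2 * dot r r) by rewrite mulrA ler_peMl.
  by apply: (le_trans B); rewrite ler_wpM2l ?(ltW h1)//; have := e_le8; lra.
have u_gt0 : 0 < dot u u.
  by apply: le_lt_trans h1; rewrite mulr_ge0// exprn_ge0// addr_ge0// ltW.
have h3 : dot q q + e * dot u u <= 2 * dot u q by move: h2; rewrite rE; lra.
have eu : 0 < e * dot u u by rewrite mulr_gt0.
split; last by move: h3 qq eu; lra.
have : (dot q q + e * dot u u) ^+ 2 <= (2 * dot u q) ^+ 2.
  rewrite ler_pXn2r// ?nnegrE; first by rewrite addr_ge0// ltW.
  by move: h3 qq eu; lra.
have := sqr_ge0 (dot q q - e * dot u u).
by rewrite !expr2; move: (dot q q) (dot u u) (dot u q) => x y v; lra.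
Qed.

Lemma not_goodstep ws i : {subset ws0 <= ws} -> ~ goodstep ws i ->
  l2norm (G *m (p i - gslift G ws *m a i)) <=
    (1 + e) * l2norm (c i) + e / 3 * l2norm (b i).
Proof.
move=> sub ng.
have e3 : 0 <= e / 3 by rewrite divr_ge0// ltW.
have [le|gt] := leP (l2norm (G *m (p i - gslift G ws *m a i))) ((1 + e) * l2norm (c i)).
  by rewrite (le_trans le)// lerDl mulr_ge0 ?l2norm_ge0.
rewrite residualE (le_trans (l2normD _ _))// lerD//.
  by rewrite ler_peMl ?l2norm_ge0// lerDl ltW.
rewrite -gsproj_b//.
have [le2|gt2] := leP ((e / 3) ^+ 2 * dot (b i) (b i))
    (dot (gsproj (L ws) *m b i) (gsproj (L ws) *m b i)); first by case: ng.
rewrite -(@ler_pXn2r _ 2)// ?nnegrE ?(mulr_ge0 e3) ?l2norm_ge0//.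
by rewrite exprMn !sqr_l2norm ltW.
Qed.

(** [a i] is [G p i - c i], and the projection removes the image of [closest F (p i)], which lies in
    the span of [ws0]. The two remaining parts are bounded by [upper] and [lower]. *)
Lemma lz_b : lz z (fun i => l2norm (b i)) <= 3 * OPT.
Proof.
have : lz z (fun i => l2norm (b i)) <=
    lz z (fun i => l2norm (G *m (p i - closest F (p i)))) +
    lz z (fun i => l2norm (c i)).
  apply: lzD_abs => // i; rewrite !ger0_norm ?l2norm_ge0// /b.
  have -> : a i = G *m p i - c i by rewrite /c subKr.
  rewrite mulmxBr (le_trans (l2normB _ _))// lerD ?l2norm_gsproj//.
  rewrite mulmxBr l2norm_gsproj_le// span_map// ws0_span//.
  exact: closest_mem F_flat.
have : OPT / (1 + 8 * e) <= OPT.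
  by rewrite ler_pdivrMr ?ler_peMr ?(ltW OPT_gt0)//; have := e_gt0; lra.
by move: upper lower; lra.
Qed.

(** Suppose the good steps had small weight. Let [D >= OPT] be the cost of the lifted flat. Points
    in [B] and good steps together weigh less than [e], so dropping them leaves at least
    [(1 - e) D]. For the other points [G] is nearly isometric and [not_goodstep] applies; with
    [lz_b] this gives [(1 - e)^2 OPT <= (1 + e) OPT / (1 + 8 e) + e OPT], which is false for
    [e <= 1 / 8]. *)
Lemma goodstep_mass ws (B : I -> Prop) : {subset ws0 <= ws} ->
  (forall i, ~ B i -> forall y, y \in <<p i :: ws>>%VS ->
     (1 - e) * l2norm y <= l2norm (G *m y)) ->
  wmass B < e / 2 -> e / 2 <= wmass (goodstep ws).
Proof.
move=> sub emb Bsmall; rewrite leNgt; apply/negP => Gsmall.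
pose F2 := mulmx (gslift G ws) @` F'.
have F2f : is_flat k F2 by exact: flat_image.
set C := lz z (fun i => fdist F2 (p i)).
have [D DE] : exists D, D = C by exists C.
have OC : OPT <= D by rewrite DE; exact: F_opt.
have D0 : 0 < D by exact: lt_le_trans OC.
pose Y i := ~ B i /\ ~ goodstep ws i.
pose f i := if `[< Y i >] then fdist F2 (p i) else 0.
have f0 i : 0 <= f i by rewrite /f; case: ifP => // _; exact: l2norm_ge0.
have e1 : 0 <= 1 - e <= 1 by have := e_gt0; have := e_le8; lra.
have z0 : 0 <= z by apply: le_trans z_ge1.
have lf : (1 - e) * D <= lz z f.
  apply: (le_root z_ge1); rewrite ?lz_ge0 ?mulr_ge0 ?(ltW D0)//; first by case/andP: e1.
  rewrite powRM ?(ltW D0)//; last by case/andP: e1.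
  (* As [z >= 1], a loss of the fraction [e] of the [z]-th powers costs at most the factor [1 - e]
     on the norm. *)
  apply: (@le_trans _ _ ((1 - e) * D `^ z)).
    rewrite ler_wpM2r ?powR_ge0//.
    have [->|ne] := eqVneq (1 - e) 0; first by rewrite powR0// gt_eqF// (lt_le_trans _ z_ge1).
    by rewrite ge1r_powR// lt_def ne; case/andP: e1 => -> ->.
  have : D `^ z <= \sum_i `|f i| `^ z + (wmass B + wmass (goodstep ws)) * D `^ z.
    rewrite {1}DE lz_powR// /wmass mulrDl !mulr_suml.
    rewrite [X in _ + (X + _)]big_mkcond [X in _ + (_ + X)]big_mkcond -!big_split/=.
    apply: ler_sum => i _.
    have wi : `|fdist F2 (p i)| `^ z <= K i `^ z * D `^ z.
      rewrite -powRM ?(ltW D0)// le_powz// ger0_norm ?l2norm_ge0// DE.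
      exact: K_sens.
    have KD : 0 <= K i `^ z * D `^ z by rewrite mulr_ge0 ?powR_ge0.
    rewrite /f; case: asboolP => [_|nY].
      by rewrite lerDl addr_ge0//; case: ifP.
    rewrite normr0 powR0 ?gt_eqF ?(lt_le_trans _ z_ge1)// add0r.
    case: asboolP => [_|nB]; first by rewrite (le_trans wi)// lerDl; case: ifP.
    case: asboolP => [_|nG]; first by rewrite add0r.
    by exfalso; apply: nY.
  rewrite lz_powR//; have Dz : 0 < D `^ z by exact: powR_gt0.
  have : (wmass B + wmass (goodstep ws)) * D `^ z <= e * D `^ z.
    by rewrite ler_wpM2r ?(ltW Dz)//; move: Bsmall Gsmall; lra.
  by lra.
have fb : (1 - e) * lz z f <= (1 + e) * lz z (fun i => l2norm (c i)) +
    e / 3 * lz z (fun i => l2norm (b i)).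
  have e2 : 0 <= 1 - e by case/andP: e1.
  have e3 : 0 <= 1 + e by rewrite addr_ge0 ?(ltW e_gt0).
  have e4 : 0 <= e / 3 by rewrite divr_ge0 ?(ltW e_gt0).
  rewrite -!lzZ_ge0//; apply: lzD_abs => // i.
  rewrite !ger0_norm ?(mulr_ge0 e2) ?(mulr_ge0 e3) ?(mulr_ge0 e4) ?l2norm_ge0//.
  rewrite /f; case: asboolP => [[nB nG]|_]; last first.
    by rewrite mulr0 addr_ge0 ?(mulr_ge0 e3) ?(mulr_ge0 e4) ?l2norm_ge0.
  apply: le_trans (not_goodstep sub nG).
  apply: le_trans (emb i nB _ _); last first.
    rewrite memvB//; first by rewrite memv_span ?mem_head.
    by rewrite span_cons (subvP (addvSr _ _))// gslift_span.
  rewrite ler_wpM2l//.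
  apply: (closest_le _ F2f); exists (a i) => //.
  exact: closest_mem F'_flat.
have : (1 - e) * ((1 - e) * OPT) <= (1 + e) * (OPT / (1 + 8 * e)) + e / 3 * (3 * OPT).
  apply: (@le_trans _ _ ((1 - e) * lz z f)).
    rewrite ler_wpM2l//; first by case/andP: e1.
    by apply: le_trans lf; rewrite ler_wpM2l//; case/andP: e1.
  apply: (le_trans fb); apply: lerD; rewrite ler_wpM2l ?addr_ge0 ?divr_ge0 ?(ltW e_gt0)//.
    exact: ltW.
  exact: lz_b.
(* After clearing [OPT] the claim is [1 + 2 e + 8 e^2 < (1 - e)^2 (1 + 8 e)]. This is what the slack
   [8 e] in [lower] is for. *)
apply/negP; rewrite -ltNge.
have e8 : 0 < 1 + 8 * e by have := e_gt0; lra.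
have [opt OE] : exists opt, opt = OPT by exists OPT.
have O0 : 0 < opt by rewrite OE.
rewrite -OE -(@ltr_pM2r _ (1 + 8 * e))// mulrDl -[_ * _ * (1 + 8 * e)]mulrA divfK ?gt_eqF//.
have -> : (1 + e) * opt + e / 3 * (3 * opt) * (1 + 8 * e) = opt * (1 + e + e * (1 + 8 * e)).
  by field.
have -> : (1 - e) * ((1 - e) * opt) * (1 + 8 * e) = opt * ((1 - e) ^+ 2 * (1 + 8 * e)).
  by ring.
by rewrite ltr_pM2l//; have := e_gt0; have := e_le8; nra.
Qed.

(* [bad_iter M j ws]: from [ws], sampling [p i] with weight [K i ^ z] at each
   step, the grid test fails within [j] steps with substantial weight. *)
Fixpoint bad_iter (M j : nat) (ws : seq 'cV[R]_d) : Prop :=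
  if j is j'.+1 then
    e / 2 <= wmass (fun i => ~ gridok e M G (p i :: ws)) \/
    e / 2 <= wmass (fun i => bad_iter M j' (p i :: ws))
  else False.

Lemma wmass_mono (P Q : I -> Prop) : (forall i, P i -> Q i) ->
  wmass P <= wmass Q.
Proof.
move=> PQ; rewrite /wmass [leRHS]big_mkcond [leLHS]big_mkcond; apply: ler_sum => i _.
case: asboolP => [/PQ Qi|_]; case: asboolP => // _; exact: powR_ge0.
Qed.

(** Unless grid failure is already heavy, the good steps are heavy by [goodstep_mass]. Prepending
    any of them to [ws] multiplies the determinant by at most [1 - e / 2], so the induction
    hypothesis puts all of them in the next bad set. At [j = 0] the budget contradicts
    [det_potmx_ge1]. *)
Lemma pot_bad_iter cs M j ws : (0 < M)%N ->
  (forall i, b i \in <<cs>>%VS) ->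
  {subset ws0 <= ws} -> 6 * (size ws + j)%:R <= e * M%:R ->
  \det (potmx ((e / 3) ^- 2) cs (L ws)) * (1 - e / 2) ^+ j < 1 ->
  bad_iter M j ws.
Proof.
move=> M0 bcs.
have c0 : 0 < (e / 3) ^- 2 by rewrite invr_gt0 exprn_gt0// divr_gt0.
elim: j ws => [|j IH] ws sub fine small /=.
  by move: small; rewrite expr0 mulr1 ltNge (det_potmx_ge1 c0).
have [le|gt] := leP (e / 2) (wmass (fun i => ~ gridok e M G (p i :: ws))); [by left|right].
apply: (@le_trans _ _ (wmass (goodstep ws))).
  apply: goodstep_mass gt => // i /contrapT ok y yin.
  apply: (grid_embedding e_gt0 _ M0 _ ok) => //.
    by rewrite (le_trans e_le8)// invf_le1 ?ler1n.
  by apply: le_trans fine; rewrite ler_pM2l// ler_nat /= addnS ltnS leq_addr.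
apply: wmass_mono => i gi; apply: IH.
- by move=> x /sub xin; rewrite in_cons xin orbT.
- by rewrite /= addSn -addnS.
have [ang uq] := goodstep_angle sub gi.
apply: le_lt_trans small; rewrite [_ ^+ j.+1]exprS mulrA ler_wpM2r//.
  by rewrite exprn_ge0//; have := e_le8; have := e_gt0; lra.
rewrite [leRHS]mulrC; apply: (det_potmx_step c0 (bcs i) (ltW e_gt0) _ ang uq).
by rewrite mulrC ler_pdivlMr ?exprn_gt0 ?divr_gt0// mulrC; exact: gi.2.
Qed.

(** [cs] consists of at most [k + 1] vectors spanning [F'], projected off the initial span; these
    are fixed by that projection, as [det_potmx_le] requires. The conclusion no longer involves
    [F']: one event in [G] covers all flats. *)
Lemma bad_iter_of_failure M j : (0 < M)%N ->
  6 * (size ws0 + j)%:R <= e * M%:R ->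
  (1 + (e / 3) ^- 2) ^+ k.+1 * (1 - e / 2) ^+ j < 1 -> bad_iter M j ws0.
Proof.
move=> M0 fine small.
have c0 : 0 < (e / 3) ^- 2 by rewrite invr_gt0 exprn_gt0// divr_gt0.
have [us [size_us usF']] := flat_span F'_flat.
apply: (@pot_bad_iter (map (mulmx (gsproj (L ws0))) us)) => // [i|].
  by rewrite /b span_map// usF'//; exact: closest_mem F'_flat.
apply: le_lt_trans small; rewrite ler_wpM2r//.
  by rewrite exprn_ge0//; have := e_le8; have := e_gt0; lra.
apply: (le_trans (det_potmx_le c0 _)) => [_ /mapP[x _ ->]|].
  by rewrite gsprojK.
by rewrite size_map ler_weXn2l// lerDl ltW.
Qed.

End Descent.

(** * Independence *)

Section IndependentSigmaAlgebras.
Local Open Scope ereal_scope.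
Context d (T : measurableType d) (R : realType) (P : probability T R).

(** [P (A & B)] and [P A * P B] are finite measures in [A] that agree on a generating pi-system. The
    two-sided version applies this once in each argument. *)
Let indep1 (G : set (set T)) (B : set T) : G `<=` measurable -> G setT ->
  setI_closed G -> measurable B ->
  (forall A, G A -> P (A `&` B) = P A * P B) ->
  forall A, <<s G >> A -> P (A `&` B) = P A * P B.
Proof.
move=> Gm GT GI mB H A sA.
have PBfin : P B \is a fin_num by exact: fin_num_measure.
have PB0 : (0 <= fine (P B))%R by rewrite fine_ge0.
pose m1 : {measure set T -> \bar R} := mrestr P mB.
pose m2 : {measure set T -> \bar R} := mscale (NngNum PB0) P.
have m1E X : m1 X = P (X `&` B) by [].
have m2E X : m2 X = P X * P B by rewrite /m2/= /mscale/= fineK// muleC.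
rewrite -m1E -m2E.
apply: (@g_sigma_algebra_measure_unique _ _ _ G Gm (fun=> setT)) => //.
- by rewrite bigcup_const//; exists 0%N.
- by move=> X GX; rewrite m1E m2E H.
- by move=> _; rewrite m1E setTI (le_lt_trans (probability_le1 _ mB))// ltry.
Qed.

Lemma indep_sigma (G1 G2 : set (set T)) :
  G1 `<=` measurable -> G1 setT -> setI_closed G1 ->
  G2 `<=` measurable -> G2 setT -> setI_closed G2 ->
  (forall A B, G1 A -> G2 B -> P (A `&` B) = P A * P B) ->
  forall A B, <<s G1 >> A -> <<s G2 >> B -> P (A `&` B) = P A * P B.
Proof.
move=> m1 T1 I1 m2 T2 I2 H A B sA sB.
have mA : measurable A.
  by move: A sA; apply: smallest_sub => //; exact: sigma_algebra_measurable.
rewrite setIC muleC; apply: (indep1 m2 T2 I2 mA) sB => {}B G2B.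
rewrite setIC muleC; apply: (indep1 m1 T1 I1) sA => [|{mA} A G1A]; last exact: H.
exact: m2.
Qed.

End IndependentSigmaAlgebras.

Section IndependentPair.
Local Open Scope ereal_scope.
Context d (T : measurableType d) (R : realType) (P : probability T R).
Variables (Y Z : {mfun T >-> R}).
Hypothesis YZ_indep : forall A B : set R, measurable A -> measurable B ->
  P (Y @^-1` A `&` Z @^-1` B) = P (Y @^-1` A) * P (Z @^-1` B).

Let YZ : T -> R * R := fun w => (Y w, Z w).

Let measurable_YZ : measurable_fun setT YZ.
Proof. exact: measurable_fun_pair. Qed.

Let YZm : {mfun T >-> (R * R)%type} := mfun_Sub (mem_set measurable_YZ).

Lemma indep_pair_law (D : set (R * R)) : measurable D ->
  P (YZ @^-1` D) = (distribution P Y \x distribution P Z) D.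
Proof.
move=> mD; apply/esym.
apply: (@product_measure_unique _ _ _ _ _ _ _ (distribution P YZm)); last exact: mD.
by move=> A B mA mB; rewrite /distribution/= /pushforward/= -YZ_indep.
Qed.

Lemma indep_expectationM : (forall w, (0 <= Y w)%R) -> (forall w, (0 <= Z w)%R) ->
  \int[P]_w (Y w * Z w)%:E = \int[P]_w (Y w)%:E * \int[P]_w (Z w)%:E.
Proof.
move=> Y0 Z0.
(* The absolute values make the integrand nonnegative on the whole plane, as Tonelli requires; they
   change nothing on the values of [Y] and [Z]. *)
pose h (u : R * R) : \bar R := (`|u.1| * `|u.2|)%:E.
have mh : measurable_fun [set: R * R] h.
  by apply/measurable_EFinP; apply: measurable_funM; exact: measurableT_comp.
have h0 u : 0 <= h u by rewrite lee_fin mulr_ge0.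
have mabs : measurable_fun setT (fun y : R => `|y|%:E).
  by apply/measurable_EFinP; exact: normr_measurable.
have -> : \int[P]_w (Y w * Z w)%:E = \int[P]_w (h \o YZm) w.
  by apply: eq_integral => w _; rewrite /h /= !ger0_norm.
rewrite -(@ge0_integral_distribution _ _ _ _ _ P YZm)//.
rewrite (eq_measure_integral (distribution P Y \x distribution P Z)); last first.
  by move=> A mA _; rewrite /= -indep_pair_law.
rewrite fubini_tonelli1//= /fubini_F /=.
under eq_integral => x _.
  rewrite /h /=; under eq_integral do rewrite EFinM.
  rewrite ge0_integralZl//; over.
rewrite ge0_integralZr//; last exact: integral_ge0.
rewrite !ge0_integral_distribution//=.
by congr (_ * _); apply: eq_integral => w _; rewrite /= ger0_norm.
Qed.

End IndependentPair.

(** * Functions of disjoint blocks of independent variables *)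

Section MutualIndependence.
Local Open Scope ereal_scope.
Context d (T : measurableType d) (R : realType) (P : probability T R).
Variables (I : finType) (X : I -> {RV P >-> R}).
Hypothesis X_indep : mutually_independent X.
Implicit Types (J : {set I}).

Definition rect J (A : I -> set R) := \bigcap_(i in [set` J]) (X i @^-1` A i).

Definition rects J : set (set T) :=
  [set B | exists2 A : I -> set R, (forall i, measurable (A i)) & B = rect J A].

Let rects_measurable J : rects J `<=` measurable.
Proof.
move=> _ [A mA ->]; apply: fin_bigcap_measurable => // i _.
by rewrite -[_ @^-1` _]setTI; exact: measurable_funPT.
Qed.

Let rectsT J : rects J setT.
Proof.
exists (fun=> setT) => //; rewrite /rect.
by rewrite bigcapT.
Qed.

Let rectsI J : setI_closed (rects J).
Proof.
move=> _ _ [A mA ->] [B mB ->]; exists (fun i => A i `&` B i).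
  by move=> i; exact: measurableI.
by rewrite /rect -bigcapI.
Qed.

(** Measurability for the sigma-algebra generated by the [X i] with [i] in [J]: [rects J] is a
    pi-system generating it. Stated as an instance of [measurable_fun], it inherits the closure
    lemmas for sums and products. *)
Definition jmeas J (f : T -> R) :=
  @measurable_fun _ _ (g_sigma_algebraType (rects J)) R setT f.

Lemma jmeasE J f : jmeas J f ->
  forall A : set R, measurable A -> <<s rects J >> (f @^-1` A).
Proof. by move=> mf A mA; have := mf measurableT A mA; rewrite setTI. Qed.

Lemma jmeas_measurable J f : jmeas J f -> measurable_fun setT f.
Proof.
move=> mf _ A mA; rewrite setTI; have := jmeasE mf mA.
move: (f @^-1` A); apply: smallest_sub; first exact: sigma_algebra_measurable.
exact: rects_measurable.
Qed.

Lemma jmeas_X J i : i \in J -> jmeas J (X i).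
Proof.
move=> iJ _ A mA; rewrite setTI; apply: sub_sigma_algebra.
exists (fun l => if l == i then A else setT); first by move=> l; case: ifP.
apply/seteqP; split=> [w Aw l _ /=|w /(_ i iJ)/=]; last by rewrite eqxx.
by case: eqP => // ->.
Qed.

Lemma jmeas_sub J J' f : J \subset J' -> jmeas J f -> jmeas J' f.
Proof.
move=> JJ' mf _ A mA; rewrite setTI.
have := jmeasE mf mA; move: (f @^-1` A); apply: (smallest_sub (smallest_sigma_algebra _ _)) => _ [B mB ->].
apply: sub_sigma_algebra.
exists (fun l => if l \in J then B l else setT).
  by move=> l; case: ifP.
apply/seteqP; split=> [w Bw l _ /=|w Bw l /= lJ]; first by case: ifP => // lJ; exact: Bw.
by have := Bw l (fintype.subsetP JJ' _ lJ); rewrite /= lJ.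
Qed.

Lemma indep_rect J1 J2 A B : (forall i, i \in J1 -> i \notin J2) -> rects J1 A -> rects J2 B ->
  P (A `&` B) = P A * P B.
Proof.
move=> dis [A1 mA ->] [A2 mB ->].
pose C i := if i \in J1 then A1 i else A2 i.
have mC i : measurable (C i) by rewrite /C; case: ifP.
have -> : rect J1 A1 `&` rect J2 A2 = rect (J1 :|: J2) C.
  apply/seteqP; split=> [w [h1 h2] i /=|w h].
    by rewrite inE /C /=; case: ifP => [iJ _|_ /= iJ2]; [exact: h1|exact: h2].
  split=> i /= iJ; have := h i; rewrite /= inE iJ ?orbT => /(_ isT).
    by rewrite /C iJ.
  by rewrite /C; case: ifP => // /dis; rewrite iJ.
rewrite /rect !X_indep// (eq_bigl [predU J1 & J2])/=; last by move=> i; rewrite !inE.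
rewrite bigU/=; last first.
  by rewrite disjoint_subset; apply/fintype.subsetP => i /dis; rewrite !inE.
congr (_ * _); apply: eq_bigr => i iJ; rewrite /C ?iJ//.
by case: ifP => // /dis; rewrite iJ.
Qed.

Lemma jmeas_indep J1 J2 f g : (forall i, i \in J1 -> i \notin J2) ->
  jmeas J1 f -> jmeas J2 g -> forall A B : set R, measurable A -> measurable B ->
  P (f @^-1` A `&` g @^-1` B) = P (f @^-1` A) * P (g @^-1` B).
Proof.
move=> dis mf mg A B mA mB.
apply: (indep_sigma (@rects_measurable J1) (@rectsT J1) (@rectsI J1)
  (@rects_measurable J2) (@rectsT J2) (@rectsI J2)).
- by move=> ? ?; exact: indep_rect.
- exact: jmeasE.
- exact: jmeasE.
Qed.

Lemma jmeas_expectationM J1 J2 f g : (forall i, i \in J1 -> i \notin J2) ->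
  jmeas J1 f -> jmeas J2 g -> (forall w, (0 <= f w)%R) -> (forall w, (0 <= g w)%R) ->
  \int[P]_w (f w * g w)%:E = \int[P]_w (f w)%:E * \int[P]_w (g w)%:E.
Proof.
move=> dis mf mg f0 g0.
pose Y : {mfun T >-> R} := mfun_Sub (mem_set (jmeas_measurable mf)).
pose Z : {mfun T >-> R} := mfun_Sub (mem_set (jmeas_measurable mg)).
by apply: (@indep_expectationM _ _ _ _ Y Z) => // A B mA mB;
  exact: (jmeas_indep dis mf mg).
Qed.

(** Induction on a list of blocks: the product over the tail is measurable for the union of its
    blocks, which is disjoint from the head block. *)
Lemma jmeas_expectation_prod (L : finType) (J : L -> {set I}) (f : L -> T -> R) :
  (forall l l', l != l' -> (forall i, i \in J l -> i \notin J l')) ->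
  (forall l, jmeas (J l) (f l)) -> (forall l w, (0 <= f l w)%R) ->
  \int[P]_w (\prod_l f l w)%:E = \prod_l \int[P]_w (f l w)%:E.
Proof.
move=> dis mf f0.
have meas s : jmeas (\bigcup_(l <- s) J l) (fun w => \prod_(l <- s) f l w)%R.
  apply: (@measurable_prod _ (g_sigma_algebraType _)) => l ls.
  apply: jmeas_sub (mf l); rewrite (big_rem l)//=; exact: finset.subsetUl.
suff H s : uniq s -> \int[P]_w (\prod_(l <- s) f l w)%:E =
    \prod_(l <- s) \int[P]_w (f l w)%:E by exact/H/index_enum_uniq.
elim: s => [_|l s IH /= /andP[ls us]].
  rewrite big_nil; under eq_integral do rewrite big_nil.
  by rewrite integral_cst// mul1e; exact: probability_setT.
rewrite big_cons -IH//; under eq_integral do rewrite big_cons.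
apply: (jmeas_expectationM _ (mf l) (meas s)) => [|//|w]; last exact: prodr_ge0.
move=> i il; elim: s ls {us IH} => [_|l' s IH].
  by rewrite big_nil inE.
rewrite in_cons negb_or big_cons inE negb_or => /andP[ll' /IH ->].
by rewrite andbT (dis l).
Qed.

End MutualIndependence.

(** * Gaussian moments and tails *)

Section GaussianIntegrals.
Local Open Scope ereal_scope.
Context {R : realType}.
Local Notation leb := (@lebesgue_measure R).
Import HBNNSimple.

(** The law is given on sets as the integral of its density; this extends to simple functions by
    linearity and to nonnegative ones by monotone convergence on both sides. *)
Lemma integral_normal_prob (s : R) (f : R -> \bar R) :
  measurable_fun [set: measurableTypeR R] f -> (forall x, 0 <= f x) ->
  \int[normal_prob 0 s]_x f x = \int[leb]_x (f x * (normal_pdf 0 s x)%:E).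
Proof.
move=> mf f0; pose h := nnsfun_approx measurableT mf.
have g0 x : 0 <= (normal_pdf 0 s x)%:E by rewrite lee_fin normal_pdf_ge0.
have mg : measurable_fun setT (fun x => (normal_pdf 0 s x)%:E).
  by apply/measurable_EFinP; exact: measurable_normal_pdf.
have mh n : measurable_fun setT (fun x => (h n x)%:E) by exact/measurable_EFinP.
have hcvg x : (h n x)%:E @[n --> \oo] --> f x by exact: cvg_nnsfun_approx.
have hnd x : {homo (fun n => (h n x)%:E) : m n / (m <= n)%N >-> m <= n}.
  by move=> m n mn; rewrite lee_fin; exact/lefP/nd_nnsfun_approx.
have step n : \int[normal_prob 0 s]_x (h n x)%:E =
              \int[leb]_x ((h n x)%:E * (normal_pdf 0 s x)%:E).
  rewrite (integralT_nnsfun (normal_prob 0 s) (h n)) sintegralE.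
  transitivity (\int[leb]_x (\sum_(y \in range (h n))
      ((y * \1_(h n @^-1` [set y]) x)%:E * (normal_pdf 0 s x)%:E))).
    rewrite ge0_integral_fsum//.
    - apply: eq_fsbigr => y /[!inE] -[x _ <-{y}].
      under eq_integral do rewrite EFinM -muleA.
      rewrite ge0_integralZl ?lee_fin//.
      + congr (_ * _); rewrite /normal_prob /= [LHS]integral_mkcond.
        apply: eq_integral => u _.
        by rewrite epatch_indic muleC.
      + by apply: emeasurable_funM => //; exact/measurable_EFinP/measurable_indic.
      + by move=> u _; rewrite mule_ge0// lee_fin.
    - move=> y; apply: emeasurable_funM => //; apply/measurable_EFinP.
      by apply: measurable_funM => //; exact: measurable_indic.
    - by move=> y x _; rewrite mule_ge0//; exact: nnfun_muleindic_ge0.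
  apply: eq_integral => x _.
  rewrite -ge0_mule_fsuml; last by move=> y; exact: nnfun_muleindic_ge0.
  by rewrite fsumEFin// -fimfunE.
transitivity (limn (fun n => \int[normal_prob 0 s]_x (h n x)%:E)).
  rewrite -monotone_convergence//.
  - by apply: eq_integral => x _; apply/esym/cvg_lim.
  - by move=> n x _; rewrite lee_fin.
under eq_fun do rewrite step.
rewrite -monotone_convergence//.
- apply: eq_integral => x _; apply: cvg_lim => //.
  exact: cvgeZr.
- by move=> n; exact: emeasurable_funM.
- by move=> n x _; rewrite mule_ge0// lee_fin.
- by move=> x _ m n mn; rewrite lee_wpmul2r//; exact: hnd.
Qed.

(** Completing the square turns the integrand into a constant times the density with mean
    [a s^2]. *)
Lemma normal_mgf (s a : R) : s != 0%R ->
  \int[leb]_x ((expR (a * x))%:E * (normal_pdf 0 s x)%:E) =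
  (expR (a ^+ 2 * s ^+ 2 / 2))%:E.
Proof.
move=> s0.
under eq_integral => x _.
  rewrite -EFinM (_ : (expR (a * x) * normal_pdf 0 s x)%R =
    (expR (a ^+ 2 * s ^+ 2 / 2) * normal_pdf (a * s ^+ 2) s x)%R); last first.
    rewrite !normal_pdfE//= mulrCA [RHS]mulrCA; congr (_ * _)%R.
    rewrite -!expRD; congr expR.
    rewrite mulr2n; field.
    by rewrite -mulr2n mulrn_eq0 /= sqrf_eq0.
  rewrite EFinM; over.
rewrite ge0_integralZl ?lee_fin ?expR_ge0//.
- by rewrite integral_normal_pdf mule1.
- by apply/measurable_EFinP; exact: measurable_normal_pdf.
- by move=> x _; rewrite lee_fin normal_pdf_ge0.
Qed.

(** The integrand is [s] times the centred normal density of standard deviation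
    [s = (1 - 2 b)^(-1/2)]. *)
Lemma normal_quadratic_mgf (b : R) : (b < 1 / 2)%R ->
  \int[leb]_x ((expR (b * x ^+ 2))%:E * (normal_pdf 0 1 x)%:E) =
  ((Num.sqrt (1 - 2 * b))^-1)%:E.
Proof.
move=> b_lt; have c0 : (0 < 1 - 2 * b)%R by lra.
pose s := (Num.sqrt (1 - 2 * b))^-1%R.
have s0 : (0 < s)%R by rewrite invr_gt0 sqrtr_gt0.
have s2 : (s ^+ 2 = (1 - 2 * b)^-1)%R by rewrite exprVn sqr_sqrtr// ltW.
under eq_integral => x _.
  rewrite -EFinM (_ : (expR (b * x ^+ 2) * normal_pdf 0 1 x)%R = (s * normal_pdf 0 s x)%R); last first.
    rewrite !normal_pdfE ?gt_eqF ?oner_neq0//=.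
    rewrite mulrCA [RHS]mulrA; congr (_ * _)%R; last first.
      rewrite /normal_fun -expRD; congr expR; rewrite s2 subr0.
      by rewrite !mulr2n expr1n; field; rewrite gt_eqF.
    rewrite /normal_peak expr1n mul1r -mulrnAr sqrtrM ?sqr_ge0// sqrtr_sqr.
    by rewrite ger0_norm ?(ltW s0)// invfM mulrA divff ?mul1r ?gt_eqF.
  rewrite EFinM; over.
rewrite ge0_integralZl ?lee_fin ?(ltW s0)//.
- by rewrite integral_normal_pdf mule1.
- by apply/measurable_EFinP; exact: measurable_normal_pdf.
- by move=> x _; rewrite lee_fin normal_pdf_ge0.
Qed.

End GaussianIntegrals.

Section GaussianMap.
Local Open Scope ereal_scope.
Context (R : realType) (disp : measure_display) (T : measurableType disp).
Context (P : probability T R) (d t : nat) (G : 'I_t -> 'I_d -> {RV P >-> R}).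
Hypothesis G_iid : iid_gaussian_entries G.
Hypothesis t_gt0 : (0 < t)%N.
Local Notation leb := (@lebesgue_measure R).

Let tR_gt0 : (0 < t%:R :> R)%R. Proof. by rewrite ltr0n. Qed.
Let sigma_neq0 : (Num.sqrt t%:R^-1 != 0 :> R)%R.
Proof. by rewrite gt_eqF// sqrtr_gt0 invr_gt0. Qed.

Definition grow (i : 'I_t) (v : 'cV[R]_d) (w : T) : R :=
  (\sum_(j < d) G i j w * v j 0)%R.

Definition gsq (v : 'cV[R]_d) (w : T) : R :=
  dot (random_map G w v) (random_map G w v).

Lemma random_mapE v w i : random_map G w v i 0%R = grow i v w.
Proof. by rewrite !mxE; apply: eq_bigr => j _; rewrite !mxE. Qed.

Lemma gsqE v w : gsq v w = (\sum_(i < t) grow i v w ^+ 2)%R.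
Proof. by apply: eq_bigr => i _; rewrite !random_mapE expr2. Qed.

Lemma measurable_grow i v : measurable_fun setT (grow i v).
Proof. by apply: measurable_sum => j; exact: measurable_funM. Qed.

Lemma measurable_gsq v : measurable_fun setT (gsq v).
Proof.
rewrite (_ : gsq v = fun w => (\sum_(i < t) grow i v w ^+ 2)%R).
  by apply: measurable_sum => i; apply: measurable_funX; exact: measurable_grow.
by apply/funext => w; rewrite gsqE.
Qed.

Lemma measurable_expR_lin (c : R) (f : T -> R) : measurable_fun setT f ->
  measurable_fun setT (fun w => (expR (c * f w))%:E).
Proof.
move=> mf; apply/measurable_EFinP; apply: measurableT_comp => //.
exact: measurable_funM.
Qed.

Lemma entry_mgf i j (a : R) :
  \int[P]_w (expR (a * G i j w))%:E = (expR (a ^+ 2 / (2 * t%:R)))%:E.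
Proof.
have mexp : measurable_fun [set: measurableTypeR R] (fun x => (expR (a * x))%:E).
  by apply/measurable_EFinP; apply: measurableT_comp => //; exact: measurable_funM.
pose g : T -> measurableTypeR R := G i j.
have mG : @measurable_fun _ _ T (measurableTypeR R) setT g.
  by move=> _ A mA; exact: measurable_funPT.
pose X : {mfun T >-> measurableTypeR R} :=
  @mfun_Sub _ _ T (measurableTypeR R) g (mem_set mG).
transitivity (\int[distribution P X]_x (expR (a * x))%:E).
  by rewrite ge0_integral_distribution.
rewrite (eq_measure_integral (normal_prob 0 (Num.sqrt t%:R^-1))).
  rewrite integral_normal_prob// normal_mgf//; congr (expR _)%:E.
  rewrite sqr_sqrtr ?invr_ge0 ?ler0n//.
  by field; rewrite gt_eqF.
by move=> A mA _; exact: G_iid.1.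
Qed.

Local Notation X := (fun ij : 'I_t * 'I_d => G ij.1 ij.2).

Lemma grow_mgf i v (a : R) :
  \int[P]_w (expR (a * grow i v w))%:E =
  (expR (a ^+ 2 * dot v v / (2 * t%:R)))%:E.
Proof.
have E w : expR (a * grow i v w) = (\prod_(j < d) expR (a * v j 0 * G i j w))%R.
  rewrite /grow mulr_sumr expR_sum; apply: eq_bigr => j _.
  by congr expR; ring.
under eq_integral do rewrite E.
rewrite (jmeas_expectation_prod (X := X) G_iid.2 (J := fun j => [set (i, j)]%SET))//.
- under eq_bigr do rewrite entry_mgf.
  rewrite prodEFin -expR_sum /dot; congr (expR _)%:E.
  rewrite [RHS]mulrAC mulr_sumr; apply: eq_bigr => j _.
  by field; rewrite gt_eqF.
- move=> j j' jj' ij; rewrite !inE => /eqP ->.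
  by apply: contra jj' => /eqP[->].
- move=> j; apply: (measurableT_comp (f := expR))=> //.
  apply: measurable_funM => //; apply: (@jmeas_X _ _ _ _ _ X _ (i, j)).
  by rewrite !inE.
Qed.

(** The square is linearised by an auxiliary Gaussian variable [x]: [exp(th Y^2)] is the mean of
    [exp(tau Y x)] when [tau^2 = 2 th]. After exchanging the integrals, [grow_mgf] evaluates the
    inner one and [normal_quadratic_mgf] the outer one. As [tau] is real, this covers nonnegative
    [th] only. *)
Lemma grow_quadratic i v (th : R) : dot v v = 1%R -> (0 <= th)%R ->
  (2 * th < t%:R)%R ->
  \int[P]_w (expR (th * grow i v w ^+ 2))%:E =
  ((Num.sqrt (1 - 2 * (th / t%:R)))^-1)%:E.
Proof.
move=> v1 th0 th_lt; pose tau := Num.sqrt (2 * th).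
have tau2 : (tau ^+ 2 = 2 * th)%R by rewrite sqr_sqrtr// mulr_ge0.
pose F (u : T * measurableTypeR R) : \bar R :=
  (expR (tau * grow i v u.1 * u.2) * normal_pdf 0 1 u.2)%:E.
have F0 u : 0 <= F u by rewrite lee_fin mulr_ge0 ?expR_ge0 ?normal_pdf_ge0.
have mF : measurable_fun setT F.
  apply/measurable_EFinP; apply: measurable_funM.
    apply: measurableT_comp => //; apply: measurable_funM => //.
    apply: measurable_funM => //; apply: measurableT_comp => //.
    exact: measurable_grow.
  apply: (measurableT_comp (measurable_normal_pdf 0 1)) => //.
transitivity (\int[P]_w \int[leb]_x F (w, x)).
  apply: eq_integral => w _; rewrite /F /=.
  under eq_integral do rewrite EFinM.
  rewrite normal_mgf ?oner_neq0//; congr (expR _)%:E.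
  by rewrite exprMn tau2 expr1n; field.
have := @fubini_tonelli _ _ T (measurableTypeR R) R P leb F mF F0; rewrite /fubini_F /fubini_G => ->.
transitivity (\int[leb]_x ((expR (th / t%:R * x ^+ 2))%:E * (normal_pdf 0 1 x)%:E)).
  apply: eq_integral => x _; rewrite /F /=.
  under eq_integral do rewrite EFinM.
  rewrite ge0_integralZr ?lee_fin ?normal_pdf_ge0//; last first.
    apply/measurable_EFinP; apply: measurableT_comp => //.
    by do 2 apply: measurable_funM => //; exact: measurable_grow.
  congr (_ * _).
  under eq_integral do rewrite mulrAC.
  rewrite grow_mgf v1 exprMn tau2; congr (expR _)%:E.
  by field; rewrite gt_eqF.
rewrite normal_quadratic_mgf//.
by rewrite ltr_pdivrMr// ; move: th_lt; lra.
Qed.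

Lemma gsq_product v (c : R) :
  \int[P]_w (expR (c * gsq v w))%:E =
  \prod_(i < t) \int[P]_w (expR (c * grow i v w ^+ 2))%:E.
Proof.
under eq_integral do rewrite gsqE mulr_sumr expR_sum.
apply: (jmeas_expectation_prod (X := X) G_iid.2
  (J := fun i => [set ij | ij.1 == i]%SET)).
- move=> i i' ii' ij; rewrite !inE => /eqP ->.
  by [].
- move=> i; apply: (measurableT_comp (f := expR))=> //.
  apply: measurable_funM => //; apply: measurable_funX.
  apply: (@measurable_sum _ (g_sigma_algebraType _)) => j.
  apply: measurable_funM => //; apply: (@jmeas_X _ _ _ _ _ X _ (i, j)).
  by rewrite !inE.
- by move=> i w; exact: expR_ge0.
Qed.

End GaussianMap.

(** * Elementary inequalities for exponentials and powers *)

Section ExponentialInequalities.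
Variable R : realType.
Implicit Types x y : R.

Lemma invsqrt_le_expR y : 0 <= y -> 8 * y <= 1 ->
  (Num.sqrt (1 - 2 * y))^-1 <= expR (y + 2 * y ^+ 2).
Proof.
move=> y0 y8; have c0 : 0 < 1 - 2 * y by lra.
rewrite -[leLHS]mul1r ler_pdivrMr ?sqrtr_gt0//.
rewrite -(@ler_pXn2r _ 2)// ?nnegrE ?mulr_ge0 ?expR_ge0 ?sqrtr_ge0//.
rewrite exprMn sqr_sqrtr ?(ltW c0)// expr1n.
have h : 1 + (y + 2 * y ^+ 2) <= expR (y + 2 * y ^+ 2) by exact: expR_ge1Dx.
have : (1 + (y + 2 * y ^+ 2)) ^+ 2 <= expR (y + 2 * y ^+ 2) ^+ 2.
  rewrite ler_pXn2r// ?nnegrE ?expR_ge0//.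
  by rewrite !addr_ge0// mulr_ge0// exprn_ge0.
move=> h2; apply: (@le_trans _ _ ((1 + (y + 2 * y ^+ 2)) ^+ 2 * (1 - 2 * y))); last first.
  by rewrite ler_wpM2r// ltW.
have -> : (1 + (y + 2 * y ^+ 2)) ^+ 2 * (1 - 2 * y) =
    1 + y ^+ 2 * (1 - 6 * y - 4 * y ^+ 2 - 8 * y ^+ 3) by ring.
rewrite lerDl mulr_ge0 ?sqr_ge0//.
have y2 : y ^+ 2 <= y / 8 by rewrite expr2; nra.
have y3 : y ^+ 3 <= y / 64 by rewrite exprS; nra.
by lra.
Qed.

Lemma invsqrt_ge y : 0 <= y -> 8 * y <= 1 -> 1 + y <= (Num.sqrt (1 - 2 * y))^-1.
Proof.
move=> y0 y8; have c0 : 0 < 1 - 2 * y by lra.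
rewrite -[leRHS]mul1r ler_pdivlMr ?sqrtr_gt0//.
rewrite -(@ler_pXn2r _ 2)// ?nnegrE ?mulr_ge0 ?addr_ge0 ?sqrtr_ge0//.
rewrite exprMn sqr_sqrtr ?(ltW c0)// expr1n.
have -> : (1 + y) ^+ 2 * (1 - 2 * y) = 1 - y ^+ 2 * (3 + 2 * y) by ring.
by rewrite gerBl mulr_ge0 ?sqr_ge0//; lra.
Qed.

(** Bounds a negative exponential by positive ones, whose moments [grow_quadratic] provides. It
    follows from [0 <= 1 - exp(- y) <= y], squared and multiplied by [exp y]. *)
Lemma expR_cosh_le y : 0 <= y -> expR (- y) + expR y <= 2 + y ^+ 2 * expR y.
Proof.
move=> y0; have [E EE] : exists E, E = expR y by exists (expR y).
have E0 : 0 < E by rewrite EE expR_gt0.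
rewrite expRN -EE.
have h : 1 - y <= E^-1 by rewrite EE -expRN (le_trans _ (expR_ge1Dx _)).
have E1 : E^-1 <= 1.
  by rewrite invf_le1// EE (le_trans _ (expR_ge1Dx _))// lerDl.
have : (1 - E^-1) ^+ 2 <= y ^+ 2 by rewrite ler_pXn2r// ?nnegrE; lra.
move=> h2; have : E * (1 - E^-1) ^+ 2 <= E * y ^+ 2 by rewrite ler_wpM2l// ltW.
have -> : E * (1 - E^-1) ^+ 2 = E^-1 + E - 2 by field; rewrite gt_eqF.
by lra.
Qed.

Lemma sqr_le_expR x : 0 <= x -> x ^+ 2 <= 4 * expR x.
Proof.
move=> x0; have h : 1 + x / 2 <= expR (x / 2) by exact: expR_ge1Dx.
have -> : expR x = expR (x / 2) ^+ 2 by rewrite expr2 -expRD; congr expR; lra.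
have : (1 + x / 2) ^+ 2 <= expR (x / 2) ^+ 2.
  by rewrite ler_pXn2r// ?nnegrE ?expR_ge0// addr_ge0// divr_ge0.
by nra.
Qed.

(** Above [1 + eps / 2], [ln xi <= xi - 1 <= (xi^2 - 1) / 2] bounds the power by an exponential of
    [xi^2], and [xi^2 - 1 >= eps] allows the factor [exp(a (xi^2 - 1 - eps)) >= 1]. A large [a]
    makes the mean of this term exponentially small. *)
Lemma powR_excess_le (z eps xi a : R) : 1 <= z -> 0 < eps -> 0 <= xi -> 0 <= a ->
  xi `^ z <= (1 + eps / 2) `^ z +
    expR ((z / 2 + a) * (xi ^+ 2 - 1) - a * eps).
Proof.
move=> z1 e0 xi0 a0; have z0 : 0 <= z by lra.
have [le|gt] := leP xi (1 + eps / 2).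
  apply: (@le_trans _ _ ((1 + eps / 2) `^ z)).
    by apply: ge0_ler_powR => //; rewrite nnegrE //; lra.
  by rewrite lerDl expR_ge0.
apply: (@le_trans _ _ (expR ((z / 2 + a) * (xi ^+ 2 - 1) - a * eps))); last first.
  by rewrite lerDr powR_ge0.
have xi_gt0 : 0 < xi by lra.
rewrite /powR gt_eqF// ler_expR.
have lnx : ln xi <= xi - 1.
  by rewrite -ler_expR lnK ?posrE// (le_trans _ (expR_ge1Dx _))//; lra.
have h1 : z * ln xi <= z * (xi - 1) by rewrite ler_wpM2l.
have h2 : z * (xi - 1) <= z * ((xi ^+ 2 - 1) / 2).
  by rewrite ler_wpM2l//; have := sqr_ge0 (xi - 1); nra.
have h3 : 0 <= a * (xi ^+ 2 - 1 - eps) by rewrite mulr_ge0//; nra.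
by lra.
Qed.

End ExponentialInequalities.

Section GaussianTails.
Local Open Scope ereal_scope.
Context (R : realType) (disp : measure_display) (T : measurableType disp).
Context (P : probability T R).

Lemma markov_ge0 (f : T -> R) (c b : R) : measurable_fun setT f ->
  (forall w, (0 <= f w)%R) -> (0 < c)%R -> \int[P]_w (f w)%:E <= b%:E ->
  P [set w | (c <= f w)%R] <= (b / c)%:E.
Proof.
move=> mf f0 c0 fb.
have mA : measurable [set w | (c <= f w)%R].
  rewrite -[X in measurable X]setTI; apply: measurable_fun_ler => //.
rewrite EFinM lee_pdivlMr// (le_trans _ fb)// muleC.
rewrite -(setIT [set w | _]) -integral_indic// -ge0_integralZl//; last first.
- by rewrite lee_fin ltW.
- by apply/measurable_EFinP; exact: measurable_indic.
apply: ge0_le_integral => //.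
- by move=> w _; rewrite mule_ge0// lee_fin ?(ltW c0).
- apply/measurable_EFinP; apply: measurable_funM => //; exact: measurable_indic.
- exact/measurable_EFinP.
move=> w _; rewrite indicE; case: (boolP (w \in _)) => [|_].
  by rewrite inE/= mule1 lee_fin.
by rewrite mule0 lee_fin.
Qed.

Context (d t : nat) (G : 'I_t -> 'I_d -> {RV P >-> R}).
Hypothesis G_iid : iid_gaussian_entries G.
Hypothesis t_gt0 : (0 < t)%N.
Local Notation gsq := (gsq G).

Let tR_gt0 : (0 < t%:R :> R)%R. Proof. by rewrite ltr0n. Qed.

Lemma expectation_expR_ge0 (c : R) (f : T -> R) : 0 <= \int[P]_w (expR (c * f w))%:E.
Proof. by apply: integral_ge0 => w _; rewrite lee_fin expR_ge0. Qed.

Lemma prode_le_expR (f : 'I_t -> \bar R) (a : R) : (forall i, 0 <= f i) ->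
  (forall i, f i <= (expR a)%:E) -> \prod_i f i <= (expR (a *+ t))%:E.
Proof.
move=> f0 fa; have -> : (expR (a *+ t))%:E = \prod_(i < t) (expR a)%:E.
  by rewrite prodEFin prodr_const card_ord -mulr_natl expRM_natl.
suff H s : 0 <= \prod_(i <- s) f i /\
    \prod_(i <- s) f i <= \prod_(i <- s) (expR a)%:E by case: (H (index_enum _)).
elim: s => [|i s [IH0 IH]]; first by rewrite !big_nil.
by rewrite !big_cons mule_ge0// lee_pmul.
Qed.

Lemma gsq_mgf_le v (th : R) : dot v v = 1%R -> (0 <= th)%R -> (8 * th <= t%:R)%R ->
  \int[P]_w (expR (th * gsq v w))%:E <= (expR (th + 2 * th ^+ 2 / t%:R))%:E.
Proof.
move=> v1 th0 th8; pose y := (th / t%:R)%R.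
have y0 : (0 <= y)%R by rewrite divr_ge0.
have y8 : (8 * y <= 1)%R by rewrite mulrA ler_pdivrMr// mul1r.
rewrite (gsq_product G_iid).
have -> : (th + 2 * th ^+ 2 / t%:R = (y + 2 * y ^+ 2) *+ t)%R.
  by rewrite -mulr_natr /y; field; rewrite gt_eqF.
apply: prode_le_expR => i; first exact: expectation_expR_ge0.
have th2 : (2 * th < t%:R)%R by move: tR_gt0; lra.
rewrite (grow_quadratic G_iid)//.
by rewrite lee_fin invsqrt_le_expR.
Qed.

(** Take means in [expR_cosh_le]. With [y = th / t], the factor [(th X)^2 = 16 y^2 (t X / 4)^2] is
    at most [64 y^2 exp(t X / 4)], so the error involves the moment at [th1 = t / 4 + th]; as
    [th1 / t <= 3 / 8], that moment is at most 2. Subtracting the moment at [th], at least [1 + y],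
    leaves [1 - y + 128 y^2]. *)
Lemma grow_mgfN_le i v (th : R) : dot v v = 1%R -> (0 <= th)%R -> (8 * th <= t%:R)%R ->
  \int[P]_w (expR (- th * grow G i v w ^+ 2))%:E <=
  (expR (- (th / t%:R) + 128 * (th / t%:R) ^+ 2))%:E.
Proof.
move=> v1 th0 th8; pose y := (th / t%:R)%R.
have y0 : (0 <= y)%R by rewrite divr_ge0.
have y8 : (8 * y <= 1)%R by rewrite mulrA ler_pdivrMr// mul1r.
pose X w := (grow G i v w ^+ 2)%R.
have X0 w : (0 <= X w)%R by exact: sqr_ge0.
have mX : measurable_fun setT X by apply: measurable_funX; exact: measurable_grow.
have mE (c : R) : measurable_fun setT (fun w => (expR (c * X w))%:E).
  exact: measurable_expR_lin.
have E0 (c : R) w : 0 <= (expR (c * X w))%:E by rewrite lee_fin expR_ge0.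
pose th1 := (t%:R / 4 + th)%R.
have pointwise w : (expR (- th * X w) + expR (th * X w) <=
    2 + 64 * y ^+ 2 * expR (th1 * X w))%R.
  have thX : (0 <= th * X w)%R by rewrite mulr_ge0.
  have := expR_cosh_le thX; rewrite -mulNr => /le_trans; apply; rewrite lerD2l.
  have tX : (0 <= t%:R / 4 * X w)%R by rewrite mulr_ge0.
  have := sqr_le_expR tX => h.
  have -> : ((th * X w) ^+ 2 = 16 * y ^+ 2 * (t%:R / 4 * X w) ^+ 2)%R.
    by rewrite /y; field; rewrite gt_eqF.
  rewrite /th1 [((_ + _) * X w)%R in leRHS]mulrDl expRD mulrA ler_wpM2r ?expR_ge0//.
  have -> : (64 * y ^+ 2 * expR (t%:R / 4 * X w) =
    16 * y ^+ 2 * (4 * expR (t%:R / 4 * X w)))%R by ring.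
  by rewrite ler_wpM2l// mulr_ge0// sqr_ge0.
have h : \int[P]_w (expR (- th * X w))%:E + \int[P]_w (expR (th * X w))%:E <=
    2%:E + (64 * y ^+ 2)%:E * \int[P]_w (expR (th1 * X w))%:E.
  rewrite -ge0_integralD//.
  have -> : 2%:E + (64 * y ^+ 2)%:E * \int[P]_w (expR (th1 * X w))%:E =
      \int[P]_w (2%:E + (64 * y ^+ 2)%:E * (expR (th1 * X w))%:E).
    rewrite ge0_integralD//; first last.
    - by apply: emeasurable_funM => //.
    - by move=> w _; rewrite mule_ge0// lee_fin mulr_ge0// sqr_ge0.
    rewrite integral_cst// ge0_integralZl//; last by rewrite lee_fin mulr_ge0// sqr_ge0.
    by congr (_ + _); rewrite -[LHS]mule1; congr (_ * _); symmetry; exact: (probability_setT P).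
  apply: ge0_le_integral => //.
  - by move=> w _; rewrite adde_ge0.
  - exact: emeasurable_funD.
  - by apply: emeasurable_funD => //; apply: emeasurable_funM.
  - by move=> w _; rewrite lee_fin.
have th2 : (2 * th < t%:R)%R by move: tR_gt0; lra.
have th12 : (2 * th1 < t%:R)%R by rewrite /th1; move: tR_gt0; lra.
have th10 : (0 <= th1)%R by rewrite addr_ge0// divr_ge0.
move: h; rewrite (grow_quadratic G_iid t_gt0 i v1 th0 th2).
rewrite (grow_quadratic G_iid t_gt0 i v1 th10 th12).
set B := (_^-1)%R; set C := (_^-1)%R.
have Bge : (1 + y <= B)%R by exact: invsqrt_ge.
have Cle : (C <= 2)%R.
  rewrite /C; have -> : (th1 / t%:R = 1 / 4 + y)%R.
    by rewrite /th1 /y; field; rewrite gt_eqF.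
  rewrite -[leRHS]invrK lef_pV2 ?posrE ?invr_gt0//; last first.
    by rewrite sqrtr_gt0; lra.
  have -> : (2^-1 = Num.sqrt (2^-1 ^+ 2) :> R)%R by rewrite sqrtr_sqr ger0_norm.
  by rewrite ler_sqrt; lra.
move=> h; have : \int[P]_w (expR (- th * X w))%:E <= (2 + 64 * y ^+ 2 * C - B)%:E.
  by rewrite EFinB leeBrDr// EFinD.
move=> /le_trans; apply; rewrite lee_fin.
apply: (@le_trans _ _ (1 + (- y + 128 * y ^+ 2))%R); last exact: expR_ge1Dx.
have : (64 * y ^+ 2 * C <= 64 * y ^+ 2 * 2)%R.
  by rewrite ler_wpM2l// mulr_ge0// sqr_ge0.
by move: Bge; lra.
Qed.

Lemma gsq_mgfN_le v (th : R) : dot v v = 1%R -> (0 <= th)%R -> (8 * th <= t%:R)%R ->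
  \int[P]_w (expR (- th * gsq v w))%:E <= (expR (- th + 128 * th ^+ 2 / t%:R))%:E.
Proof.
move=> v1 th0 th8; rewrite (gsq_product G_iid).
have -> : (- th + 128 * th ^+ 2 / t%:R =
    (- (th / t%:R) + 128 * (th / t%:R) ^+ 2) *+ t)%R.
  by rewrite -mulr_natr; field; rewrite gt_eqF.
apply: prode_le_expR => i; first exact: expectation_expR_ge0.
exact: grow_mgfN_le.
Qed.

End GaussianTails.

Lemma measurable_fun_eq0 (R : realType) (disp : measure_display)
    (T : measurableType disp) (f : T -> R) :
  measurable_fun setT f -> measurable [set w | f w = 0].
Proof. by move=> mf; have := mf measurableT [set 0] (measurable_set1 0); rewrite setTI. Qed.

(** * Tails of the squared norms of images, and almost sure injectivity *)

Section GaussianConcentration.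
Local Open Scope ereal_scope.
Context (R : realType) (disp : measure_display) (T : measurableType disp).
Context (P : probability T R) (d t : nat) (G : 'I_t -> 'I_d -> {RV P >-> R}).
Hypothesis G_iid : iid_gaussian_entries G.
Hypothesis t_gt0 : (0 < t)%N.
Local Notation gsq := (gsq G).
Local Notation Gw := (random_map G).

Let tR_gt0 : (0 < t%:R :> R)%R. Proof. by rewrite ltr0n. Qed.

Lemma random_mapZ w (c : R) v : Gw w (c *: v) = (c *: Gw w v)%R.
Proof. by rewrite /random_map scalemxAr. Qed.

Lemma gsqZ w (c : R) v : gsq (c *: v) w = (c ^+ 2 * gsq v w)%R.
Proof. by rewrite /gsq random_mapZ dotZl dotZr mulrA expr2. Qed.

Lemma gsq_ge0 v w : (0 <= gsq v w)%R.
Proof. exact: dot_ge0. Qed.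

Lemma unit_dot (v : 'cV[R]_d) : v != 0%R ->
  dot ((l2norm v)^-1 *: v) ((l2norm v)^-1 *: v) = 1%R.
Proof.
move=> v0; rewrite dotZl dotZr -sqr_l2norm expr2 mulrA.
have : l2norm v != 0%R by rewrite l2norm_eq0.
by move=> n0; field.
Qed.

Lemma unit_scale (v : 'cV[R]_d) : v != 0%R -> v = (l2norm v *: ((l2norm v)^-1 *: v))%R.
Proof. by move=> v0; rewrite scalerA divff ?scale1r// l2norm_eq0. Qed.

Lemma gsq_lower_tail v (eta : R) : (0 < eta)%R -> (eta <= 1)%R ->
  P [set w | (gsq v w < (1 - eta) * dot v v)%R] <=
  (expR (- (eta ^+ 2 * t%:R / 512)))%:E.
Proof.
move=> eta0 eta1; have [->|v0] := eqVneq v 0%R.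
  rewrite (_ : [set w | _] = set0) ?measure0 ?lee_fin ?expR_ge0//.
  by apply/seteqP; split => // w /=; rewrite dot0l mulr0 ltNge gsq_ge0.
have u1 := unit_dot v0; have vE := unit_scale v0.
set u := (_ *: v)%R in u1 vE; clearbody u.
have [c c0 cE] : exists2 c, (0 < c)%R & c = l2norm v.
  by exists (l2norm v) => //; rewrite lt_neqAle l2norm_ge0 eq_sym l2norm_eq0 v0.
rewrite -cE in vE; rewrite vE; clear v v0 cE vE.
(* The minimiser of the Chernoff exponent [- eta th + 128 th^2 / t]. *)
pose th := (eta * t%:R / 256)%R.
have th0 : (0 <= th)%R by rewrite divr_ge0// mulr_ge0// ltW.
have th8 : (8 * th <= t%:R)%R by rewrite /th; have := ler_wpM2r (ltW tR_gt0) eta1; rewrite mul1r; move: tR_gt0; lra.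
have m : measurable_fun setT (fun w => expR (- th * gsq u w)).
  by apply: measurableT_comp => //; apply: measurable_funM => //; exact: measurable_gsq.
apply: (@le_trans _ _ (P [set w | (expR (- th * (1 - eta)) <= expR (- th * gsq u w))%R])).
  apply: le_measure; rewrite ?inE.
  - rewrite -[X in measurable X]setTI; apply: measurable_fun_ltr => //.
    exact: measurable_gsq.
  - rewrite -[X in measurable X]setTI; exact: measurable_fun_ler.
  - move=> w /=; rewrite gsqZ dotZl dotZr mulrA -expr2 u1 mulr1 mulrC.
    rewrite ltr_pM2r ?exprn_gt0// => h.
    by rewrite ler_expR !mulNr lerN2 ler_wpM2l// ltW.
apply: (le_trans (markov_ge0 m _ _ (gsq_mgfN_le G_iid t_gt0 u1 th0 th8))).
- by move=> w; exact: expR_ge0.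
- exact: expR_gt0.
rewrite lee_fin -expRN -expRD ler_expR /th le_eqVlt; apply/orP; left; apply/eqP.
by field; rewrite gt_eqF.
Qed.

Lemma gsq_upper_tail v :
  P [set w | (2 ^+ 2 * dot v v < gsq v w)%R] <= (expR (- (t%:R / 4)))%:E.
Proof.
have [->|v0] := eqVneq v 0%R.
  rewrite (_ : [set w | _] = set0) ?measure0 ?lee_fin ?expR_ge0//.
  apply/seteqP; split => // w /=.
  by rewrite dot0l mulr0 -(scale0r (0 : 'cV[R]_d)) gsqZ expr0n mul0r ltxx.
have u1 := unit_dot v0; have vE := unit_scale v0.
set u := (_ *: v)%R in u1 vE; clearbody u.
have [c c0 cE] : exists2 c, (0 < c)%R & c = l2norm v.
  by exists (l2norm v) => //; rewrite lt_neqAle l2norm_ge0 eq_sym l2norm_eq0 v0.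
rewrite -cE in vE; rewrite vE; clear v v0 cE vE.
(* The largest parameter that [gsq_mgf_le] admits; the exponent is [t / 8 + t / 32 - t / 2]. *)
pose th := (t%:R / 8 : R)%R.
have th0 : (0 <= th)%R by rewrite divr_ge0.
have th8 : (8 * th <= t%:R)%R by rewrite /th; lra.
have m : measurable_fun setT (fun w => expR (th * gsq u w)).
  by apply: measurableT_comp => //; apply: measurable_funM => //; exact: measurable_gsq.
apply: (@le_trans _ _ (P [set w | (expR (th * 4) <= expR (th * gsq u w))%R])).
  apply: le_measure; rewrite ?inE.
  - rewrite -[X in measurable X]setTI; apply: measurable_fun_ltr => //.
    exact: measurable_gsq.
  - rewrite -[X in measurable X]setTI; exact: measurable_fun_ler.
  - move=> w /=; rewrite gsqZ dotZl dotZr [(c * _)%R]mulrA -expr2 u1 mulr1 mulrC.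
    rewrite ltr_pM2l ?exprn_gt0// => h.
    by rewrite ler_expR ler_wpM2l//; lra.
apply: (le_trans (markov_ge0 m _ _ (gsq_mgf_le G_iid t_gt0 u1 th0 th8))).
- by move=> w; exact: expR_ge0.
- exact: expR_gt0.
rewrite lee_fin -expRN -expRD ler_expR /th.
have -> : (2 * (t%:R / 8) ^+ 2 / t%:R = t%:R / 32 :> R)%R.
  by field; rewrite gt_eqF.
by move: tR_gt0; lra.
Qed.

Definition gsq_ok (e : R) v w : bool :=
  ((1 - e / 2) ^+ 2 * dot v v <= gsq v w <= 2 ^+ 2 * dot v v)%R.

Lemma measurable_gsq_ok e v : measurable [set w | ~~ gsq_ok e v w].
Proof.
have -> : [set w | ~~ gsq_ok e v w] =
    [set w | (gsq v w < (1 - e / 2) ^+ 2 * dot v v)%R] `|`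
    [set w | (2 ^+ 2 * dot v v < gsq v w)%R].
  apply/seteqP; split => w /=; rewrite /gsq_ok negb_and -!ltNge; first by move=> /orP.
  by move=> h; apply/orP.
by apply: measurableU; rewrite -[X in measurable X]setTI;
  apply: measurable_fun_ltr => //; exact: measurable_gsq.
Qed.

Lemma gsq_ok_tail v (e : R) : (0 < e)%R -> (e <= 1)%R ->
  P [set w | ~~ gsq_ok e v w] <= (2 * expR (- (e ^+ 2 * t%:R / 2048)))%:E.
Proof.
move=> e0 e1; have eta0 : (0 < e / 2)%R by lra.
have eta1 : (e / 2 <= 1)%R by lra.
have mL : measurable [set w | (gsq v w < (1 - e / 2) * dot v v)%R].
  rewrite -[X in measurable X]setTI; apply: measurable_fun_ltr => //.
  exact: measurable_gsq.
have mU : measurable [set w | (2 ^+ 2 * dot v v < gsq v w)%R].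
  rewrite -[X in measurable X]setTI; apply: measurable_fun_ltr => //.
  exact: measurable_gsq.
apply: (@le_trans _ _ (P ([set w | (gsq v w < (1 - e / 2) * dot v v)%R] `|`
    [set w | (2 ^+ 2 * dot v v < gsq v w)%R]))).
  apply: le_measure; rewrite ?inE; [exact: measurable_gsq_ok|exact: measurableU|].
  move=> w /=; rewrite /gsq_ok negb_and -!ltNge => /orP[h|]; last by right.
  left; apply: (lt_le_trans h); rewrite ler_wpM2r ?dot_ge0//; nra.
apply: (le_trans (measureU2 _ mL mU)).
have := leeD (gsq_lower_tail v eta0 eta1) (gsq_upper_tail v).
move=> /le_trans; apply; rewrite -EFinD lee_fin [leRHS]mulrDl mul1r.
rewrite lerD// ler_expR lerN2; first by move: tR_gt0; nra.
have : (e ^+ 2 * t%:R <= 1 * t%:R)%R by rewrite ler_wpM2r// expr_le1// ltW.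
by move: tR_gt0; lra.
Qed.

Lemma powR_gap (z eps : R) : (1 <= z)%R -> (0 < eps)%R ->
  ((1 + eps / 2) `^ z + eps / 2 <= (1 + eps) `^ z)%R.
Proof.
move=> z1 e0; have z1' : (0 <= z - 1)%R by lra.
have E (b : R) : (0 < b)%R -> (b `^ z = b * b `^ (z - 1))%R.
  move=> b0; rewrite -{2}[b]powRr1 ?(ltW b0)// -powRD; first by rewrite addrC subrK.
  by rewrite (gt_eqF b0) implybT.
rewrite !E; [|lra..].
have h1 : ((1 + eps / 2) `^ (z - 1) <= (1 + eps) `^ (z - 1))%R.
  by apply: ge0_ler_powR => //; rewrite ?nnegrE; lra.
have h2 : (1 <= (1 + eps) `^ (z - 1))%R.
  by rewrite -[leLHS](powRr0 (1 + eps)) ler_powR//; lra.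
set A := (_ `^ (z - 1))%R in h1 *; set B := (_ `^ (z - 1))%R in h1 h2 *.
by nra.
Qed.

(* The sum exceeds [(1 + eps / 2) `^ z] times its target only through the
   exponential terms of [powR_excess_le], whose expectation is exponentially
   small once [z] is below [eps * t / 50]. *)
Lemma random_map_sum_tail (I : finType) (u : I -> 'cV[R]_d) (z eps : R) :
  (1 <= z)%R -> (0 < eps)%R -> (eps < 1)%R -> (50 * z <= eps * t%:R)%R ->
  P [set w | ((1 + eps) `^ z * \sum_i l2norm (u i) `^ z <
              \sum_i l2norm (Gw w (u i)) `^ z)%R] <=
  (2 / eps * expR (- (eps ^+ 2 * t%:R / 32)))%:E.
Proof.
move=> z1 e0 e1 zt; pose a := (eps * t%:R / 20)%R.
have a0 : (0 <= a)%R by rewrite divr_ge0// mulr_ge0// ltW.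
pose th := (z / 2 + a)%R.
have th0 : (0 <= th)%R by rewrite addr_ge0//; lra.
have tht : (th <= 6 / 100 * (eps * t%:R))%R by rewrite /th /a; lra.
have et : (eps * t%:R <= t%:R)%R by rewrite ler_piMl// ltW.
have th8 : (8 * th <= t%:R)%R by lra.
pose n i := ((l2norm (u i))^-1 *: u i)%R.
pose Y i w := (l2norm (u i) `^ z * expR (th * (gsq (n i) w - 1) - a * eps))%R.
have Y0 i w : (0 <= Y i w)%R by rewrite mulr_ge0 ?powR_ge0 ?expR_ge0.
have mY i : measurable_fun setT (Y i).
  apply: measurable_funM => //; apply: measurableT_comp => //.
  apply: measurable_funB => //; apply: measurable_funM => //.
  by apply: measurable_funB => //; exact: measurable_gsq.
set S := (\sum_i l2norm (u i) `^ z)%R.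
have S0 : (0 <= S)%R by apply: sumr_ge0 => i _; exact: powR_ge0.
have z0 : z != 0%R by rewrite gt_eqF//; lra.
have bound i w : (l2norm (Gw w (u i)) `^ z <=
    (1 + eps / 2) `^ z * l2norm (u i) `^ z + Y i w)%R.
  have [->|u0] := eqVneq (u i) 0%R.
    by rewrite /random_map mulmx0 !l2norm0 powR0// mulr0 add0r.
  rewrite {1}(unit_scale u0) random_mapZ l2normZ ger0_norm ?l2norm_ge0//.
  rewrite powRM ?l2norm_ge0// /Y [((1 + _) `^ z * _)%R]mulrC -mulrDr ler_wpM2l ?powR_ge0//.
  have := powR_excess_le z1 e0 (l2norm_ge0 (Gw w (n i))) a0.
  by rewrite sqr_l2norm.
have EY i : u i != 0%R -> \int[P]_w (Y i w)%:E <=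
    (l2norm (u i) `^ z * expR (- (eps ^+ 2 * t%:R / 32)))%:E.
  move=> u0; have E w : (Y i w)%:E = (l2norm (u i) `^ z * expR (- th - a * eps))%:E *
      (expR (th * gsq (n i) w))%:E.
    by rewrite -EFinM -mulrA -expRD /Y; congr ((_ * expR _)%:E); ring.
  under eq_integral do rewrite E.
  rewrite ge0_integralZl//; first last.
  - by rewrite lee_fin mulr_ge0 ?powR_ge0 ?expR_ge0.
  - by apply: measurable_expR_lin; exact: measurable_gsq.
  apply: (@le_trans _ _ ((l2norm (u i) `^ z * expR (- th - a * eps))%:E *
     (expR (th + 2 * th ^+ 2 / t%:R))%:E)).
    apply: lee_pmul => //.
    - by rewrite lee_fin mulr_ge0 ?powR_ge0 ?expR_ge0.
    - exact: expectation_expR_ge0.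
    - exact: (gsq_mgf_le G_iid t_gt0 (unit_dot u0)).
  rewrite -EFinM lee_fin -[leLHS]mulrA -expRD ler_wpM2l ?powR_ge0// ler_expR.
  have : (th ^+ 2 <= (6 / 100 * (eps * t%:R)) ^+ 2)%R.
    by rewrite ler_pXn2r// nnegrE// mulr_ge0// mulr_ge0// ltW.
  move=> h; have : (2 * th ^+ 2 / t%:R <= 2 * (6 / 100 * (eps * t%:R)) ^+ 2 / t%:R)%R.
    by rewrite ler_pM2r ?invr_gt0// ler_pM2l.
  have -> : (2 * (6 / 100 * (eps * t%:R)) ^+ 2 / t%:R = 72 / 10000 * (eps ^+ 2 * t%:R))%R.
    by field; rewrite gt_eqF.
  have -> : (a * eps = eps ^+ 2 * t%:R / 20)%R by rewrite /a; field.
  have : (0 <= eps ^+ 2 * t%:R)%R by rewrite mulr_ge0// sqr_ge0.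
  by lra.
have EY' i : \int[P]_w (Y i w)%:E <=
    (l2norm (u i) `^ z * expR (- (eps ^+ 2 * t%:R / 32)))%:E.
  have [u0|/EY//] := eqVneq (u i) 0%R.
  rewrite integral0_eq => [|w _]; last by rewrite /Y u0 l2norm0 powR0// mul0r.
  by rewrite lee_fin mulr_ge0 ?powR_ge0 ?expR_ge0.
have msum : measurable_fun setT (fun w => \sum_i Y i w)%R by exact: measurable_sum.
have mlhs : measurable [set w | ((1 + eps) `^ z * S <
              \sum_i l2norm (Gw w (u i)) `^ z)%R].
  rewrite -[X in measurable X]setTI; apply: measurable_fun_ltr => //.
  apply: measurable_sum => i; apply: (measurableT_comp (measurable_powR z)).
  rewrite (_ : (fun w => _) = (fun w => Num.sqrt (gsq (u i) w))); last first.
    by apply/funext => w; rewrite l2normE.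
  by apply: measurableT_comp; [exact: (continuous_measurable_fun (@sqrt_continuous R))|exact: measurable_gsq].
have [S_eq0|S_neq0] := eqVneq S 0%R.
  rewrite (_ : [set w | _] = set0).
    by rewrite measure0 lee_fin mulr_ge0 ?expR_ge0// divr_ge0// ltW.
  apply/seteqP; split => // w /=; rewrite S_eq0 mulr0 big1 ?ltxx// => i _.
  have := S_eq0; rewrite /S => /psumr_eq0P.
  move=> /(_ (fun j _ => powR_ge0 _ _) i isT) /eqP; rewrite powR_eq0 l2norm_eq0 => /andP[/eqP -> _].
  by rewrite /random_map mulmx0 l2norm0 powR0.
have S_gt0 : (0 < S)%R by rewrite lt_neqAle eq_sym S_neq0.
apply: (@le_trans _ _ (P [set w | (eps / 2 * S <= \sum_i Y i w)%R])).
  apply: le_measure; rewrite ?inE//.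
    by rewrite -[X in measurable X]setTI; exact: measurable_fun_ler.
  move=> w /= h; have := ltW h => {}h.
  have : (\sum_i l2norm (Gw w (u i)) `^ z <= (1 + eps / 2) `^ z * S + \sum_i Y i w)%R.
    by rewrite mulr_sumr -big_split; exact: ler_sum.
  have : (((1 + eps / 2) `^ z + eps / 2) * S <= (1 + eps) `^ z * S)%R.
    by rewrite ler_wpM2r// powR_gap.
  by rewrite mulrDl; move: h; lra.
have c0 : (0 < eps / 2 * S)%R by rewrite mulr_gt0// divr_gt0.
have EYS : \int[P]_w (\sum_i Y i w)%:E <= (S * expR (- (eps ^+ 2 * t%:R / 32)))%:E.
  under eq_integral do rewrite -sumEFin.
  rewrite ge0_integral_sum//; first last.
  - by move=> i w _; rewrite lee_fin.
  - by move=> i; exact/measurable_EFinP.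
  rewrite mulr_suml -sumEFin; apply: lee_sum => i _; exact: EY'.
apply: (le_trans (markov_ge0 msum _ c0 EYS)) => [w|].
  by apply: sumr_ge0.
rewrite lee_fin le_eqVlt; apply/orP; left; apply/eqP.
by field; rewrite gt_eqF//= gt_eqF.
Qed.

(** Choose [j] with [v j] nonzero. In the first row, [G i j] is independent of the rest [f] of the
    sum and must take the single value [- f / v j], which has probability 0 because the normal law
    has a density. *)
Lemma random_map_kernel_null v : v != 0%R ->
  P [set w | Gw w v = 0%R] = 0.
Proof.
move=> v0; have [j vj0] : exists j, v j 0%R != 0%R.
  apply/existsP; apply: contra_neqT v0 => /existsPn h.
  by apply/colP => i; rewrite mxE; apply/eqP; move: (h i); rewrite negbK.
pose i := Ordinal t_gt0.
pose J1 := [set ij : 'I_t * 'I_d | ij != (i, j)]%SET.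
pose J2 := [set (i, j)]%SET.
pose X := (fun ij : 'I_t * 'I_d => G ij.1 ij.2).
pose f w := (\sum_(l < d | l != j) G i l w * v l 0%R)%R.
have jf : jmeas X J1 f.
  have -> : f = (fun w => \sum_(l < d) (if l != j then G i l w * v l 0 else 0))%R.
    by apply/funext => w; rewrite /f big_mkcond.
  apply: (@measurable_sum _ (g_sigma_algebraType _)) => l.
  have [_|lj] := eqVneq l j; first exact: measurable_cst.
  apply: measurable_funM => //; apply: (@jmeas_X _ _ _ _ _ X _ (i, l)).
  by rewrite !inE; apply: contra lj => /eqP[->].
have jg : jmeas X J2 (G i j) by apply: (@jmeas_X _ _ _ _ _ X _ (i, j)); rewrite !inE.
pose Y : {mfun T >-> R} := mfun_Sub (mem_set (jmeas_measurable jf)).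
pose D := [set u : R * R | (u.1 + u.2 * v j 0 = 0)%R].
have mD : measurable D.
  apply: (measurable_fun_eq0 (f := fun u : R * R => (u.1 + u.2 * v j 0)%R)).
  by apply: measurable_funD => //; apply: measurable_funM.
have law : P [set w | D (Y w, G i j w)] = 0.
  rewrite (@indep_pair_law _ _ _ P Y (G i j) _ D mD).
    rewrite /product_measure1 integral0_eq// => x _ /=.
    have -> : xsection D x = [set (- x / v j 0)%R].
      apply/seteqP; split => y /=; rewrite /xsection /= inE /D /=.
        by move=> /eqP; rewrite addrC addr_eq0 => /eqP <-; rewrite mulfK.
      by move=> ->; rewrite mulfVK// subrr.
    rewrite G_iid.1//.
    have := @normal_prob_dominates R 0 (Num.sqrt t%:R^-1).
    move=> /null_content_dominatesP; apply => //; exact: lebesgue_measure_set1.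
  move=> A B mA mB; apply: (jmeas_indep (X := X) G_iid.2 _ jf jg) => // ij.
  by rewrite !inE.
apply/eqP; rewrite eq_le measure_ge0 andbT -law; apply: le_measure; rewrite ?inE.
- rewrite (_ : [set w | _] = [set w | gsq v w = 0%R]); last first.
    by apply/seteqP; split => w /=; [rewrite /gsq => ->; rewrite dot0l|move=> /eqP; rewrite dot_eq0 => /eqP].
  apply: measurable_fun_eq0; exact: measurable_gsq.
- apply: measurable_fun_eq0.
  by apply: measurable_funD; [exact: (jmeas_measurable jf)|exact: measurable_funM].
- move=> w /= /colP/(_ i); rewrite random_mapE mxE /grow (bigD1 j)//= addrC /D /=.
  by [].
Qed.

End GaussianConcentration.

(** * Probability of the bad sets *)

Section UnionBound.
Local Open Scope ereal_scope.
Context (R : realType) (disp : measure_display) (T : measurableType disp).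
Context (P : probability T R).

Lemma measurable_wmass (I : finType) (kap : I -> R) (A : I -> set T) (c : R) :
  (forall i, measurable (A i)) ->
  measurable [set w | (c <= \sum_(i | `[< A i w >]) kap i)%R].
Proof.
move=> mA; rewrite -[X in measurable X]setTI.
have -> : (fun w => (c <= \sum_(i | `[< A i w >]) kap i)%R : Prop) =
    (fun w => (c <= \sum_i kap i * \1_(A i) w)%R).
  apply/funext => w; rewrite big_mkcond /=; congr (is_true (_ <= _)%R).
  by apply: eq_bigr => i _; rewrite indicE; case: asboolP => h; [rewrite mem_set|rewrite memNset]; rewrite ?mulr1 ?mulr0.
apply: measurable_fun_ler => //; apply: measurable_sum => i.
by apply: measurable_funM => //; exact: measurable_indic.
Qed.

(** The expected weight of the indices whose event occurs is at most [b] times the total weight; the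
    number of indices does not enter. *)
Lemma wmass_markov (I : finType) (kap : I -> R) (A : I -> set T) (b c : R) :
  (forall i, (0 <= kap i)%R) -> (forall i, measurable (A i)) ->
  (0 < c)%R -> (forall i, P (A i) <= b%:E) ->
  P [set w | (c <= \sum_(i | `[< A i w >]) kap i)%R] <= ((\sum_i kap i) * b / c)%:E.
Proof.
move=> kap0 mA c0 Pb.
pose f w := (\sum_i kap i * \1_(A i) w)%R.
have -> : [set w | (c <= \sum_(i | `[< A i w >]) kap i)%R] = [set w | (c <= f w)%R].
  apply/funext => w; rewrite /= big_mkcond /f /=; congr (is_true (_ <= _)%R).
  by apply: eq_bigr => i _; rewrite indicE; case: asboolP => h; [rewrite mem_set|rewrite memNset]; rewrite ?mulr1 ?mulr0.
have mi i : measurable_fun setT (fun w => kap i * \1_(A i) w)%R.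
  by apply: measurable_funM => //; exact: measurable_indic.
have f0 i w : (0 <= kap i * \1_(A i) w)%R by rewrite mulr_ge0// indicE.
apply: markov_ge0 => //.
- exact: measurable_sum.
- by move=> w; exact: sumr_ge0.
under eq_integral do rewrite -sumEFin.
rewrite ge0_integral_sum//; first last.
- by move=> i w _; rewrite lee_fin.
- by move=> i; exact/measurable_EFinP.
rewrite mulr_suml -sumEFin; apply: lee_sum => i _.
under eq_integral do rewrite EFinM.
rewrite ge0_integralZl//; first last.
- by rewrite lee_fin.
- by apply/measurable_EFinP; exact: measurable_indic.
rewrite integral_indic// setIT EFinM.
exact: lee_wpmul2l (kap0 i : 0 <= (kap i)%:E) _ _ (Pb i).
Qed.

Lemma measurable_finite_exists (C : finType) (A : C -> set T) :
  (forall c, measurable (A c)) -> measurable [set w | exists c, A c w].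
Proof.
move=> mA; rewrite (_ : [set w | _] = \big[setU/set0]_(c in C) A c).
  by apply: bigsetU_measurable => c _.
by rewrite -bigcup_pred; apply/seteqP; split => w /= [c]; [exists c|move=> _ ?; exists c].
Qed.

Lemma finite_union_bound (C : finType) (A : C -> set T) (b : R) :
  (forall c, measurable (A c)) -> (forall c, P (A c) <= b%:E) ->
  P [set w | exists c, A c w] <= (#|C|%:R * b)%:E.
Proof.
move=> mA Pb.
suff H (s : seq C) : P (\big[setU/set0]_(c <- s) A c) <= ((size s)%:R * b)%:E.
  rewrite cardE (_ : [set w | _] = \big[setU/set0]_(c <- enum C) A c)//.
  rewrite big_enum /= -bigcup_pred; apply/seteqP.
  by split => w /= [c]; [exists c|move=> _ ?; exists c].
elim: s => [|c s IH]; first by rewrite big_nil measure0 mul0r.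
rewrite big_cons; apply: (le_trans (measureU2 _ (mA c) _)).
  by apply: bigsetU_measurable.
by apply: (le_trans (leeD (Pb c) IH)); rewrite -EFinD lee_fin /= -natr1 mulrDl mul1r addrC.
Qed.

Context (d t : nat) (G : 'I_t -> 'I_d -> {RV P >-> R}).
Hypothesis G_iid : iid_gaussian_entries G.
Hypothesis t_gt0 : (0 < t)%N.
Local Notation Gmx w := (\matrix_(i < t, j < d) G i j w)%R.

Variables (e : R) (M : nat).
Hypotheses (e_gt0 : (0 < e)%R) (e_le1 : (e <= 1)%R).

Lemma gridokE vs : [set w | ~ gridok e M (Gmx w) vs] =
  [set w | exists c : {ffun 'I_(size vs) -> 'I_(M + M).+1}, ~~ gsq_ok G e (gridpt c) w].
Proof.
apply/seteqP; split => w /=.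
  by move=> /existsNP[c /negP hc]; exists c.
by move=> [c /negP hc] ok; apply: hc; exact: ok.
Qed.

Lemma measurable_gridok vs : measurable [set w | ~ gridok e M (Gmx w) vs].
Proof. by rewrite gridokE; apply: measurable_finite_exists => c; exact: measurable_gsq_ok. Qed.

Definition grid_failure (s : nat) : R :=
  ((M + M).+1%:R ^+ s * (2 * expR (- (e ^+ 2 * t%:R / 2048))))%R.

Lemma grid_failure_ge0 s : (0 <= grid_failure s)%R.
Proof. by rewrite !mulr_ge0 ?exprn_ge0 ?expR_ge0. Qed.

Lemma gridok_tail s vs : (size vs <= s)%N ->
  P [set w | ~ gridok e M (Gmx w) vs] <= (grid_failure s)%:E.
Proof.
move=> vs_s; rewrite gridokE.
apply: (le_trans (finite_union_bound _ (fun c => gsq_ok_tail G_iid t_gt0 (gridpt c) e_gt0 e_le1))).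
  by move=> c; exact: measurable_gsq_ok.
rewrite lee_fin card_ffun !card_ord natrX ler_wpM2r ?mulr_ge0 ?expR_ge0//.
by rewrite ler_weXn2l// ler1n.
Qed.

Context (I : finType) (p : I -> 'cV[R]_d) (K : I -> R) (z Q : R).
Hypotheses (Q_ge1 : (1 <= Q)%R) (K_le : (\sum_i K i `^ z <= Q)%R).
Local Notation bad j ws := [set w | bad_iter z e p K (Gmx w) M j ws].

Lemma measurable_bad_iter j ws : measurable (bad j ws).
Proof.
elim: j ws => [|j IH] ws /=.
  by rewrite (_ : [set _ | False] = set0)//; apply/seteqP; split.
apply: measurableU; last exact: (measurable_wmass _ _ (fun i => IH (p i :: ws))).
exact: (measurable_wmass _ _ (fun i => measurable_gridok (p i :: ws))).
Qed.

(** For each fixed sequence, Markov with threshold [e / 2] costs the factor [2 Q / e]. The two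
    alternatives of [bad_iter] cost another 2, since [1 + q^j <= 2 q^j] for [q = 4 Q / e >= 1]. *)
Lemma bad_iter_tail s j ws : (size ws + j <= s)%N ->
  P (bad j ws) <= (grid_failure s * (4 * Q / e) ^+ j)%:E.
Proof.
have q1 : (1 <= 4 * Q / e)%R.
  rewrite ler_pdivlMr// mul1r (le_trans e_le1)// (le_trans Q_ge1)//.
  by rewrite ler_peMl ?ler1n// (le_trans ler01).
have K0 i : (0 <= K i `^ z)%R by exact: powR_ge0.
have e2 : (0 < e / 2)%R by rewrite divr_gt0.
elim: j ws => [|j IH] ws sz /=.
  have -> : [set _ | False] = set0 :> set T by apply/seteqP; split.
  by rewrite measure0 expr0 mulr1 lee_fin grid_failure_ge0.
have sz' i : (size (p i :: ws) + j <= s)%N by rewrite /= addSnnS.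
have b1 := wmass_markov K0 (fun i => measurable_gridok (p i :: ws)) e2
  (fun i => gridok_tail (leq_trans (leq_addr _ _) (sz' i))).
have b2 := wmass_markov K0 (fun i => measurable_bad_iter j (p i :: ws)) e2
  (fun i => IH _ (sz' i)).
rewrite (_ : [set w | _] =
    [set w | (e / 2 <= \sum_(i | `[< ~ gridok e M (Gmx w) (p i :: ws) >]) K i `^ z)%R] `|`
    [set w | (e / 2 <= \sum_(i | `[< bad_iter z e p K (Gmx w) M j (p i :: ws) >]) K i `^ z)%R])//.
apply: (le_trans (measureU2 _ _ _)).
- exact: (measurable_wmass _ _ (fun i => measurable_gridok (p i :: ws))).
- exact: (measurable_wmass _ _ (fun i => measurable_bad_iter j (p i :: ws))).
apply: (le_trans (leeD b1 b2)); rewrite -EFinD lee_fin.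
have [B B0 ->] : exists2 B, (0 <= B)%R & grid_failure s = B.
  by exists (grid_failure s) => //; exact: grid_failure_ge0.
have [q EQ] : exists q, q = (4 * Q / e)%R by exists (4 * Q / e)%R.
rewrite -EQ in q1 *.
have qj : (1 <= q ^+ j)%R by rewrite exprn_ege1.
have [S [S0 SQ ->]] : exists S, [/\ (0 <= S)%R, (S <= Q)%R & (\sum_i K i `^ z)%R = S].
  by exists (\sum_i K i `^ z)%R; split => //; exact: sumr_ge0.
rewrite -mulrDl -mulrDr exprS.
have -> : (S * (B + B * q ^+ j) / (e / 2) = S * (B * (2 / e * (1 + q ^+ j))))%R.
  by field; rewrite gt_eqF.
apply: (@le_trans _ _ (Q * (B * (2 / e * (1 + q ^+ j))))%R).
  rewrite ler_wpM2r// !mulr_ge0 ?invr_ge0 ?(ltW e_gt0)// addr_ge0//; lra.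
apply: (@le_trans _ _ (Q * (B * (2 / e * (q ^+ j + q ^+ j))))%R).
  rewrite ler_wpM2l//; first by lra.
  rewrite ler_wpM2l// ler_wpM2l ?divr_ge0 ?(ltW e_gt0)//; lra.
by rewrite EQ le_eqVlt; apply/orP; left; apply/eqP; field; rewrite gt_eqF.
Qed.

End UnionBound.

(** * Existence of optimal flats *)

Section EntrywiseConvergence.
Variables (R : realType) (T : Type) (F : set_system T).
Context {FF : Filter F}.

Lemma cvg_sum_seq (I : Type) (r : seq I) (Q : pred I) (f : I -> T -> R) (l : I -> R) :
  (forall i, f i x @[x --> F] --> l i) ->
  (\sum_(i <- r | Q i) f i x) @[x --> F] --> \sum_(i <- r | Q i) l i.
Proof.
move=> fl; elim: r => [|i r IH].
  by under eq_fun do rewrite big_nil; rewrite big_nil; exact: cvg_cst.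
under eq_fun do rewrite big_cons; rewrite big_cons.
by case: (Q i) => //; apply: cvgD.
Qed.

(** The formula through [ln] fails at the limit 0, which is treated by hand. The filter may be
    improper, so a negative limit has to be considered too: it forces the filter to contain the
    empty set. *)
Lemma cvg_powR (f : T -> R) (a z : R) : 0 < z -> (forall x, 0 <= f x) ->
  f x @[x --> F] --> a -> f x `^ z @[x --> F] --> a `^ z.
Proof.
move=> z0 f0 fa; have zn0 : z != 0 by rewrite gt_eqF.
have [a0|a0|a0] := ltgtP a 0.
- have : \forall x \near F, f x < 0 by apply: (cvgr_lt a).
  move=> /filterS h; have {h} : F set0 by apply: h => x /=; rewrite ltNge f0.
  by move=> F0; apply/cvgrPdist_lt => e e0; apply: filterS F0.
- have E : {near F, (fun x => expR (z * ln (f x))) =1 (fun x => f x `^ z)}.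
    have : \forall x \near F, 0 < f x by apply: (cvgr_gt a).
    by apply: filterS => x fx; rewrite /powR gt_eqF.
  rewrite {2}/powR gt_eqF//; apply: (cvg_trans (near_eq_cvg E)).
  apply: (cvg_comp (fun x => z * ln (f x)) (@expR R)); last exact: continuous_expR.
  apply: cvgM; first exact: cvg_cst.
  by apply: (cvg_comp f (@ln R) fa); exact: continuous_ln.
rewrite a0 powR0//; apply/cvgr0Pnorm_lt => e e0.
have e'0 : 0 < e `^ z^-1 by rewrite powR_gt0.
move: fa; rewrite a0 => /cvgr0Pnorm_lt/(_ _ e'0); apply: filterS => x /=.
rewrite ger0_norm// => fx; rewrite ger0_norm ?powR_ge0//.
have -> : e = (e `^ z^-1) `^ z by rewrite -powRrM mulVf// powRr1// ltW.
by apply: gt0_ltr_powR => //; rewrite nnegrE ?(ltW e'0).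
Qed.

(** Stated for an arbitrary filter: it serves both neighbourhoods of a parameter and sequences of
    rational approximations. *)
Definition mxcvg (m n : nat) (M : T -> 'M[R]_(m, n)) (L : 'M[R]_(m, n)) :=
  forall i j, M x i j @[x --> F] --> L i j.

Lemma mxcvg_cst m n (L : 'M[R]_(m, n)) : mxcvg (fun=> L) L.
Proof. by move=> i j; exact: cvg_cst. Qed.

Lemma mxcvgB m n (M M' : T -> 'M[R]_(m, n)) L L' :
  mxcvg M L -> mxcvg M' L' -> mxcvg (fun x => M x - M' x) (L - L').
Proof.
move=> h h' i j; rewrite !mxE; under eq_fun do rewrite !mxE.
by apply: cvgB; [exact: h|exact: h'].
Qed.

Lemma mxcvgD m n (M M' : T -> 'M[R]_(m, n)) L L' :
  mxcvg M L -> mxcvg M' L' -> mxcvg (fun x => M x + M' x) (L + L').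
Proof.
move=> h h' i j; rewrite !mxE; under eq_fun do rewrite !mxE.
by apply: cvgD; [exact: h|exact: h'].
Qed.

Lemma mxcvg_mul m n q (M : T -> 'M[R]_(m, n)) (M' : T -> 'M[R]_(n, q)) L L' :
  mxcvg M L -> mxcvg M' L' -> mxcvg (fun x => M x *m M' x) (L *m L').
Proof.
move=> h h' i j; rewrite !mxE; under eq_fun do rewrite !mxE.
by apply: cvg_sum_seq => l; apply: cvgM; [exact: h|exact: h'].
Qed.

Lemma mxcvg_tr m n (M : T -> 'M[R]_(m, n)) L :
  mxcvg M L -> mxcvg (fun x => (M x)^T) L^T.
Proof. by move=> h i j; rewrite !mxE; under eq_fun do rewrite !mxE; exact: h. Qed.

Lemma cvg_l2norm n (M : T -> 'cV[R]_n) L :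
  mxcvg M L -> l2norm (M x) @[x --> F] --> l2norm L.
Proof.
move=> h; apply: (cvg_comp (fun x => \sum_i M x i 0 ^+ 2) (@Num.sqrt R)); last first.
  exact: sqrt_continuous.
by apply: cvg_sum_seq => i; under eq_fun do rewrite expr2; apply: cvgM; exact: h.
Qed.

End EntrywiseConvergence.

(** * Flats parametrised by a point and a partial isometry *)

Section FlatParametrization.
Variables (R : realType) (n k : nat).
Implicit Types (tau x y : 'cV[R]_n) (V : 'M[R]_(n, k)) (F : set 'cV[R]_n).

Definition pflat tau V : set 'cV[R]_n := [set tau + V *m c | c in [set: 'cV[R]_k]].

(* Partial isometries: then V V^T is the orthogonal projection onto the range
   of V. Unlike orthonormal frames they also describe smaller dimensions. *)
Definition pisom V := V *m V^T *m V = V.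

Lemma pflat_is_flat tau V : is_flat k (pflat tau V).
Proof.
pose f : 'Hom('cV[R]_k, 'cV[R]_n) := linfun (mulmx V).
exists tau, (limg f); split.
  apply: (@leq_trans (\dim {:'cV[R]_k})); last by rewrite dimvf /dim /= muln1.
  by rewrite -(limg_ker_dim f fullv) leq_addl.
apply/seteqP; split=> [_ [c _ <-]|_ [y /memv_imgP[c _ ->] <-]].
  by exists (V *m c) => //=; rewrite -[V *m c](lfunE (mulmx V)) memv_img ?memvf.
by exists c => //; rewrite lfunE.
Qed.

Lemma fdist_pflat tau V x : pisom V ->
  fdist (pflat tau V) x = l2norm ((1%:M - V *m V^T) *m (x - tau)).
Proof.
move=> hV; have [Q EQ] : exists Q, Q = 1%:M - V *m V^T by exists (1%:M - V *m V^T).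
have QV c : Q *m (V *m c) = 0.
  by rewrite EQ mulmxBl mul1mx mulmxA hV subrr.
have QT : Q^T = Q by rewrite EQ linearB /= trmx1 trmx_mul trmxK.
have QQ y : Q *m (Q *m y) = Q *m y.
  by rewrite {2}EQ mulmxBl mul1mx mulmxBr -[V *m _ *m y]mulmxA QV subr0.
have Ql y : l2norm (Q *m y) <= l2norm y.
  rewrite -(@ler_pXn2r _ 2)// ?nnegrE ?l2norm_ge0// !sqr_l2norm.
  have := dot_ge0 (y - Q *m y).
  rewrite dotBl !dotBr (dotC y (Q *m y)) dot_mulmx_tr QT [dot (Q *m y) (Q *m y)]dot_mulmx_tr QT QQ.
  by lra.
have fl := pflat_is_flat tau V.
apply/eqP; rewrite -EQ eq_le; apply/andP; split.
  apply: (le_trans (closest_le x fl (q := tau + V *m (V^T *m (x - tau))) _)).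
    by exists (V^T *m (x - tau)).
  rewrite EQ mulmxBl mul1mx opprD addrA mulmxA lexx //.
have [c _ Ec] := closest_mem x fl.
rewrite /fdist -Ec; apply: le_trans (Ql _).
by rewrite opprD addrA [Q *m (_ - V *m c)]mulmxBr QV subr0.
Qed.

Lemma gsvec_mem (vs : seq 'cV[R]_n) v : v \in gsvec vs -> v \in <<vs>>%VS.
Proof.
elim: vs => [|a vs IH]//=; rewrite in_cons => /orP[/eqP ->|/IH]; last first.
  by rewrite span_cons; apply/subvP; exact: addvSr.
rewrite memvZ// -[gsproj vs *m a](subKr a) memvB//.
  by rewrite span_cons (subvP (addvSl _ _))// memv_line.
by rewrite span_cons (subvP (addvSr _ _))// gsproj_compl.
Qed.

(** The columns of [V] are the Gram-Schmidt vectors of a basis, padded with zeros when the dimension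
    is below [k]. The base point is left free, so that it can later be chosen close to a data
    point. *)
Lemma pflat_repr F tau : is_flat k F -> F tau -> exists V, pisom V /\ F = pflat tau V.
Proof.
move=> [tau0 [W [dW ->]]] [y0 y0W Ey0].
pose vs : seq 'cV[R]_n := vbasis W.
have sW : <<vs>>%VS = W by exact: span_basis (vbasisP W).
have szg : (size (gsvec vs) <= k)%N by rewrite size_gsvec size_tuple.
pose V : 'M[R]_(n, k) := \matrix_(i, j) (gsvec vs)`_j i 0.
have colV j : col j V = (gsvec vs)`_j by apply/colP => i; rewrite !mxE.
have VV : V *m V^T = 1%:M - gsproj vs.
  rewrite gsproj_outer (big_nth 0) big_mkord.
  apply/matrixP => i j; rewrite !mxE summxE.
  rewrite (big_ord_widen _ (fun l => ((gsvec vs)`_l *m ((gsvec vs)`_l)^T) i j) szg) [RHS]big_mkcond.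
  apply: eq_bigr => l _; rewrite !mxE big_ord1 !mxE.
  by case: ltnP => // h; rewrite !nth_default// mxE mul0r.
have QV (c : 'cV[R]_k) : gsproj vs *m (V *m c) = 0.
  apply/eqP; rewrite -gsproj_spanE.
  rewrite (_ : V *m c = \sum_j c j 0 *: (gsvec vs)`_j); last first.
    apply/colP => i; rewrite !mxE summxE; apply: eq_bigr => j _.
    by rewrite !mxE mulrC.
  rewrite memv_suml// => j _; rewrite memvZ//.
  have [h|h] := ltnP j (size (gsvec vs)); first by rewrite gsvec_mem// mem_nth.
  by rewrite nth_default// mem0v.
exists V; split.
  by apply: mulmx_colP => c; rewrite -mulmxA VV mulmxBl mul1mx QV subr0.
apply/seteqP; split=> [_ [y yW <-]|_ [c _ <-]].
  exists (V^T *m (y - y0)) => //; rewrite mulmxA VV mulmxBl mul1mx.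
  rewrite gsproj_span ?sW ?memvB// subr0 -Ey0 -addrA; congr (_ + _).
  by rewrite addrC subrK.
exists (y0 + V *m c); last by rewrite addrA Ey0.
by rewrite /= memvD// -sW gsproj_spanE QV.
Qed.

Lemma pisom_le1 V i j : pisom V -> `|V i j| <= 1.
Proof.
move=> hV; pose A := V *m V^T.
have AE : A i i = \sum_l A i l ^+ 2.
  have : A = A *m A^T by rewrite /A trmx_mul trmxK !mulmxA hV.
  move=> /matrixP/(_ i i); rewrite [in RHS]mxE => ->.
  by apply: eq_bigr => l _; rewrite [_^T _ _]mxE expr2.
have A1 : A i i <= 1.
  have : A i i ^+ 2 <= A i i.
    by rewrite [leRHS]AE (bigD1 i)//= lerDl sumr_ge0// => l _; exact: sqr_ge0.
  by nra.
have : V i j ^+ 2 <= A i i.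
  rewrite mxE (bigD1 j)//= mxE -expr2 lerDl sumr_ge0// => l _.
  by rewrite mxE -expr2 sqr_ge0.
move=> h; have : `|V i j| ^+ 2 <= 1 by rewrite real_normK ?num_real//; lra.
by rewrite expr_le1.
Qed.

End FlatParametrization.

Lemma abs_le_l2norm (R : realType) (n : nat) (x : 'cV[R]_n) i : `|x i 0| <= l2norm x.
Proof.
rewrite -sqrtr_sqr ler_sqrt; last by apply: sumr_ge0 => j _; exact: sqr_ge0.
by rewrite (bigD1 i)//= lerDl sumr_ge0// => j _; exact: sqr_ge0.
Qed.

HB.lock Definition objective (R : realType) (n : nat) (z : R) (s : seq 'cV[R]_n)
  (F : set 'cV[R]_n) : R := \sum_(y <- s) fdist F y `^ z.

Section OptimalFlat.
Variables (R : realType) (n k : nat) (z : R).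
Hypothesis z_gt0 : 0 < z.
Implicit Types (F : set 'cV[R]_n).

Local Notation objective := (objective z).

Local Notation param := (prod_topology (fun _ : 'I_n * option 'I_k => R)).
Let ptau (th : param) : 'cV[R]_n := \col_i th (i, None).
Let pV (th : param) : 'M[R]_(n, k) := \matrix_(i, j) th (i, Some j).

Let cvg_coord (th : param) ij : (fun x : param => x ij) @ th --> th ij.
Proof. exact: (@proj_continuous _ (fun _ => R) ij th). Qed.

Let cvg_tau (th : param) : mxcvg (nbhs th) ptau (ptau th).
Proof.
move=> i j; rewrite mxE (_ : (fun x => ptau x i j) = (fun x => x (i, None))).
  exact: cvg_coord.
by apply/funext => x; rewrite mxE.
Qed.

Let cvg_V (th : param) : mxcvg (nbhs th) pV (pV th).
Proof.
move=> i j; rewrite mxE (_ : (fun x => pV x i j) = (fun x => x (i, Some j))).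
  exact: cvg_coord.
by apply/funext => x; rewrite mxE.
Qed.

Let closed_pisom : closed [set th : param | pisom (pV th)].
Proof.
have -> : [set th : param | pisom (pV th)] =
  \bigcap_(ij in [set: 'I_n * 'I_k])
   ((fun th : param => (pV th *m (pV th)^T *m pV th - pV th) ij.1 ij.2) @^-1` [set 0]).
  apply/seteqP; split => th; first by rewrite /= /pisom => h ij _ /=; rewrite h subrr mxE.
  move=> h; apply/eqP; rewrite -subr_eq0; apply/eqP/matrixP => i j; rewrite [RHS]mxE.
  exact: (h (i, j)).
apply: closed_bigI => ij _; apply: preimage_closed; last exact: closed_eq.
move=> th _; have cV := @cvg_V th.
have H : mxcvg (nbhs th) (fun x => pV x *m (pV x)^T *m pV x - pV x)
    (pV th *m (pV th)^T *m pV th - pV th).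
  apply: mxcvgB => //; apply: mxcvg_mul => //; apply: mxcvg_mul => //.
  exact: mxcvg_tr.
exact: H.
Qed.

(** Compactness of the parameters. By [pisom_le1], partial isometries have entries in [[-1, 1]].
    Translations are confined by taking as base point the point closest to the first data point [y]:
    for a flat at least as good as the one-point flat [F0] at [y], it lies within the cost [r] of
    [F0]. Any other flat is beaten by [F0], which has admissible parameters. *)
Lemma exists_minimizing_flat s : exists F, is_flat k F /\
  forall F', is_flat k F' -> objective s F <= objective s F'.
Proof.
case: s => [|y s].
  exists (pflat 0 (0 : 'M[R]_(n, k))); split; first exact: pflat_is_flat.
  have E F : objective [::] F = 0 by rewrite objective.unlock big_nil.
  by move=> F' _; rewrite !E.
have obj_ge0 F (s' : seq 'cV[R]_n) : 0 <= objective s' F.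
  by rewrite objective.unlock; apply: sumr_ge0 => x _; exact: powR_ge0.
have pis0 : pisom (0 : 'M[R]_(n, k)) by rewrite /pisom mulmx0.
pose F0 := pflat y (0 : 'M[R]_(n, k)).
pose r := objective (y :: s) F0 `^ z^-1.
have r0 : 0 <= r by exact: powR_ge0.
pose box (ij : 'I_n * option 'I_k) : set R :=
  if ij.2 is Some _ then `[-1, 1]%classic else `[y ij.1 0 - r, y ij.1 0 + r]%classic.
pose A := [set th : param | forall ij, box ij (th ij)] `&` [set th : param | pisom (pV th)].
have cA : compact A.
  apply: compact_closedI => //.
  have cbox ij : compact (box ij).
    by rewrite /box; case: ij.2 => [_|]; exact: segment_compact.
  by have := @tychonoff _ _ _ cbox.
pose h (x : 'cV[R]_n) (th : param) := l2norm ((1%:M - pV th *m (pV th)^T) *m (x - ptau th)).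
pose f (th : param) := \sum_(x <- y :: s) h x th `^ z.
have fE th : pisom (pV th) -> f th = objective (y :: s) (pflat (ptau th) (pV th)).
  by move=> hV; rewrite objective.unlock; apply: eq_bigr => x _; rewrite fdist_pflat.
have cf : continuous f.
  move=> th.
  have ch x : h x u @[u --> nbhs th] --> h x th.
    apply: cvg_l2norm; apply: mxcvg_mul; last first.
      by apply: mxcvgB; [exact: mxcvg_cst|exact: cvg_tau].
    apply: mxcvgB; first exact: mxcvg_cst.
    by apply: mxcvg_mul; [exact: cvg_V|apply: mxcvg_tr; exact: cvg_V].
  have chz x : h x u `^ z @[u --> nbhs th] --> h x th `^ z.
    by apply: cvg_powR => // u; exact: l2norm_ge0.
  have := @cvg_sum_seq R param (nbhs th) (nbhs_filter th) _ (y :: s) xpredT _ _ chz.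
  exact.
pose enc (tau : 'cV[R]_n) (V : 'M[R]_(n, k)) : param :=
  fun ij => if ij.2 is Some j then V ij.1 j else tau ij.1 0.
have encT tau V : ptau (enc tau V) = tau by apply/colP => i; rewrite mxE.
have encV tau V : pV (enc tau V) = V by apply/matrixP => i j; rewrite mxE.
have A_enc tau V : pisom V -> l2norm (y - tau) <= r -> A (enc tau V).
  move=> hV hr; split; last by rewrite /= encV.
  move=> [i [j|]]; rewrite /box /enc /= in_itv /=.
    by rewrite -ler_norml pisom_le1.
  rewrite -ler_distl distrC; apply: le_trans hr.
  by have := abs_le_l2norm (y - tau) i; rewrite !mxE.
have A0 : A !=set0.
  by exists (enc y 0); apply: A_enc => //; rewrite subrr l2norm0.
have [th /set_mem[_ thp] thmin] := compact_EVT_min A0 cA (continuous_subspaceT cf).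
exists (pflat (ptau th) (pV th)); split; first exact: pflat_is_flat.
have {}thmin tau (V : 'M[R]_(n, k)) : pisom V -> l2norm (y - tau) <= r ->
    objective (y :: s) (pflat (ptau th) (pV th)) <= objective (y :: s) (pflat tau V).
  move=> hV hr; have := thmin (enc tau V); rewrite inE => /(_ (A_enc _ _ hV hr)).
  have E2 := fE (enc tau V); rewrite encT encV in E2.
  by rewrite (fE _ thp) (E2 hV).
move=> F' fF'; have [le|gt] := leP (objective (y :: s) F') (objective (y :: s) F0); last first.
  by apply: le_trans (ltW gt); apply: thmin => //; rewrite subrr l2norm0.
have [V [hV FE]] := pflat_repr fF' (closest_mem y fF').
rewrite [in leRHS]FE; apply: thmin => //.
have z1 : 0 <= z^-1 by rewrite invr_ge0 ltW.
rewrite -/(fdist F' y) -[leLHS]powRr1 ?l2norm_ge0// -(mulfV (x := z)) ?gt_eqF// powRrM /r.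
have := obj_ge0 F0 (y :: s) => h0.
apply: ge0_ler_powR => //; rewrite ?nnegrE ?powR_ge0//.
apply: le_trans le; rewrite objective.unlock big_cons lerDl.
by have := obj_ge0 F' s; rewrite objective.unlock.
Qed.

End OptimalFlat.

(** * Measurability of the optimal cost *)

Section CostOfFiniteSets.
Variables (R : realType) (n k : nat) (z : R).
Hypothesis z_gt0 : 0 < z.
Implicit Types (F Y : set 'cV[R]_n).

Lemma cost_ge0 Y F : 0 <= cost z Y F. Proof. exact: powR_ge0. Qed.

Lemma cost_seq (s : seq 'cV[R]_n) F : uniq s ->
  cost z [set` s] F = objective z s F `^ z^-1.
Proof. by move=> us; rewrite objective.unlock /cost -fsbig_seq. Qed.

Lemma exists_optimal_flat Y : finite_set Y -> exists F, is_optimal_flat k z Y F.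
Proof.
move=> /finite_seqP[s0 ->].
have -> : [set` s0] = [set` undup s0] by apply/seteqP; split => x /=; rewrite mem_undup.
have [F [fF Fmin]] := exists_minimizing_flat k z_gt0 (undup s0).
exists F; split; first exact: fF.
move=> F' fF'; rewrite (cost_seq F (undup_uniq s0)) (cost_seq F' (undup_uniq s0)).
have h0 F1 : 0 <= objective z (undup s0) F1.
  by rewrite objective.unlock sumr_ge0// => y _; exact: powR_ge0.
by apply: ge0_ler_powR; rewrite ?nnegrE ?h0 ?Fmin// invr_ge0 ltW.
Qed.

Variable N : nat.
Implicit Type y : 'I_N -> 'cV[R]_n.

(** Selects one index per value of [y]: the sum over a set in [cost] becomes an indexed sum with 0-1
    weights that depend measurably on the points. *)
Definition first_occ y (i : 'I_N) := [forall j : 'I_N, (j < i)%N ==> (y j != y i)].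

Lemma cost_range y F :
  cost z (range y) F = (\sum_(i | first_occ y i) fdist F (y i) `^ z) `^ z^-1.
Proof.
rewrite /cost; congr (_ `^ _).
have -> : range y = y @` [set` first_occ y].
  apply/seteqP; split=> [_ [i _ <-]|_ [i _ <-]]; last by exists i.
  pose p j := y j == y i; have pi : p i by rewrite /p.
  have [j /eqP pj jmin] := arg_minnP (fun j : 'I_N => j : nat) pi.
  exists j => //=; apply/forallP => l; apply/implyP; rewrite ltnNge pj; apply: contra.
  exact: jmin.
rewrite fsbig_image.
  have -> : [set` first_occ y] = [set` enum (first_occ y)].
    by apply/seteqP; split => i /=; rewrite mem_enum.
  by rewrite -fsbig_seq ?enum_uniq// big_enum.
move=> i j /set_mem /= /forallP hi /set_mem /= /forallP hj yij.
apply/val_inj/eqP; case: ltngtP => // ij.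
  by have := hj i; rewrite ij yij eqxx.
by have := hi j; rewrite ij yij eqxx.
Qed.

Lemma first_occ_inj y i : injective y -> first_occ y i.
Proof.
move=> yinj; apply/forallP => j; apply/implyP; apply: contraTneq => /yinj ->.
by rewrite ltnn.
Qed.

Lemma cost_range_inj y F : injective y ->
  cost z (range y) F = lz z (fun i => fdist F (y i)).
Proof.
move=> yinj; rewrite cost_range lz.unlock; congr (_ `^ _).
apply: eq_big => [i|i _]; first by rewrite first_occ_inj.
by rewrite ger0_norm// l2norm_ge0.
Qed.

End CostOfFiniteSets.

Section OptimalCostMeasurability.
Variables (R : realType) (disp : measure_display) (T : measurableType disp).
Variables (n k N : nat) (z : R).
Hypothesis z_gt0 : 0 < z.
Variable y : 'I_N -> T -> 'cV[R]_n.
Hypothesis my : forall i l, measurable_fun setT (fun w => y i w l 0).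
Implicit Types (F : set 'cV[R]_n).

Lemma exists_rat_cvg :
  exists q : R -> nat -> rat, forall x, (ratr (q x m) : R) @[m --> \oo] --> x.
Proof.
have E (x : R) m : exists r : rat, `|x - ratr r| < m.+1%:R^-1.
  have lt : x - m.+1%:R^-1 < x + m.+1%:R^-1 by rewrite ltrD2l gtrN// invr_gt0.
  have [r] := rat_in_itvoo lt.
  by rewrite in_itv /= -ltr_distlC => h; exists r.
pose q x m := sval (cid (E x m)).
exists q => x; apply/cvgrPdist_lt => e e0.
near=> m; apply: (lt_trans (svalP (cid (E x m)))).
near: m; exact: (near_infty_natSinv_lt (PosNum e0)).
Unshelve. all: by end_near. Qed.

Let weight i w : R := (first_occ (y^~ w) i)%:R.

Let measurable_weight i : measurable_fun setT (weight i).
Proof.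
rewrite (_ : weight i = \1_(~` [set w | exists j : 'I_N, (j < i)%N /\ y j w = y i w])).
  apply: measurable_indic; apply: measurableC; apply: measurable_finite_exists => j.
  have mji : measurable [set w | y j w = y i w].
    rewrite (_ : [set w | _] = [set w | dot (y j w - y i w) (y j w - y i w) = 0]).
      apply: measurable_fun_eq0; apply: measurable_sum => l.
      have m1 : measurable_fun setT (fun w => (y j w - y i w) l 0).
        by under eq_fun do rewrite !mxE; exact: measurable_funB.
      exact: measurable_funM.
    apply/seteqP; split => w /=; first by move=> ->; rewrite subrr dot0l.
    by move=> /eqP; rewrite dot_eq0 subr_eq0 => /eqP.
  case: (j < i)%N; [rewrite (_ : (fun w => _) = [set w | y j w = y i w])//|
                    rewrite (_ : (fun w => _) = set0)//];
  by apply/seteqP; split => w //= [].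
apply/funext => w; rewrite indicE /weight; congr ((_ : bool)%:R).
apply/forallP/idP => [h|].
  rewrite inE /= => -[j [ji /eqP ye]].
  by have := h j; rewrite ji ye.
rewrite inE /= => h j; apply/implyP => ji; apply/eqP => ye.
by apply: h; exists j.
Qed.

Let dist_sum (q : 'I_N -> 'cV[R]_n) w :=
  \sum_i weight i w * l2norm (y i w - q i) `^ z.

Let measurable_dist_sum q : measurable_fun setT (dist_sum q).
Proof.
apply: measurable_sum => i; apply: measurable_funM; first exact: measurable_weight.
apply: (measurableT_comp (measurable_powR z)).
apply: (measurableT_comp (continuous_measurable_fun (@sqrt_continuous R))).
apply: measurable_sum => l; apply: measurable_funX.
by under eq_fun do rewrite !mxE; exact: measurable_funB.
Qed.

Let costE w F : cost z (range (y^~ w)) F = dist_sum (fun i => closest F (y i w)) w `^ z^-1.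
Proof.
rewrite cost_range; congr (_ `^ _); rewrite big_mkcond; apply: eq_bigr => i _.
by rewrite /weight; case: (first_occ _ _); rewrite ?mul1r ?mul0r.
Qed.

Let dist_sum_ge0 q w : 0 <= dist_sum q w.
Proof. by apply: sumr_ge0 => i _; rewrite mulr_ge0// ?powR_ge0// ler0n. Qed.

Let cost_ltE w F a : 0 < a ->
  (cost z (range (y^~ w)) F < a) = (dist_sum (fun i => closest F (y i w)) w < a `^ z).
Proof.
move=> a0; have zn0 : z != 0 by rewrite gt_eqF.
have zi0 : 0 < z^-1 by rewrite invr_gt0.
have aE : a = (a `^ z) `^ z^-1 by rewrite -powRrM mulfV// powRr1// ltW.
rewrite costE {1}aE; apply/idP/idP => h.
  rewrite ltNge; apply/negP => /(ge0_ler_powR (ltW zi0)).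
  by rewrite !nnegrE powR_ge0 dist_sum_ge0 leNgt h => /(_ isT isT).
by apply: gt0_ltr_powR; rewrite ?nnegrE ?powR_ge0.
Qed.

(** The event is a countable union over rational data, since a strict inequality for a flat survives
    rational approximation of its base point, of its directions and of the coordinates of the
    closest points. *)
Lemma measurable_cost_lt a :
  measurable [set w | exists F, is_flat k F /\ cost z (range (y^~ w)) F < a].
Proof.
have [a0|a0] := leP a 0.
  rewrite (_ : [set w | _] = set0)//; apply/seteqP; split => w // [F [_]].
  by rewrite ltNge (le_trans a0)// cost_ge0.
pose toR m1 m2 (A : 'M[rat]_(m1, m2)) : 'M[R]_(m1, m2) := map_mx ratr A.
(* [th] describes a flat and one point of it per index. These points need not be the closest ones;
   passing to the closest ones only lowers the sum. *)
pose q (th : 'cV[rat]_n * 'M[rat]_(n, k) * 'M[rat]_(k, N)) (i : 'I_N) : 'cV[R]_n :=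
  toR _ _ th.1.1 + toR _ _ th.1.2 *m col i (toR _ _ th.2).
rewrite (_ : [set w | _] = \bigcup_th [set w | dist_sum (q th) w < a `^ z]).
  apply: countable_bigcupT_measurable; first exact: countableP.
  move=> th.
  by rewrite -[X in measurable X]setTI; apply: measurable_fun_ltr.
apply/seteqP; split => w /=; last first.
  move=> [th _ /= h]; exists (pflat (toR _ _ th.1.1) (toR _ _ th.1.2)).
  have fl := pflat_is_flat (toR _ _ th.1.1) (toR _ _ th.1.2).
  split; first exact: fl.
  rewrite (cost_ltE _ _ a0); apply: le_lt_trans h.
  apply: ler_sum => i _; rewrite ler_wpM2l ?ler0n//.
  apply: ge0_ler_powR; rewrite ?nnegrE ?l2norm_ge0//; first exact: ltW.
  by apply: (closest_le _ fl); exists (col i (toR _ _ th.2)).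
move=> [F [fF]]; rewrite (cost_ltE _ _ a0) => h.
have [V [hV FE]] := pflat_repr fF (closest_mem 0 fF).
set tau := closest F 0 in FE.
have /choice[c cE] (i : 'I_N) : exists c : 'cV[R]_k, tau + V *m c = closest F (y i w).
  by have := closest_mem (y i w) fF; rewrite [X in X _ -> _]FE => -[c _ <-]; exists c.
have [r rE] := exists_rat_cvg.
pose app m1 m2 (A : 'M[R]_(m1, m2)) m : 'M[rat]_(m1, m2) := \matrix_(i, j) r (A i j) m.
have appE m1 m2 (A : 'M[R]_(m1, m2)) : mxcvg \oo (fun m => toR _ _ (app _ _ A m)) A.
  by move=> i j; under eq_fun do rewrite !mxE; exact: rE.
pose C : 'M[R]_(k, N) := \matrix_(l, i) c i l 0.
have CE i : col i C = c i by apply/colP => l; rewrite !mxE.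
pose th m := (app _ _ tau m, app _ _ V m, app _ _ C m).
have cq i : mxcvg \oo (fun m => q (th m) i) (closest F (y i w)).
  rewrite -cE; apply: mxcvgD; first exact: appE.
  apply: mxcvg_mul; first exact: appE.
  by move=> l j; rewrite -CE [in X in _ --> X]mxE; under eq_fun do rewrite mxE; exact: appE.
have cs : dist_sum (q (th m)) w @[m --> \oo] --> dist_sum (fun i => closest F (y i w)) w.
  apply: cvg_sum_seq => i; apply: cvgM; first exact: cvg_cst.
  apply: cvg_powR => //; first by move=> m; exact: l2norm_ge0.
  by apply: cvg_l2norm; apply: mxcvgB => //; exact: mxcvg_cst.
have [m _ /(_ m (leqnn m)) /= hm] : \forall m \near \oo, dist_sum (q (th m)) w < a `^ z.
  exact: (cvgr_lt _ cs).
by exists (th m).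
Qed.

(** Because an optimal flat always exists, the lower bound says that no flat costs less than [lo],
    and the upper bound that for every [m] some flat costs less than [hi + 1 / (m + 1)]. *)
Lemma measurable_optimal_cost lo hi :
  measurable [set w | exists F, is_optimal_flat k z (range (y^~ w)) F /\
    lo <= cost z (range (y^~ w)) F /\ cost z (range (y^~ w)) F <= hi].
Proof.
rewrite (_ : [set w | _] =
    ~` [set w | exists F, is_flat k F /\ cost z (range (y^~ w)) F < lo] `&`
    \bigcap_m [set w | exists F, is_flat k F /\ cost z (range (y^~ w)) F < hi + m.+1%:R^-1]).
  apply: measurableI; first by apply: measurableC; exact: measurable_cost_lt.
  by apply: bigcapT_measurable => m; exact: measurable_cost_lt.
apply/seteqP; split => w /=.
  move=> [F [[fF Fmin] [Flo Fhi]]]; split.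
    by move=> [F' [/Fmin h]]; rewrite ltNge (le_trans Flo).
  by move=> m _ /=; exists F; split => //; rewrite (le_lt_trans Fhi)// ltrDl invr_gt0.
move=> [hlo hhi].
have fin : finite_set (range (y^~ w)) by apply: finite_image; exact: finite_finset.
have [F [fF Fmin]] := exists_optimal_flat k z_gt0 fin.
exists F; split => //; split.
  by rewrite leNgt; apply/negP => h; apply: hlo; exists F.
apply/ler_addgt0Pr => e e0.
have [m me] : exists m : nat, m.+1%:R^-1 <= e.
  have [m _ /(_ m (leqnn m)) h] := near_infty_natSinv_lt (PosNum e0).
  by exists m; exact: ltW.
have [F' [fF' h]] := hhi m I.
by rewrite (le_trans (Fmin _ fF'))// (le_trans (ltW h))// lerD2l.
Qed.

End OptimalCostMeasurability.

(** * Choice of the parameters *)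

Section NetSizes.
Variable R : realType.
Implicit Types (eps z t L : R).

Lemma exp2_le_expR n : 2 ^+ n <= expR n%:R :> R.
Proof.
rewrite -[n%:R]mulr1 expRM_natl lerXn2r ?nnegrE ?expR_ge0//.
by have := expR_ge1Dx (1 : R); lra.
Qed.

Lemma exists_nat_above x : 0 <= x :> R -> exists n : nat, x < n%:R <= x + 1.
Proof.
move=> /truncn_itv/andP[h1 h2]; exists (Num.truncn x).+1.
by rewrite h2 -natr1 lerD2r.
Qed.

(** The exponents of [exists_net_parameters] in multiples of [unit]: the grid, the Markov steps, the
    Gaussian tail and the constant 40. *)
Lemma exponent_budget (u : R) : 1 <= u ->
  4845 * u + 3531 * u - 1024 * 2 ^+ 4 * u + 6 * u <= 0.
Proof. lra. Qed.

Lemma forty_le_expR6 : 40 <= expR 6%:R :> R.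
Proof. by apply: le_trans (exp2_le_expR 6); lra. Qed.

Context (k : nat) (eps z t : R).
Hypotheses (k_gt0 : (0 < k)%N) (eps_gt0 : 0 < eps) (eps_lt1 : eps < 1) (z_ge1 : 1 <= z).
Let L := 1 + ln (k%:R / eps).
Hypothesis t_ge : 2 ^+ 31 * (z * k%:R ^+ 2 * L ^+ 2 / eps ^+ 3) <= t.

Let k1 : 1 <= k%:R :> R. Proof. by rewrite ler1n. Qed.
Let a_ge1 : 1 <= k%:R / eps.
Proof. by rewrite ler_pdivlMr// mul1r (le_trans (ltW eps_lt1)). Qed.
Let L_ge1 : 1 <= L. Proof. by rewrite lerDl ln_ge0. Qed.
Let expRL : expR (L - 1) = k%:R / eps.
Proof. by rewrite addrC addKr lnK// posrE (lt_le_trans ltr01). Qed.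
Let L_le : L <= k%:R / eps.
Proof. by rewrite -expRL -[leLHS](subrK 1) addrC expR_ge1Dx. Qed.

(** As [L = 1 + ln (k / eps)], the right side is the [n]-th power of [e k / eps]: one exponential
    absorbs a numerical constant and a power of [1 / eps] together. *)
Let expR_lower (n m : nat) : (m <= n)%N -> 2 ^+ n * (k%:R / eps) ^+ m <= expR (n%:R * L).
Proof.
move=> mn; have -> : n%:R * L = n%:R + n%:R * (L - 1) by ring.
rewrite expRD ler_pM ?exprn_ge0 ?exp2_le_expR//; first by rewrite (le_trans ler01).
rewrite expRM_natl expRL ler_weXn2l//.
Qed.

Lemma z_le_eps_dim : 50 * z <= eps * t.
Proof.
have e3 : 0 < eps ^+ 3 by rewrite exprn_gt0.
apply: (@le_trans _ _ (eps * (2 ^+ 31 * (z * k%:R ^+ 2 * L ^+ 2 / eps ^+ 3)))); last first.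
  by rewrite ler_wpM2l// ltW.
have -> : eps * (2 ^+ 31 * (z * k%:R ^+ 2 * L ^+ 2 / eps ^+ 3)) =
  2 ^+ 31 * z * (k%:R ^+ 2 * L ^+ 2 / eps ^+ 2) by field; rewrite gt_eqF.
have h : 1 <= k%:R ^+ 2 * L ^+ 2 / eps ^+ 2.
  rewrite ler_pdivlMr ?exprn_gt0// mul1r (@le_trans _ _ 1)//.
    by rewrite expr_le1// ltW.
  by rewrite mulr_ege1// exprn_ege1.
have z0 : 0 <= 2 ^+ 31 * z by rewrite mulr_ge0 ?exprn_ge0// (le_trans ler01).
apply: (@le_trans _ _ (2 ^+ 31 * z * 1)); last by rewrite ler_wpM2l.
rewrite mulr1 ler_wpM2r ?(le_trans ler01)//.
have -> : 2 ^+ 31 = 2 ^+ 6 * 2 ^+ 25 :> R by rewrite -exprD.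
have : 1 <= 2 ^+ 25 :> R by rewrite exprn_ege1// ler1n.
move: (2 ^+ 25) => u u1; lra.
Qed.

Let budget : 2 ^+ 17 * 2 ^+ 14 * (z * k%:R ^+ 2 * L ^+ 2 / eps) <= eps ^+ 2 * t.
Proof.
have -> : 2 ^+ 17 * 2 ^+ 14 * (z * k%:R ^+ 2 * L ^+ 2 / eps) =
    eps ^+ 2 * (2 ^+ 31 * (z * k%:R ^+ 2 * L ^+ 2 / eps ^+ 3)).
  by rewrite -exprD; field; rewrite gt_eqF.
by rewrite ler_wpM2l ?exprn_ge0// ltW.
Qed.

Let unit := z * k%:R ^+ 2 * L ^+ 2 / eps.
(** [2 ^+ 17] is [8^2 * 2048]: the right side is the tail exponent of [gsq_ok_tail] at accuracy
    [eps / 8]. *)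
Let budget' : 2 ^+ 14 * unit <= eps ^+ 2 * t / 2 ^+ 17.
Proof.
rewrite ler_pdivlMr ?exprn_gt0//; apply: le_trans budget.
by rewrite le_eqVlt; apply/orP; left; apply/eqP; rewrite /unit; ring.
Qed.

Let L_le_unit : L <= unit.
Proof.
rewrite /unit ler_pdivlMr//.
apply: (@le_trans _ _ (L * 1)); first by rewrite ler_wpM2l ?(le_trans ler01)// ltW.
rewrite mulr1 [L ^+ 2]expr2 mulrA ler_peMl ?(le_trans ler01)//.
by rewrite !mulr_ege1// exprn_ege1.
Qed.

Lemma overshoot_bound_small : 2 / eps * expR (- (eps ^+ 2 * t / 32)) <= 1 / 20.
Proof.
have h1 : 40 / eps <= expR (6%:R * L).
  apply: le_trans (@expR_lower 6 1 isT); rewrite expr1 mulrA ler_pM2r ?invr_gt0//.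
  by move: k1; lra.
have h2 : 6%:R * L <= eps ^+ 2 * t / 32.
  have u0 : 0 <= unit by rewrite (le_trans _ L_le_unit)// (le_trans ler01).
  have b : 2 ^+ 14 * unit * 2 ^+ 17 <= eps ^+ 2 * t by rewrite -ler_pdivlMr ?exprn_gt0.
  have : 6 * 32 <= 2 ^+ 14 * 2 ^+ 17 :> R.
    rewrite -exprD (_ : (14 + 17)%N = (8 + 23)%N)// exprD.
    have : 1 <= 2 ^+ 23 :> R by rewrite exprn_ege1// ler1n.
    move: (2 ^+ 23) => u u1; lra.
  move=> h; have : 6 * 32 * unit <= eps ^+ 2 * t.
    apply: le_trans b; rewrite [leRHS]mulrAC; exact: ler_wpM2r.
  by move: L_le_unit; lra.
have : 40 / eps * expR (- (eps ^+ 2 * t / 32)) <= 1.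
  rewrite expRN ler_pdivrMr ?expR_gt0// mul1r (le_trans h1)// ler_expR//.
by lra.
Qed.

Lemma exists_net_parameters : exists J M : nat, [/\ (0 < M)%N,
  6 * (k.+1 + J)%:R <= eps / 8 * M%:R,
  (1 + (eps / 8 / 3) ^- 2) ^+ k.+1 * (1 - eps / 8 / 2) ^+ J < 1 &
  (M + M).+1%:R ^+ (k.+1 + J) * (2 * expR (- ((eps / 8) ^+ 2 * t / 2048))) *
    (4 * ((3 ^+ k.+2) `^ z) / (eps / 8)) ^+ J <= 1 / 20].
Proof.
have L0 : 0 < L by rewrite (lt_le_trans ltr01).
(* [J] is about [320 Y] and [M] about [48 * 323 * Y / eps]; every factor of the
   failure bound is then the exponential of a constant times [unit]. *)
have [Y EY] : exists Y, Y = k%:R * L / eps by exists (k%:R * L / eps).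
have kL : 1 <= k%:R * L by rewrite mulr_ege1.
have Y1 : 1 <= Y by rewrite EY ler_pdivlMr// mul1r (le_trans (ltW eps_lt1)).
have kY : k%:R <= Y.
  by rewrite EY ler_pdivlMr// ler_pM ?(ltW eps_gt0)// (le_trans (ltW eps_lt1)).
have Y0 : 0 <= Y by rewrite (le_trans ler01).
(* The determinant condition reduces to [10 (k + 1) L < J eps / 16]; with [k + 1 <= 2 k] this gives
   [320 = 10 * 2 * 16]. *)
have J00 : 0 <= 320 * Y by lra.
have [J /andP[J1 J2]] := exists_nat_above J00.
have {}J2 : J%:R <= 321 * Y by lra.
have s2 : (k.+1 + J)%:R <= 323 * Y :> R by rewrite natrD -natr1; lra.
have Ye0 : 0 <= Y / eps by rewrite divr_ge0// ltW.
have M00 : 0 <= 48 * 323 * (Y / eps) by move: (Y / eps) Ye0 => v; lra.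
have [M /andP[M1 M2]] := exists_nat_above M00.
exists J, M; split.
- by rewrite -(ltr0n R) (le_lt_trans M00).
- apply: (@le_trans _ _ (6 * (323 * Y))); first by rewrite ler_pM2l.
  apply: (@le_trans _ _ (eps / 8 * (48 * 323 * (Y / eps)))).
    by rewrite le_eqVlt; apply/orP; left; apply/eqP; field; rewrite gt_eqF.
  by rewrite ler_wpM2l ?divr_ge0 ?ltW.
- have h1 : 1 + (eps / 8 / 3) ^- 2 <= expR (10%:R * L).
    apply: le_trans (@expR_lower 10 2 isT).
    have -> : (eps / 8 / 3) ^- 2 = 576 / eps ^+ 2 by field; rewrite gt_eqF.
    have e2 : eps ^+ 2 <= 1 by rewrite expr_le1// ltW.
    have e20 : 0 < eps ^+ 2 by rewrite exprn_gt0.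
    rewrite expr_div_n mulrA ler_pdivlMr// mulrDl divfK ?gt_eqF//.
    have : 1 <= k%:R ^+ 2 :> R by rewrite exprn_ege1.
    have -> : 2 ^+ 10 = 1024 :> R by rewrite -natrX.
    by move: (k%:R ^+ 2) e2 => u; lra.
  have h2 : 1 - eps / 8 / 2 <= expR (- (eps / 16)).
    by apply: le_trans (expR_ge1Dx _); lra.
  have b0 : 0 <= 1 + (eps / 8 / 3) ^- 2.
    by rewrite addr_ge0// invr_ge0 exprn_ge0// !divr_ge0// ltW.
  apply: (@le_lt_trans _ _ (expR (10%:R * L) ^+ k.+1 * expR (- (eps / 16)) ^+ J)).
    have b1 : 0 <= 1 - eps / 8 / 2 by move: eps_lt1; lra.
    by rewrite ler_pM ?exprn_ge0// lerXn2r ?nnegrE ?expR_ge0.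
  rewrite -!expRM_natl -expRD -[ltRHS]expR0 ltr_expR.
  have : 320 * (k%:R * L) < J%:R * eps.
    by rewrite -ltr_pdivrMr// -mulrA -EY.
  have h : k.+1%:R * L <= 2 * (k%:R * L).
    by rewrite mulrA ler_wpM2r ?(ltW L0)// -natr1; move: k1; lra.
  have -> : k.+1%:R * (10 * L) + J%:R * - (eps / 16) = 10 * (k.+1%:R * L) - J%:R * eps / 16.
    by ring.
  by move: (_ * L) (_ * L) (_ * eps) h => u1 u2 u3; lra.
have p5 : 2 ^+ 5 = 32 :> R by rewrite -natrX.
have p10 : 2 ^+ 10 = 1024 :> R by rewrite -natrX.
have u1 : 1 <= unit by rewrite (le_trans _ L_le_unit).
have YL : Y * L <= unit.
  have -> : Y * L = k%:R * L ^+ 2 / eps by rewrite EY; field; rewrite gt_eqF.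
  rewrite /unit ler_pM2r ?invr_gt0// ler_wpM2r ?exprn_ge0 ?(ltW L0)//.
  rewrite expr2 mulrA ler_peMl ?(le_trans ler01)//.
  by rewrite mulr_ege1.
have Yk : Y * (k%:R * z) <= unit.
  have -> : Y * (k%:R * z) = z * k%:R ^+ 2 * L / eps by rewrite EY; field; rewrite gt_eqF.
  rewrite /unit ler_pM2r ?invr_gt0// ler_wpM2l ?mulr_ge0 ?exprn_ge0 ?(le_trans ler01)//.
  rewrite [leRHS]expr2.
  by rewrite ler_peMl ?(ltW L0).
have a0 : 0 < k%:R / eps by rewrite (lt_le_trans ltr01).
have Yeps : Y / eps <= (k%:R / eps) ^+ 3.
  have -> : Y / eps = k%:R / eps * (L * eps^-1) by rewrite EY; field; rewrite gt_eqF.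
  rewrite exprS ler_wpM2l ?(ltW a0)// expr2 ler_pM ?invr_ge0 ?(ltW eps_gt0) ?(ltW L0)//.
  by rewrite ler_peMl ?invr_ge0 ?(ltW eps_gt0).
have Yeps1 : 1 <= Y / eps.
  by rewrite ler_pdivlMr// mul1r (le_trans (ltW eps_lt1)).
have hM : (M + M).+1%:R <= expR (15%:R * L).
  apply: le_trans (@expR_lower 15 3 isT).
  apply: (@le_trans _ _ ((2 * 48 * 323 + 3) * (Y / eps))).
    by rewrite -natr1 natrD; move: Yeps1 M2; move: (Y / eps) => u; lra.
  apply: (@le_trans _ _ (2 ^+ 15 * (Y / eps))); last by rewrite ler_wpM2l ?exprn_ge0.
  by rewrite ler_wpM2r// (exprD _ 10 5) p10 p5; lra.
have hMs : (M + M).+1%:R ^+ (k.+1 + J) <= expR (4845 * unit).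
  apply: (@le_trans _ _ (expR (15%:R * L) ^+ (k.+1 + J))).
    by rewrite lerXn2r ?nnegrE ?expR_ge0.
  rewrite -expRM_natl ler_expR.
  apply: (@le_trans _ _ (323 * Y * (15%:R * L))).
    by rewrite ler_wpM2r ?mulr_ge0 ?(ltW L0).
  have -> : 323 * Y * (15%:R * L) = 4845 * (Y * L) by ring.
  by move: YL; lra.
have hQ : 4 * ((3 ^+ k.+2) `^ z) / (eps / 8) <= expR (5%:R * L + 6 * (k%:R * z)).
  have -> : 4 * ((3 ^+ k.+2) `^ z) / (eps / 8) = 32 / eps * ((3 ^+ k.+2) `^ z).
    by field; rewrite gt_eqF.
  rewrite expRD ler_pM ?powR_ge0 ?divr_ge0 ?(ltW eps_gt0)//.
    apply: le_trans (@expR_lower 5 1 isT).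
    rewrite expr1 mulrA ler_pM2r ?invr_gt0//.
    by rewrite p5; move: k1; lra.
  (* [3 <= e^2], hence [3^(k + 2) <= e^(2 k + 4) <= e^(6 k)], as [k >= 1]. *)
  apply: (@le_trans _ _ ((expR (6 * k%:R)) `^ z)); last by rewrite -expRM mulrA.
  apply: ge0_ler_powR; rewrite ?nnegrE ?expR_ge0 ?exprn_ge0//.
    by rewrite (le_trans ler01).
  apply: (@le_trans _ _ (expR 2%:R ^+ k.+2)).
    rewrite lerXn2r ?nnegrE ?expR_ge0//; by apply: le_trans (exp2_le_expR 2); lra.
  by rewrite -expRM_natl ler_expR -!natr1; move: k1; lra.
have hQJ : (4 * ((3 ^+ k.+2) `^ z) / (eps / 8)) ^+ J <= expR (3531 * unit).
  have Q0 : 0 <= 4 * ((3 ^+ k.+2) `^ z) / (eps / 8).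
    by rewrite divr_ge0 ?divr_ge0 ?(ltW eps_gt0)// mulr_ge0 ?powR_ge0.
  apply: (@le_trans _ _ (expR (5%:R * L + 6 * (k%:R * z)) ^+ J)).
    by rewrite lerXn2r ?nnegrE ?expR_ge0.
  rewrite -expRM_natl ler_expR.
  apply: (@le_trans _ _ (321 * Y * (5%:R * L + 6 * (k%:R * z)))).
    rewrite ler_wpM2r// addr_ge0 ?mulr_ge0 ?(ltW L0)// (le_trans ler01)//.
  have -> : 321 * Y * (5%:R * L + 6 * (k%:R * z)) = 1605 * (Y * L) + 1926 * (Y * (k%:R * z)) by ring.
  by move: (Y * L) (Y * _) YL Yk => ? ?; lra.
set A := _ ^+ _ in hMs *; set B := _ ^+ _ in hQJ *.
have A0 : 0 <= A by rewrite exprn_ge0.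
have B0 : 0 <= B.
  by rewrite exprn_ge0// divr_ge0 ?divr_ge0 ?(ltW eps_gt0)// mulr_ge0 ?powR_ge0.
clearbody A B.
(* [40] is the factor 2 of the two-sided tail times the inverse of the target [1 / 20]. *)
have h40 : 40 <= expR (6 * unit).
  apply: (le_trans forty_le_expR6).
  by rewrite ler_expR ler_peMr.
set D := expR (- _).
have DE : D <= expR (- (2 ^+ 14 * unit)).
  rewrite /D ler_expR lerN2 (le_trans budget')// le_eqVlt; apply/orP; left; apply/eqP.
  by field.
have D0 : 0 <= D by exact: expR_ge0.
have : A * B * D * 40 <= expR (4845 * unit) * expR (3531 * unit) * expR (- (2 ^+ 14 * unit)) * expR (6 * unit).
  by rewrite !ler_pM ?mulr_ge0.
rewrite -!expRD => h.
have : expR (4845 * unit + 3531 * unit + - (2 ^+ 14 * unit) + 6 * unit) <= 1.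
  rewrite -[leRHS]expR0 ler_expR (exprD _ 10 4) p10.
  exact: exponent_budget.
move=> h'; have := le_trans h h'.
rewrite (_ : A * (2 * D) * B = A * B * D * 2); last by ring.
by rewrite ler_pdivlMr//; move: (A * B * D) => X; rewrite -mulrA -natrM.
Qed.

End NetSizes.

(** * Main theorem *)

Section MainTheorem.
Local Open Scope ereal_scope.
Context (R : realType) (disp : measure_display) (T : measurableType disp).
Context (P : probability T R) (d t : nat) (G : 'I_t -> 'I_d -> {RV P >-> R}).
Hypothesis G_iid : iid_gaussian_entries G.
Hypothesis t_gt0 : (0 < t)%N.
Context (k : nat) (z eps : R).
Hypotheses (z_ge1 : (1 <= z)%R) (eps_gt0 : (0 < eps)%R) (eps_lt1 : (eps < 1)%R).
Context (N : nat) (p : 'I_N -> 'cV[R]_d) (F : set 'cV[R]_d).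
Hypothesis p_inj : injective p.
Hypothesis F_opt : is_optimal_flat k z (range p) F.

Local Notation OPT := (cost z (range p) F).
Local Notation Gw := (random_map G).
Local Notation Gmx w := (\matrix_(i < t, j < d) G i j w)%R.

Let z_gt0 : (0 < z)%R. Proof. exact: lt_le_trans z_ge1. Qed.
Let F_flat : is_flat k F. Proof. by case: F_opt. Qed.

Definition collision := [set w | exists ij : 'I_N * 'I_N,
  ij.1 != ij.2 /\ Gw w (p ij.1 - p ij.2) = 0%R].

Let measurable_zero v : measurable [set w | Gw w v = 0%R].
Proof.
rewrite (_ : [set w | _] = [set w | gsq G v w = 0%R]).
  by apply: measurable_fun_eq0; exact: measurable_gsq.
apply/seteqP; split => w /=; rewrite /gsq; first by move=> ->; rewrite dot0l.
by move=> /eqP; rewrite dot_eq0 => /eqP.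
Qed.

Let measurable_pair (ij : 'I_N * 'I_N) :
  measurable [set w | ij.1 != ij.2 /\ Gw w (p ij.1 - p ij.2) = 0%R].
Proof.
case: (ij.1 != ij.2).
  rewrite (_ : [set w | _] = [set w | Gw w (p ij.1 - p ij.2) = 0%R])//.
  by apply/seteqP; split => w //= [].
by rewrite (_ : [set w | _] = set0)//; apply/seteqP; split => w //= [].
Qed.

Lemma measurable_collision : measurable collision.
Proof. exact: measurable_finite_exists. Qed.

Lemma collision_null : P collision <= 0.
Proof.
have := @finite_union_bound _ _ _ P _ _ 0%R measurable_pair.
rewrite mulr0; apply => ij; have := measurable_pair ij.
case: (boolP (ij.1 != ij.2)) => ij12 mA; last first.
  rewrite (_ : [set w | _] = set0) ?measure0//.
  by apply/seteqP; split => w //= [].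
have v0 : (p ij.1 - p ij.2 != 0)%R.
  by rewrite subr_eq0; apply: contra ij12 => /eqP/p_inj ->.
have /eqP := random_map_kernel_null G_iid t_gt0 v0; rewrite eq_le => /andP[+ _].
apply: le_trans; apply: le_measure; rewrite ?inE; [exact: mA|exact: measurable_zero|].
by move=> w /= [].
Qed.

Lemma not_collision_inj w : ~ collision w -> injective (fun i => Gw w (p i)).
Proof.
move=> nc i j ij; apply/eqP/negPn/negP => ne; apply: nc; exists (i, j); split => //=.
by rewrite /random_map mulmxBr -/(Gw w _) -/(Gw w _) ij subrr.
Qed.

Lemma range_image w : Gw w @` range p = range (fun i => Gw w (p i)).
Proof. by rewrite image_comp. Qed.

Lemma OPTE : OPT = lz z (fun i => fdist F (p i)).
Proof. exact: cost_range_inj. Qed.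

Definition overshoot := [set w | ((1 + eps) `^ z * \sum_i fdist F (p i) `^ z <
  \sum_i l2norm (Gw w (p i - closest F (p i))) `^ z)%R].

Lemma measurable_overshoot : measurable overshoot.
Proof.
rewrite -[X in measurable X]setTI; apply: measurable_fun_ltr => //.
apply: measurable_sum => i; apply: (measurableT_comp (measurable_powR z)).
rewrite (_ : (fun w => _) = (fun w => Num.sqrt (gsq G (p i - closest F (p i)) w))); last first.
  by apply/funext => w; rewrite l2normE.
apply: measurableT_comp; last exact: measurable_gsq.
exact: (continuous_measurable_fun (@sqrt_continuous R)).
Qed.

Lemma not_overshoot w : ~ overshoot w ->
  (lz z (fun i => l2norm (Gw w (p i - closest F (p i)))) <= (1 + eps) * OPT)%R.
Proof.
move=> /negP; rewrite -leNgt => h; have e1 : (0 <= 1 + eps)%R by rewrite addr_ge0// ltW.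
apply: lz_le_sum => //; first by rewrite mulr_ge0// cost_ge0.
rewrite powRM ?cost_ge0// OPTE lz_powR//.
under eq_bigr do rewrite ger0_norm ?l2norm_ge0//.
apply: le_trans h _; rewrite ler_wpM2l ?powR_ge0//.
by apply: ler_sum => i _; rewrite ger0_norm ?l2norm_ge0.
Qed.

Lemma upper_bound w F' : ~ collision w -> ~ overshoot w ->
  is_optimal_flat k z (range (fun i => Gw w (p i))) F' ->
  (cost z (range (fun i => Gw w (p i))) F' <= (1 + eps) * OPT)%R.
Proof.
move=> /not_collision_inj inj /not_overshoot h [fF' F'min].
have fGF := flat_image (Gmx w) F_flat.
apply: le_trans (F'min _ fGF) _; apply: le_trans h.
rewrite cost_range_inj//; apply: lz_mono => // i.
rewrite !ger0_norm ?l2norm_ge0//.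
rewrite /random_map mulmxBr; apply: (closest_le _ fGF).
by exists (closest F (p i)) => //; exact: closest_mem F_flat.
Qed.

Hypothesis overshoot_le : P overshoot <= (1 / 20)%:E.
Hypothesis lower_parameters : exists J M : nat, [/\ (0 < M)%N,
  (6 * (k.+1 + J)%:R <= eps / 8 * M%:R)%R,
  ((1 + (eps / 8 / 3) ^- 2) ^+ k.+1 * (1 - eps / 8 / 2) ^+ J < 1)%R &
  ((M + M).+1%:R ^+ (k.+1 + J) * (2 * expR (- ((eps / 8) ^+ 2 * t%:R / 2048))) *
    (4 * ((3 ^+ k.+2) `^ z) / (eps / 8)) ^+ J <= 1 / 20)%R].

(** The descent is applied with [e = eps / 8], for which [1 + 8 e] is exactly [1 + eps]; its
    hypothesis [upper] holds off [overshoot], as [1 + eps <= 2]. A zero optimum is separated because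
    the sensitivities are normalised by [OPT]. *)
Lemma lower_bound : exists B : set T, [/\ measurable B, P B <= (1 / 20)%:E &
  forall w F', ~ collision w -> ~ overshoot w -> ~ B w ->
    is_flat k F' ->
    ((1 + eps)^-1 * OPT <= cost z (range (fun i => Gw w (p i))) F')%R].
Proof.
have [OPT0|OPTn0] := eqVneq OPT 0%R.
  exists set0; split => //; first by rewrite measure0 lee_fin divr_ge0.
  by move=> w F' _ _ _ _; rewrite OPT0 mulr0 cost_ge0.
have OPT_gt0 : (0 < lz z (fun i => fdist F (p i)))%R.
  by rewrite -OPTE lt_neqAle eq_sym OPTn0 cost_ge0.
have opt F' : is_flat k F' ->
    (lz z (fun i => fdist F (p i)) <= lz z (fun i => fdist F' (p i)))%R.
  rewrite -(cost_range_inj z F p_inj) -(cost_range_inj z F' p_inj).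
  by case: F_opt => _; apply.
have [K [K0 K3 Ks]] := flat_sensitivity z_ge1 F_flat OPT_gt0 opt.
have [J [M [M0 M6 Jlt fail]]] := lower_parameters.
have [ws0 [sz0 span0]] := flat_span F_flat.
have e0 : (0 < eps / 8)%R by rewrite divr_gt0.
have e1 : (eps / 8 <= 1)%R by move: eps_lt1; lra.
have e8 : (eps / 8 <= 8^-1)%R by move: eps_lt1; lra.
have Q1 : (1 <= (3 ^+ k.+2) `^ z)%R.
  rewrite -[leLHS](powRr0 (3 ^+ k.+2)) ler_powR ?exprn_ege1 ?ler1n//.
  exact: ltW.
have KQ : (\sum_i K i `^ z <= (3 ^+ k.+2) `^ z)%R.
  rewrite (eq_bigr (fun i => `|K i| `^ z)%R); last by move=> i _; rewrite ger0_norm.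
  by rewrite -lz_powR//; apply: le_powz => //; exact: lz_ge0.
exists [set w | bad_iter z (eps / 8) p K (Gmx w) M J ws0]; split.
- exact: measurable_bad_iter.
- apply: (le_trans (bad_iter_tail G_iid t_gt0 M e0 e1 p Q1 KQ (s := (k.+1 + J)%N) _)).
    by rewrite leq_add2r.
  by rewrite lee_fin.
move=> w F' /not_collision_inj inj /not_overshoot h nB fF'.
rewrite leNgt; apply/negP => lt; apply: nB.
apply: (bad_iter_of_failure z_ge1 e0 e8 F_flat fF' span0 K0 OPT_gt0 opt Ks) => //.
- rewrite OPTE in h; apply: le_trans h _; rewrite ler_wpM2r ?(ltW OPT_gt0)//.
  by move: eps_lt1; lra.
- rewrite -OPTE mulrC mulrCA divff// mulr1.
  by move: lt; rewrite cost_range_inj// mulrC.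
- by apply: le_trans M6; rewrite ler_pM2l// ler_nat leq_add2r.
Qed.

(** The exceptional sets have probabilities 0, [1 / 20] and [1 / 20]; off them, any optimal flat of
    the image, which exists by compactness, is a witness. *)
Lemma good_event_probability : let good := [set w : T | exists F' : set 'cV[R]_t,
      is_optimal_flat k z (Gw w @` range p) F' /\
      ((1 + eps)^-1 * OPT <= cost z (Gw w @` range p) F')%R /\
      (cost z (Gw w @` range p) F' <= (1 + eps) * OPT)%R] in
  measurable good /\ (9 / 10)%:E <= P good.
Proof.
move=> good.
have mgood : measurable good.
  have := @measurable_optimal_cost R _ T t k N z z_gt0 (fun i w => Gw w (p i)) _
    ((1 + eps)^-1 * OPT)%R ((1 + eps) * OPT)%R.
  rewrite (_ : [set w | _] = good); last first.
    by apply/funext => w; rewrite /good /= range_image.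
  apply => i l; rewrite (_ : (fun w => _) = grow G l (p i)); first exact: measurable_grow.
  by apply/funext => w; rewrite random_mapE.
split => //; have [B [mB PB HB]] := lower_bound.
have sub : ~` good `<=` (collision `|` overshoot) `|` B.
  move=> w ng; apply: contrapT => nb; apply: ng.
  have nc : ~ collision w by move=> ?; apply: nb; left; left.
  have no : ~ overshoot w by move=> ?; apply: nb; left; right.
  have nB : ~ B w by move=> ?; apply: nb; right.
  have fin : finite_set (range (fun i => Gw w (p i))).
    by apply: finite_image; exact: finite_finset.
  have [F' optF'] := exists_optimal_flat k z_gt0 fin.
  exists F'; rewrite range_image; split => //; split.
    by apply: HB => //; case: optF'.
  exact: upper_bound.
have PC : P (~` good) <= (1 / 10)%:E.
  have mco : measurable (collision `|` overshoot).
    by apply: measurableU; [exact: measurable_collision|exact: measurable_overshoot].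
  apply: (@le_trans _ _ (P ((collision `|` overshoot) `|` B))).
    by apply: le_measure; rewrite ?inE//; [exact: measurableC|exact: measurableU].
  apply: (le_trans (measureU2 _ mco mB)).
  have h := le_trans (measureU2 P measurable_collision measurable_overshoot)
    (leeD collision_null overshoot_le); rewrite add0e in h.
  apply: (le_trans (leeD h PB)); rewrite -EFinD lee_fin; lra.
have := probability_setC P mgood => E; rewrite E in PC.
move: PC; have : P good \is a fin_num by exact: fin_num_measure.
move: (P good) => [x| |]// _; rewrite -EFinB !lee_fin; lra.
Qed.

End MainTheorem.

Theorem theorem6p1 (R : realType) :
  exists C C' : R, 0 < C /\ 0 < C' /\
  forall (d k : nat) (z : R) (X F : set 'cV[R]_d) (eps : R) (t : nat),
    (0 < k)%N -> 1 <= z -> finite_set X -> is_optimal_flat k z X F ->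
    0 < eps -> eps < 1 ->
    C * (z * k%:R ^+ 2 * (1 + ln (k%:R / eps)) `^ C' / eps ^+ 3) <= t%:R ->
  forall (disp : measure_display) (T : measurableType disp)
    (P : probability T R) (G : 'I_t -> 'I_d -> {RV P >-> R}),
    iid_gaussian_entries G ->
    let good := [set w : T | exists F' : set 'cV[R]_t,
      is_optimal_flat k z (random_map G w @` X) F' /\
      (1 + eps)^-1 * cost z X F <= cost z (random_map G w @` X) F' /\
      cost z (random_map G w @` X) F' <= (1 + eps) * cost z X F] in
    measurable good /\ ((9 / 10)%:E <= P good)%E.
Proof.
(* [2 ^+ 31] is [2 ^+ 17 * 2 ^+ 14], the denominator of the tail exponent times the budget. Of the
   two logarithms, one comes from the number of steps and one from the size of the grid. *)
exists (2 ^+ 31), 2; split; first by rewrite exprn_gt0.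
split=> // d k z X F eps t k0 z1 finX optF e0 e1 t_ge disp T P G iid.
have a1 : 1 <= k%:R / eps.
  by rewrite ler_pdivlMr// mul1r (le_trans (ltW e1))// ler1n.
have L1 : 1 <= 1 + ln (k%:R / eps) by rewrite lerDl ln_ge0.
have {}t_ge : 2 ^+ 31 * (z * k%:R ^+ 2 * (1 + ln (k%:R / eps)) ^+ 2 / eps ^+ 3) <= t%:R.
  by move: t_ge; rewrite powR_mulrn// (le_trans ler01).
have t0 : (0 < t)%N.
  rewrite -(ltr0n R); apply: lt_le_trans t_ge.
  have L0 := lt_le_trans ltr01 L1; have z0 := lt_le_trans ltr01 z1.
  by rewrite mulr_gt0 ?divr_gt0 ?mulr_gt0 ?exprn_gt0 ?ltr0n.
have over := overshoot_bound_small k0 e0 e1 z1 t_ge.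
have low := exists_net_parameters k0 e0 e1 z1 t_ge.
(* The enumeration has no repetitions, so [cost] over the set is a plain indexed sum. *)
have [s us XE] : exists2 s : seq 'cV[R]_d, uniq s & X = [set` s].
  have [s0 ->] := (finite_seqP X).1 finX; exists (undup s0); first exact: undup_uniq.
  by apply/seteqP; split => x /=; rewrite mem_undup.
pose p (i : 'I_(size s)) := s`_i.
have Xp : X = range p.
  rewrite XE; apply/seteqP; split => [x /= xs|_ [i _ <-]]; last by rewrite /= mem_nth.
  have h : (index x s < size s)%N by rewrite index_mem.
  by exists (Ordinal h) => //; rewrite /p /= nth_index.
have p_inj : injective p.
  by move=> i j /eqP; rewrite nth_uniq// => /eqP/val_inj.
rewrite Xp in optF *.
apply: good_event_probability => //.
apply: (le_trans (random_map_sum_tail iid t0 _ z1 e0 e1 (z_le_eps_dim k0 e0 e1 z1 t_ge))).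
by rewrite lee_fin.
Qed.
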